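(* Let $\Phi$ be a Young function with $\Phi(x)/x^2\to\infty$ as $x\to0+$. Then the following hold. (i) There exists a singular inner function $\Theta$ such that for any $f\in K_\Theta$, $$\sum_{n=0}^\infty \Phi\big(|\widehat f(n)|\big)<\infty \implies f\equiv 0.$$ (ii) There exists an outer function $b$, which is a holomorphic self-map $b:\mathbb{D}\to\mathbb{D}$, such that for any $f\in\mathcal{H}(b)$, $$\sum_{n=0}^\infty \Phi\big(|\widehat f(n)|\big)<\infty \implies f\equiv 0.$$
   Context: $\mathbb{D}$ is the open unit disc, $\mathbb{T}$ the unit circle, $m$ normalized Lebesgue measure on $\mathbb{T}$. For a holomorphic function $f$ on $\mathbb{D}$, $(\widehat f(n))_{n\ge0}$ denotes its Taylor coefficients at $0$. $H^2$ is the Hardy space of holomorphic $f$ on $\mathbb{D}$ with $\sum_{n\ge0}|\widehat f(n)|^2<\infty$. A Young function is a convex function $\Phi$ on $[0,\infty)$ with $\Phi(0)=0$, $\Phi(x)>0$ for $x>0$, and $\Phi(2x)\asymp\Phi(x)$ as $x\to0$ (two-sided bounds with positive constants for small $x>0$). A singular inner function is a function of the form $\Theta(z)=\exp\left(-\int_{\mathbb{T}}\frac{\zeta+z}{\zeta-z}\,d\nu(\zeta)\right)$, $z\in\mathbb{D}$, with $\nu$ a non-zero positive finite Borel measure on $\mathbb{T}$ singular with respect to $m$. For an inner function $\Theta$, the model space is $K_\Theta=H^2\ominus\Theta H^2$. For a holomorphic $b:\mathbb{D}\to\mathbb{D}$, the de Branges-Rovnyak space $\mathcal{H}(b)$ is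 the reproducing kernel Hilbert space of holomorphic functions on $\mathbb{D}$ with reproducing kernel $\frac{1-\overline{b(\lambda)}b(z)}{1-\overline{\lambda}z}$, $z,\lambda\in\mathbb{D}$. *)

(* Defs.v *)
From HB Require Import structures.
From mathcomp Require Import all_boot all_order all_algebra.
From mathcomp Require Import all_classical all_reals all_analysis.
From mathcomp Require Import complex.

Set Implicit Arguments.
Unset Strict Implicit.
Unset Printing Implicit Defensive.

Import Order.TTheory GRing.Theory Num.Theory.
Import numFieldNormedType.Exports.
Import ComplexField.Normc.

Local Open Scope classical_set_scope.
Local Open Scope ring_scope.

(* R[i] packed as a numClosedFieldType, so that it carries the library's
   topology, and its normed module structure over itself: [derivable] and
   [derive1n] on [Cplx R -> Cplx R] are complex differentiation. *)
Definition Cplx (R : realType) : numClosedFieldType := R[i].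

Definition cexp (R : realType) (z : Cplx R) : Cplx R :=
  Complex (expR (complex.Re z) * cos (complex.Im z))
          (expR (complex.Re z) * sin (complex.Im z)).

Definition expi (R : realType) (t : R) : Cplx R := Complex (cos t) (sin t).

Definition disc (R : realType) : set (Cplx R) := [set z | `|z| < 1].

(* Functions on the disc are represented by functions on the whole of [Cplx R]
   whose values outside the disc are irrelevant. *)
Definition holomorphic (R : realType) (f : Cplx R -> Cplx R) : Prop :=
  forall z, disc z -> derivable f z 1.

Definition taylor (R : realType) (f : Cplx R -> Cplx R) (n : nat) : Cplx R :=
  derive1n n f 0 / n`!%:R.

Definition H2 (R : realType) (f : Cplx R -> Cplx R) : Prop :=
  holomorphic f /\
  (\sum_(0 <= n <oo) (normc (taylor f n) ^+ 2)%:E < +oo)%E.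

(* <f, g> = 0 for f, g in H^2, with <f, g> = \sum_n f^(n) conj(g^(n)). *)
Definition H2_orthogonal (R : realType) (f g : Cplx R -> Cplx R) : Prop :=
  series (fun n => taylor f n * (taylor g n)^* : Cplx R) @ \oo
    --> (0 : Cplx R).

Definition model_space (R : realType) (Theta : Cplx R -> Cplx R) :
    set (Cplx R -> Cplx R) :=
  [set f | H2 f /\ forall g, H2 g -> H2_orthogonal f (Theta \* g)].

(* The complex plane with its Borel sigma-algebra.  Borel measures on the
   circle are represented by the measures on it giving mass 0 to the complement
   of the circle. *)
Definition CplxB (R : realType) := g_sigma_algebraType (@open (Cplx R)).

Definition circle (R : realType) : set (CplxB R) :=
  [set z : Cplx R | `|z| = 1].

Lemma continuous_expi (R : realType) : continuous (@expi R).
Proof.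
have cC : continuous (fun x : R => Complex x 0 : Cplx R).
  move=> x; apply/cvgrPdist_lt => e e0.
  have /andP[/eqP Ie0 Re0] : (complex.Im e == 0) && (0 < complex.Re e).
    by move: e0; rewrite ltcE.
  near=> y.
  have -> : (Complex x 0 - Complex y 0 : Cplx R) = Complex (x - y) 0.
    by rewrite -[LHS]/(Complex (x - y) (0 - 0)) subr0.
  rewrite normc_def ltcE /= Ie0 eqxx/= expr0n/= addr0 sqrtr_sqr.
  by near: y; exact: cvgr_dist_lt.
have -> : @expi R = (fun t => Complex (cos t) 0 + Complex 0 1 * Complex (sin t) 0).
  apply/funext => t; rewrite /expi.
  rewrite -[RHS]/(Complex (cos t + (0 * sin t - 1 * 0)) (0 + (0 * 0 + 1 * sin t))).
  by rewrite !mul0r mulr0 subr0 addr0 !add0r mul1r.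
move=> t; apply: (@cvgD _ (Cplx R)).
  exact: (continuous_comp (@continuous_cos R t) (cC _)).
apply: (@cvgM (Cplx R)); first exact: cvg_cst.
exact: (continuous_comp (@continuous_sin R t) (cC _)).
Unshelve. all: by end_near. Qed.

Lemma measurable_expi (R : realType) :
  measurable_fun [set: measurableTypeR R] (@expi R : _ -> CplxB R).
Proof.
apply: (@measurability _ _ (measurableTypeR R) (CplxB R) setT (@expi R)
  (@open (Cplx R))) => // _ [U oU <-].
rewrite setTI; apply: measurable_realfun.open_measurable.
by move/continuousP : (@continuous_expi R); exact.
Qed.

Definition expiB (R : realType) : measurableTypeR R -> CplxB R := @expi R.

HB.instance Definition _ (R : realType) :=
  @isMeasurableFun.Build _ _ (measurableTypeR R) (CplxB R) (@expiB R)
    (@measurable_expi R).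

Lemma pi2_gt0 (R : realType) : 0 < 2 * (pi : R).
Proof. by rewrite mulr_gt0 ?pi_gt0. Qed.

(* Normalized Lebesgue measure m, as the image of dt / (2 pi) on [0, 2 pi]
   under t |-> e^{it}. *)
Definition circle_measure (R : realType) : probability (CplxB R) R :=
  distribution (uniform_prob (@pi2_gt0 R))
    (@expiB R).

Definition mutually_singular d (T : measurableType d) (R : realType)
    (mu nu : set T -> \bar R) : Prop :=
  exists A, [/\ measurable A, mu A = 0%E & nu (~` A) = 0%E].

Definition cintegral d (T : measurableType d) (R : realType)
    (mu : {measure set T -> \bar R}) (D : set T) (f : T -> Cplx R) : Cplx R :=
  Complex (\int[mu]_(x in D) complex.Re (f x)) (\int[mu]_(x in D) complex.Im (f x)).

Definition herglotz_kernel (R : realType) (z zeta : Cplx R) : Cplx R :=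
  (zeta + z) / (zeta - z).

Definition singular_inner (R : realType) (Theta : Cplx R -> Cplx R) : Prop :=
  exists nu : {finite_measure set (CplxB R) -> \bar R},
    [/\ nu (~` @circle R) = 0%E,
        nu (@circle R) != 0%E,
        mutually_singular (@circle_measure R) nu &
        forall z, disc z ->
          Theta z = cexp (- cintegral nu (@circle R) (herglotz_kernel z))].

(* b(z) = c exp(\int_T (zeta + z)/(zeta - z) log(phi(zeta)) dm(zeta)) on the
   disc, with |c| = 1, phi > 0 measurable on T and log(phi) in L^1(m). *)
Definition outer (R : realType) (b : Cplx R -> Cplx R) : Prop :=
  exists (c : Cplx R) (phi : CplxB R -> R),
    [/\ `|c| = 1,
        measurable_fun (@circle R) phi /\
          (forall zeta, circle zeta -> 0 < phi zeta),
        (@circle_measure R).-integrable (@circle R)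
          (fun zeta => (ln (phi zeta))%:E) &
        forall z, disc z ->
          b z = c * cexp (cintegral (@circle_measure R) (@circle R)
            (fun zeta => herglotz_kernel z zeta
                         * (Complex (ln (phi zeta)) 0 : Cplx R)))].

Definition holomorphic_self_map (R : realType) (b : Cplx R -> Cplx R) : Prop :=
  holomorphic b /\ (forall z, disc z -> disc (b z)).

(* (H, ip) is a Hilbert space of holomorphic functions on the disc with
   reproducing kernel k, where [k lambda] is the kernel function at lambda.
   Since values outside the disc are irrelevant, H is closed under equality on
   the disc, and ip f f = 0 means that f vanishes on the disc. *)
Record is_rkhs (R : realType) (k : Cplx R -> Cplx R -> Cplx R)
    (H : set (Cplx R -> Cplx R))
    (ip : (Cplx R -> Cplx R) -> (Cplx R -> Cplx R) -> Cplx R) : Prop := IsRKHS {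
  rkhs_holomorphic : forall f, H f -> holomorphic f ;
  rkhs_eq : forall f g, H f -> (forall z, disc z -> f z = g z) -> H g ;
  rkhs_linear : forall (a : Cplx R) f g,
    H f -> H g -> H (fun z => a * f z + g z) ;
  rkhs_ip_linear : forall (a : Cplx R) f g h, H f -> H g -> H h ->
    ip (fun z => a * f z + g z) h = a * ip f h + ip g h ;
  rkhs_ip_conj : forall f g, H f -> H g -> ip g f = (ip f g)^* ;
  rkhs_ip_ge0 : forall f, H f -> 0 <= ip f f ;
  rkhs_ip_eq0 : forall f, H f ->
    (ip f f = 0 <-> forall z, disc z -> f z = 0) ;
  rkhs_complete : forall u : nat -> Cplx R -> Cplx R, (forall n, H (u n)) ->
    (forall e : Cplx R, 0 < e -> exists N : nat,
      forall m n, (N <= m)%N -> (N <= n)%N ->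
        ip (u m \- u n) (u m \- u n) < e) ->
    exists2 f, H f &
      (ip (u n \- f) (u n \- f) : Cplx R) @[n --> \oo] --> (0 : Cplx R) ;
  rkhs_kernel : forall lambda, disc lambda -> H (k lambda) ;
  rkhs_reproducing : forall f lambda, H f -> disc lambda ->
    ip f (k lambda) = f lambda
}.

(* Such an H exists and is determined by the kernel (Moore-Aronszajn). *)
Definition deBranges_Rovnyak (R : realType) (b : Cplx R -> Cplx R) :
    set (Cplx R -> Cplx R) :=
  [set f | exists H ip,
    is_rkhs (fun lambda z => (1 - (b lambda)^* * b z) / (1 - lambda^* * z)) H ip
    /\ H f].

Definition young_function (R : realType) (Phi : R -> R) : Prop :=
  [/\ convex_function (`[0, +oo[%classic : set R) Phi,
      Phi 0 = 0,
      forall x, 0 < x -> 0 < Phi x &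
      exists c C : R, [/\ 0 < c, 0 < C &
        \forall x \near 0^'+, c * Phi x <= Phi (2 * x) <= C * Phi x]].

(* Main.v *)
Require Import Defs.
From HB Require Import structures.
From mathcomp Require Import all_boot all_order all_algebra.
From mathcomp Require Import all_classical all_reals all_analysis.
From mathcomp Require Import complex ring lra zify.

Set Implicit Arguments.
Unset Strict Implicit.
Unset Printing Implicit Defensive.

Import Order.TTheory GRing.Theory Num.Theory.
Import numFieldNormedType.Exports.
Import ComplexField.Normc.

Local Open Scope classical_set_scope.
Local Open Scope ring_scope.

(** Both parts rest on one duality and one construction.

    Duality ([orlicz_duality]). Since Phi x / x ^ 2 tends to infinity at 0, a
    sequence y with bounded l2 norm and with sufficiently small entries acts on
    the sequences x with finite sum of Phi (x n) as a functional of arbitrarily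
    small norm: where x n is small, x n ^ 2 is much smaller than Phi (x n), and
    elsewhere x n is at most a multiple of Phi (x n) by convexity. Hence, if f is
    orthogonal, or almost orthogonal, to functions z ^ k G_i with G_i(0) = 1,
    with bounded l2 norm and with nonconstant coefficients that are small enough
    relative to that norm, then the k-th coefficient of f vanishes
    ([coef_small]).

    Construction ([block]). Let V be a polynomial whose real part v has values in
    [0, L] on the circle. Replacing v by v + a v (L - v) / L cos (N t) keeps the
    range and decreases the mean of v (L - v) by a fixed amount. When the
    frequency N is large, the terms of the exponential series occupy disjoint
    frequency windows, so that the nonconstant coefficients of the functions
    exp (- (V - W)), for finitely many given W, become at most a constant times
    a ([coef_step]). Taking a small and iterating, v becomes close to a function
    with the two values 0 and L, while the coefficients remain small and the low
    frequencies of V are unchanged.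

    Singular inner functions. Start from V_0 = 1 and apply the construction with
    L = 2 ^ n at the n-th step ([singular_sequence]). The densities v_n have mean
    1 and live essentially on sets of measure 2 ^ - n, so that the measures
    v_n m converge to a singular measure nu ([circle_weak_limit],
    [nu_singular]). The inner function of nu is Theta = lim exp (- V_n). Testing
    f in the model space against Theta z ^ k exp (V_i) = z ^ k G_i, with
    G_i = lim exp (- (V_n - V_i)), gives the conclusion.

    Outer functions. For each n the construction is started from the constant
    C (1 - d), where L = C, d = 2 ^ (- n - 2) and C d = 2 n + 1; the ratio
    q_n = v_n / C has mean 1 - d and is close to an indicator function. Let w be
    the product of the q_n and let b be the outer function with modulus
    exp (- w). The test function F_n = exp (- (V_n - C (1 - d))) is concentrated
    where q_n, and hence w, is small, so that the l2 norms of F_n and of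
    F_n / b almost coincide ([Ftest_weight], [gg_sum]). This forces the
    functional f |-> <f, F_n> to be small on H(b) ([rkhs_test]), and the duality
    applies again.

    The complex analysis is developed first: Goursat's theorem on rectangles in
    logarithmic coordinates gives the mean value property, from which Cauchy's
    formula, Taylor series and Parseval's identity follow. *)

(** * The modulus, real part and imaginary part *)

Section ComplexBasics.
Variable R : realType.
Local Notation C := (Cplx R).
Implicit Types z w : C.

Lemma normcE z : `|z| = (normc z)%:C%C :> C.
Proof. by case: z => a b; rewrite normc_def. Qed.

Lemma normc_ge0 z : 0 <= normc z.
Proof. by rewrite -ler0c -normcE. Qed.

Lemma normc_lt z (r : R) : (`|z| < r%:C%C) = (normc z < r).
Proof. by rewrite normcE ltcR. Qed.

Lemma normcB z w : normc (z - w) = normc (w - z).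
Proof. by rewrite -opprB normcN. Qed.

Lemma normcD_le z w : normc (z + w) <= normc z + normc w.
Proof. exact: le_normcD. Qed.

Lemma normcB_le z w : normc (z - w) <= normc z + normc w.
Proof. by rewrite (le_trans (normcD_le _ _))// normcN. Qed.

Lemma normc_dist_le z w : `|normc z - normc w| <= normc (z - w).
Proof.
rewrite ler_norml; apply/andP; split.
  by have := normcB_le z (z - w); rewrite opprB addrC subrK; lra.
by rewrite lerBlDr; have := normcD_le (z - w) w; rewrite subrK.
Qed.

Lemma normcX z n : normc (z ^+ n) = normc z ^+ n.
Proof. by elim: n => [|n IH]; rewrite ?expr0 ?normc1// !exprS normcM IH. Qed.

Lemma normc_real (x : R) : normc (x%:C%C : C) = `|x|.
Proof. by rewrite /normc /= expr0n /= addr0 sqrtr_sqr. Qed.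

Lemma normc_nat n : normc (n%:R : C) = n%:R.
Proof.
have -> : n%:R = (n%:R : R)%:C%C :> C by rewrite rmorph_nat.
by rewrite normc_real ger0_norm.
Qed.

Lemma normc_eq0 z : (normc z == 0) = (z == 0).
Proof. by apply/eqP/eqP => [/eq0_normc //|->]; rewrite normc0. Qed.

Lemma normc_gt0 z : (0 < normc z) = (z != 0).
Proof. by rewrite lt_def normc_eq0 normc_ge0 andbT. Qed.

Lemma normc0C : normc (0 : C) = 0. Proof. exact: normc0. Qed.
Lemma normc1C : normc (1 : C) = 1. Proof. exact: normc1. Qed.

Lemma normc_sqr z : normc z ^+ 2 = complex.Re z ^+ 2 + complex.Im z ^+ 2.
Proof. by case: z => a b /=; rewrite sqr_sqrtr// addr_ge0// sqr_ge0. Qed.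

Lemma normc_conj z : normc (z^*)%C = normc z.
Proof. by case: z => a b /=; rewrite sqrrN. Qed.

Lemma conjE z : (z^*)%R = (z^*)%C :> C.
Proof.
have [/eqP|z0] := boolP (z == 0); first by move->; rewrite conjC0 conjc0.
apply: (mulfI z0); rewrite -normCK normcE; case: z z0 => a b z0.
rewrite -rmorphXn /= sqr_sqrtr ?addr_ge0 ?sqr_ge0//.
Qed.

Lemma Re_le z : `|complex.Re z| <= normc z.
Proof.
by case: z => a b /=; rewrite -sqrtr_sqr ler_wsqrtr// lerDl sqr_ge0.
Qed.

Lemma Im_le z : `|complex.Im z| <= normc z.
Proof.
by case: z => a b /=; rewrite -sqrtr_sqr ler_wsqrtr// lerDr sqr_ge0.
Qed.

Lemma normc_ReIm z : normc z <= `|complex.Re z| + `|complex.Im z|.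
Proof.
rewrite -(@ler_pXn2r _ 2)// ?nnegrE ?normc_ge0 ?addr_ge0//.
rewrite normc_sqr sqrrD !real_normK ?num_real// lerD2r lerDl.
by rewrite mulrn_wge0// mulr_ge0.
Qed.

Lemma complex_ext z w : complex.Re z = complex.Re w ->
  complex.Im z = complex.Im w -> z = w.
Proof. by case: z => a b; case: w => c d /= -> ->. Qed.

Lemma ReM z w : complex.Re (z * w) =
  complex.Re z * complex.Re w - complex.Im z * complex.Im w.
Proof. by case: z; case: w. Qed.
Lemma ImM z w : complex.Im (z * w) =
  complex.Re z * complex.Im w + complex.Im z * complex.Re w.
Proof. by case: z; case: w. Qed.
Lemma ReD z w : complex.Re (z + w) = complex.Re z + complex.Re w.
Proof. by case: z; case: w. Qed.
Lemma ImD z w : complex.Im (z + w) = complex.Im z + complex.Im w.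
Proof. by case: z; case: w. Qed.
Lemma ReN z : complex.Re (- z) = - complex.Re z. Proof. by case: z. Qed.
Lemma ImN z : complex.Im (- z) = - complex.Im z. Proof. by case: z. Qed.
Lemma ReB z w : complex.Re (z - w) = complex.Re z - complex.Re w.
Proof. by rewrite ReD ReN. Qed.
Lemma ImB z w : complex.Im (z - w) = complex.Im z - complex.Im w.
Proof. by rewrite ImD ImN. Qed.
Lemma Re_sum I (s : seq I) (P : pred I) (F : I -> C) :
  complex.Re (\sum_(i <- s | P i) F i) = \sum_(i <- s | P i) complex.Re (F i).
Proof. by apply: (big_morph (@complex.Re R)) => // x y; rewrite ReD. Qed.
Lemma Im_sum I (s : seq I) (P : pred I) (F : I -> C) :
  complex.Im (\sum_(i <- s | P i) F i) = \sum_(i <- s | P i) complex.Im (F i).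
Proof. by apply: (big_morph (@complex.Im R)) => // x y; rewrite ImD. Qed.


Lemma conj_normc z : (z^*)%C * z = (normc z ^+ 2)%:C%C.
Proof.
rewrite normc_sqr; case: z => a b; apply: complex_ext; rewrite ?ReM ?ImM /=; ring.
Qed.

Lemma normc_sum_le I (s : seq I) (P : pred I) (F : I -> C) :
  normc (\sum_(i <- s | P i) F i) <= \sum_(i <- s | P i) normc (F i).
Proof.
elim/big_ind2 : _ => [|x1 x2 y1 y2 h1 h2|//]; first by rewrite normc0.
by rewrite (le_trans (normcD_le _ _))// lerD.
Qed.

Lemma gt0C (e : C) : 0 < e -> 0 < complex.Re e /\ e = (complex.Re e)%:C%C.
Proof.
by rewrite ltcE => /andP[/eqP I0 r0]; split=> //; apply: complex_ext.
Qed.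

(** Convergence in the plane, tested on the real-valued modulus *)
Lemma cvgCP {T : Type} {F : set_system T} {FF : Filter F} (f : T -> C) (l : C) :
  f x @[x --> F] --> l <-> normc (f x - l) @[x --> F] --> (0 : R).
Proof.
split.
  move=> /cvgrPdist_lt H; apply/cvgrPdist_lt => e e0.
  have e0' : (0 : C) < e%:C%C by rewrite -[0]/((0:R)%:C%C) ltcR.
  near=> x; rewrite sub0r normrN ger0_norm ?normc_ge0// -normc_lt distrC.
  by near: x; exact: H.
move=> /cvgrPdist_lt H; apply/cvgrPdist_lt => e e0.
have [Re0 eE] := gt0C e0.
near=> x.
rewrite eE.
rewrite normc_lt normcB.
have : `|0 - normc (f x - l)| < complex.Re e by near: x; exact: H.
by rewrite sub0r normrN ger0_norm ?normc_ge0.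
Unshelve. all: by end_near. Qed.

Lemma cvg_normc0 {T : Type} {F : set_system T} {FF : Filter F}
    (f : T -> C) (l : C) (g : T -> R) :
  (\forall x \near F, normc (f x - l) <= g x) -> g x @[x --> F] --> (0 : R) ->
  f x @[x --> F] --> l.
Proof.
move=> H g0; apply/cvgCP; apply: (squeeze_cvgr _ (cvg_cst (0:R)) g0).
by near=> x; rewrite normc_ge0/=; near: x.
Unshelve. all: by end_near. Qed.

Lemma cvg_dist0 {T : Type} {F : set_system T} {FF : Filter F} (f : T -> R) (l : R) :
  `|f x - l| @[x --> F] --> (0 : R) -> f x @[x --> F] --> l.
Proof.
move=> /cvgrPdist_lt H; apply/cvgrPdist_lt => e e0; near=> x.
have : `|0 - `|f x - l| | < e by near: x; exact: H.
by rewrite sub0r normrN normr_id distrC.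
Unshelve. all: by end_near. Qed.

Lemma cvg_Re {T : Type} {F : set_system T} {FF : Filter F} (f : T -> C) (l : C) :
  f x @[x --> F] --> l -> complex.Re (f x) @[x --> F] --> (complex.Re l : R).
Proof.
move=> /cvgCP H; apply: cvg_dist0; apply: (squeeze_cvgr _ (cvg_cst (0:R)) H).
by near=> x; rewrite normr_ge0/= -ReB Re_le.
Unshelve. all: by end_near. Qed.

Lemma cvg_Im {T : Type} {F : set_system T} {FF : Filter F} (f : T -> C) (l : C) :
  f x @[x --> F] --> l -> complex.Im (f x) @[x --> F] --> (complex.Im l : R).
Proof.
move=> /cvgCP H; apply: cvg_dist0; apply: (squeeze_cvgr _ (cvg_cst (0:R)) H).
by near=> x; rewrite normr_ge0/= -ImB Im_le.
Unshelve. all: by end_near. Qed.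

Lemma cvg_ReIm {T : Type} {F : set_system T} {FF : Filter F} (f : T -> C) (l : C) :
  complex.Re (f x) @[x --> F] --> (complex.Re l : R) ->
  complex.Im (f x) @[x --> F] --> (complex.Im l : R) -> f x @[x --> F] --> l.
Proof.
move=> h1 h2; apply: (@cvg_normc0 _ _ _ _ _ (fun x =>
  `|complex.Re (f x) - complex.Re l| + `|complex.Im (f x) - complex.Im l|)).
  by near=> x; rewrite -ReB -ImB normc_ReIm.
rewrite -[0]addr0; apply: cvgD.
  by rewrite -(normr0 R) -(subrr (complex.Re l)); apply: cvg_norm;
    apply: cvgB => //; exact: cvg_cst.
by rewrite -(normr0 R) -(subrr (complex.Im l)); apply: cvg_norm;
  apply: cvgB => //; exact: cvg_cst.
Unshelve. all: by end_near. Qed.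

Lemma cvg_normc {T : Type} {F : set_system T} {FF : Filter F} (f : T -> C) (l : C) :
  f x @[x --> F] --> l -> normc (f x) @[x --> F] --> (normc l : R).
Proof.
move=> /cvgCP H; apply: cvg_dist0; apply: (squeeze_cvgr _ (cvg_cst (0:R)) H).
by near=> x; rewrite normr_ge0/= normc_dist_le.
Unshelve. all: by end_near. Qed.

Lemma cvg_conj {T : Type} {F : set_system T} {FF : Filter F} (f : T -> C) (l : C) :
  f x @[x --> F] --> l -> (f x)^*%C @[x --> F] --> (l^*%C : C).
Proof.
move=> /cvgCP H; apply/cvgCP; apply: cvg_trans H; apply: near_eq_cvg.
by near=> x; rewrite -rmorphB normc_conj.
Unshelve. all: by end_near. Qed.

Lemma cvg_RC {T : Type} {F : set_system T} {FF : Filter F} (f : T -> R) (l : R) :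
  f x @[x --> F] --> l -> ((f x)%:C%C : C) @[x --> F] --> (l%:C%C : C).
Proof. by move=> H; apply: cvg_ReIm => //=; exact: cvg_cst. Qed.

End ComplexBasics.

(** * Goursat's theorem on rectangles *)

Section Goursat.
Variable R : realType.
Implicit Types u v U V : R -> R -> R.

Lemma primitive_affine_bound (g k : R -> R) (a b x A B m : R) : a <= b ->
  (forall s, a <= s <= b -> is_derive s 1 g (k s)) ->
  (forall s, a <= s <= b -> `|k s - A - B * (s - x)| <= m) ->
  `|g b - g a - A * (b - a) - B * ((b - x) ^+ 2 - (a - x) ^+ 2) / 2| <= m * (b - a).
Proof.
move=> ab gk km.
pose G s := g s - A * s - B / 2 * (s - x) ^+ 2.
have dG s : a <= s <= b -> is_derive s 1 G (k s - A - B * (s - x)).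
  move=> sab; have := gk s sab => gs.
  rewrite /G; apply: is_derive_eq.
  by rewrite /GRing.scale/= ; field.
have [c cab] : exists2 c, c \in `[a, b] & G b - G a = (k c - A - B * (c - x)) * (b - a).
  apply: (@MVT_segment _ G (fun s => k s - A - B * (s - x))) => //.
    by move=> s; rewrite in_itv/= => /andP[/ltW h1 /ltW h2]; apply: dG; rewrite h1.
  apply: derivable_within_continuous => s; rewrite in_itv/= => sab.
  by have := dG s sab => -[].
move=> E.
have -> : g b - g a - A * (b - a) - B * ((b - x) ^+ 2 - (a - x) ^+ 2) / 2 = G b - G a.
  by rewrite /G; field.
rewrite E normrM (ger0_norm (_ : 0 <= b - a)) ?subr_ge0//.
by apply: ler_wpM2r; [rewrite subr_ge0|apply: km; move: cab; rewrite in_itv].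
Qed.

Let quarter (s s' : R * R * (R * R)) :=
  let: ((a, b), (c, d)) := s in
  let m := (a + b) / 2 in let n := (c + d) / 2 in
  [\/ s' = ((a, m), (c, n)), s' = ((m, b), (c, n)),
      s' = ((a, m), (n, d)) | s' = ((m, b), (n, d))].

Lemma bisection (bad : R * R * (R * R) -> Prop) (x1 x2 y1 y2 : R) :
  x1 < x2 -> y1 < y2 ->
  bad ((x1, x2), (y1, y2)) ->
  (forall s, bad s -> exists2 s', quarter s s' & bad s') ->
  exists x y, [/\ x1 <= x <= x2, y1 <= y <= y2 &
    forall del, 0 < del -> exists a c t, [/\ 0 < t < del,
      x1 <= a <= x /\ x <= a + (x2 - x1) * t <= x2,
      y1 <= c <= y /\ y <= c + (y2 - y1) * t <= y2 &
      bad ((a, a + (x2 - x1) * t), (c, c + (y2 - y1) * t))]].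
Proof.
move=> x12 y12 b0 step.
have next s : exists s', bad s -> quarter s s' /\ bad s'.
  have [/step[s' q b]|nb] := pselect (bad s); first by exists s'.
  by exists s.
have [f fP] := choice next.
pose S n := iter n f ((x1, x2), (y1, y2)).
pose a n := (S n).1.1. pose c n := (S n).2.1.
pose t n := (2^-1 : R) ^+ n.
have t0 n : 0 < t n by rewrite exprn_gt0// invr_gt0.
have SE n : S n = ((a n, a n + (x2 - x1) * t n), (c n, c n + (y2 - y1) * t n)) /\ bad (S n).
  elim: n => [|n [IH1 IH2]].
    by split => //; rewrite /S /a /c /t /= expr0 !mulr1 !subrKC.
  have [q bd] := fP _ IH2.
  split; last by [].
  rewrite /a /c; have -> : S n.+1 = f (S n) by [].
  have -> : t n.+1 = t n / 2 by rewrite /t exprSr.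
  by move: q; rewrite /quarter IH1 => -[] -> /=; congr ((_, _), (_, _)); field.
have mono n : [/\ a n <= a n.+1, c n <= c n.+1,
    a n.+1 + (x2 - x1) * t n.+1 <= a n + (x2 - x1) * t n &
    c n.+1 + (y2 - y1) * t n.+1 <= c n + (y2 - y1) * t n].
  have [E bd] := SE n; have [q _] := fP _ bd.
  have E' : f (S n) = S n.+1 by [].
  have tn : t n.+1 = t n / 2 by rewrite /t exprSr.
  have hx : 0 <= (x2 - x1) * t n by rewrite mulr_ge0 ?ltW// subr_gt0.
  have hy : 0 <= (y2 - y1) * t n by rewrite mulr_ge0 ?ltW// subr_gt0.
  move: q; rewrite E' (SE n.+1).1 E /quarter tn.
  by move=> -[] [h1 h2 h3 h4]; split; nra.
have nest (A : nat -> R) (w : R) : 0 <= w -> (forall n, A n <= A n.+1) ->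
    (forall n, A n.+1 + w * t n.+1 <= A n + w * t n) ->
    exists x, forall n, A n <= x <= A n + w * t n.
  move=> w0 h1 h2.
  have hA m n : (m <= n)%N -> A m <= A n.
    by elim: n => [|n IH]; [rewrite leqn0 => /eqP ->|rewrite leq_eqVlt => /orP[/eqP->//|
      /IH h]; exact: le_trans h (h1 n)].
  have hB m n : (m <= n)%N -> A n + w * t n <= A m + w * t m.
    by elim: n => [|n IH]; [rewrite leqn0 => /eqP ->|rewrite leq_eqVlt => /orP[/eqP->//|
      /IH h]; exact: le_trans (h2 n) h].
  have hAB m n : A m <= A n + w * t n.
    have [mn|/ltnW nm] := leqP m n.
      by rewrite (le_trans (hA _ _ mn))// lerDl mulr_ge0// ltW.
    by rewrite (le_trans _ (hB _ _ nm))// lerDl mulr_ge0// ltW.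
  exists (sup (range A)) => n; apply/andP; split.
    apply: ub_le_sup; last by exists n.
    by exists (A 0%N + w * t 0%N) => _ [m _ <-]; exact: hAB.
  by apply: ge_sup; [exists (A 0%N), 0%N|move=> _ [m _ <-]; exact: hAB].
have [x xP] : exists x, forall n, a n <= x <= a n + (x2 - x1) * t n.
  by apply: nest => [|n|n]; [rewrite subr_ge0 ltW|case: (mono n)|case: (mono n)].
have [y yP] : exists y, forall n, c n <= y <= c n + (y2 - y1) * t n.
  by apply: nest => [|n|n]; [rewrite subr_ge0 ltW|case: (mono n)|case: (mono n)].
have a_ge n : x1 <= a n /\ a n + (x2 - x1) * t n <= x2.
  elim: n => [|n [IH1 IH2]]; first by rewrite /a /t /= expr0 mulr1 subrKC.
  by have [h1 _ h2 _] := mono n; split; lra.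
have c_ge n : y1 <= c n /\ c n + (y2 - y1) * t n <= y2.
  elim: n => [|n [IH1 IH2]]; first by rewrite /c /t /= expr0 mulr1 subrKC.
  by have [_ h1 _ h2] := mono n; split; lra.
exists x, y; split.
- by have := a_ge 0%N; have := xP 0%N; move=> /andP[? ?] [? ?]; apply/andP; split; lra.
- by have := c_ge 0%N; have := yP 0%N; move=> /andP[? ?] [? ?]; apply/andP; split; lra.
move=> del del0.
have : t n @[n --> \oo] --> (0 : R).
  by apply: cvg_expr; rewrite ger0_norm; lra.
move=> /cvgrPdist_lt /(_ _ del0) [n _ /(_ n (leqnn _))] /=.
rewrite sub0r normrN ger0_norm ?ltW// => tn.
exists (a n), (c n), (t n); have [E bd] := SE n.
have [? ?] := a_ge n; have [? ?] := c_ge n.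
have /andP[? ?] := xP n; have /andP[? ?] := yP n.
by split; [rewrite t0|split; apply/andP|split; apply/andP|rewrite -E].
Qed.

Lemma norm_alternating_le (x1 x2 x3 x4 m m' : R) :
  `|x1| <= m -> `|x2| <= m' -> `|x3| <= m -> `|x4| <= m' ->
  `|x1 - x2 - x3 + x4| <= 2 * m + 2 * m'.
Proof. by rewrite !ler_norml => /andP[? ?] /andP[? ?] /andP[? ?] /andP[? ?]; lra. Qed.

Lemma dist_itv_le (a r x x' : R) :
  a <= x' <= a + r -> a <= x <= a + r -> `|x' - x| <= r.
Proof. by move=> /andP[? ?] /andP[? ?]; rewrite ler_norml; apply/andP; split; lra. Qed.

Definition rect_flux U V (a b c d : R) : R :=
  (U b c - U a c) - (V b d - V b c) - (U b d - U a d) + (V a d - V a c).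

(** Goursat's argument: a rectangle with a large flux per unit area has a
    quarter with the same property, and the nested quarters shrink to a point
    at which the Cauchy-Riemann linearization has zero flux. *)
Lemma goursat_rect u v U V (x1 x2 y1 y2 : R) : x1 < x2 -> y1 < y2 ->
  (forall x y, x1 <= x <= x2 -> y1 <= y <= y2 ->
     is_derive x 1 (U ^~ y) (u x y) /\ is_derive y 1 (V x) (v x y)) ->
  (forall x y, x1 <= x <= x2 -> y1 <= y <= y2 -> exists p q, forall e, 0 < e ->
    exists2 del, 0 < del & forall x' y', x1 <= x' <= x2 -> y1 <= y' <= y2 ->
      `|x' - x| <= del -> `|y' - y| <= del ->
      `|u x' y' - u x y - (p * (x' - x) - q * (y' - y))|
        <= e * (`|x' - x| + `|y' - y|) /\
      `|v x' y' - v x y - (q * (x' - x) + p * (y' - y))|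
        <= e * (`|x' - x| + `|y' - y|)) ->
  rect_flux U V x1 x2 y1 y2 = 0.
Proof.
move=> x12 y12 prim diff; apply/eqP/negP => /negP J0.
pose J (s : R * R * (R * R)) := rect_flux U V s.1.1 s.1.2 s.2.1 s.2.2.
pose ar (s : R * R * (R * R)) := (s.1.2 - s.1.1) * (s.2.2 - s.2.1).
pose s0 := ((x1, x2), (y1, y2)).
have w0 : 0 < x2 - x1 by rewrite subr_gt0.
have h0 : 0 < y2 - y1 by rewrite subr_gt0.
have ar0 : 0 < ar s0 by rewrite mulr_gt0.
pose kap := `|J s0| / ar s0.
have kap0 : 0 < kap by rewrite divr_gt0// normr_gt0.
have B0 : kap * ar s0 <= `|J s0| by rewrite divfK// gt_eqF.
have Bq s : kap * ar s <= `|J s| -> exists2 s', quarter s s' & kap * ar s' <= `|J s'|.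
  move: s => [[a b] [c d]] bd.
pose m := (a + b) / 2; pose n := (c + d) / 2.
set Q := quarter _.
have arE k l k' l' : ar ((k, l), (k', l')) = (l - k) * (l' - k') by [].
apply: contrapT => nex.
have no s : Q s -> `|J s| < kap * ar s.
  by move=> qs; rewrite ltNge; apply/negP => bs; apply: nex; exists s.
have := no ((a, m), (c, n)) ltac:(by constructor 1).
have := no ((m, b), (c, n)) ltac:(by constructor 2).
have := no ((a, m), (n, d)) ltac:(by constructor 3).
have := no ((m, b), (n, d)) ltac:(by constructor 4).
rewrite !arE.
have -> : (m - a) * (n - c) = (b - a) * (d - c) / 4 by rewrite /m /n; field.
have -> : (b - m) * (n - c) = (b - a) * (d - c) / 4 by rewrite /m /n; field.
have -> : (m - a) * (d - n) = (b - a) * (d - c) / 4 by rewrite /m /n; field.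
have -> : (b - m) * (d - n) = (b - a) * (d - c) / 4 by rewrite /m /n; field.
move=> h1 h2 h3 h4.
have E : J ((a, b), (c, d)) = J ((a, m), (c, n)) + J ((m, b), (c, n))
    + J ((a, m), (n, d)) + J ((m, b), (n, d)).
  by rewrite /J /rect_flux /=; ring.
move: bd; rewrite E arE.
set j1 := J _; set j2 := J _; set j3 := J _; set j4 := J _.
have := ler_normD (j1 + j2 + j3) j4; have := ler_normD (j1 + j2) j3; have := ler_normD j1 j2.
rewrite -/j1 -/j2 -/j3 -/j4 in h1 h2 h3 h4 *.
  lra.
have [x [y [xx yy H]]] := @bisection (fun s => kap * ar s <= `|J s|) _ _ _ _ x12 y12 B0 Bq.
have [p [q pq]] := diff x y xx yy.
pose w := x2 - x1; pose h := y2 - y1.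
pose e := kap * w * h / (4 * (w + h) ^+ 2).
have wh0 : 0 < w + h by rewrite addr_gt0.
have e0 : 0 < e.
  by apply: divr_gt0; [apply: mulr_gt0 => //; apply: mulr_gt0|apply: mulr_gt0 => //; exact: exprn_gt0].
have [del del0 D] := pq e e0.
have [a [c [t [/andP[t0 tdel] [/andP[ax1 ax] /andP[xb bx2]] [/andP[cy1 cy] /andP[yd dy2]]]]]]
  := H (del / (w + h)) (divr_gt0 del0 wh0).
rewrite -/w -/h in xb bx2 yd dy2 *.
have tD : (w + h) * t < del by rewrite mulrC -ltr_pdivlMr.
have wt0 : 0 < w * t by rewrite mulr_gt0.
have ht0 : 0 < h * t by rewrite mulr_gt0.
pose b := a + w * t; pose d := c + h * t.
have m_bound x' y' : a <= x' <= b -> c <= y' <= d ->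
    [/\ x1 <= x' <= x2, y1 <= y' <= y2, `|x' - x| <= del, `|y' - y| <= del &
    e * (`|x' - x| + `|y' - y|) <= e * ((w + h) * t)].
  move=> xP yP; have hx : `|x' - x| <= w * t by apply: (dist_itv_le xP); rewrite ax xb.
  have hy : `|y' - y| <= h * t by apply: (dist_itv_le yP); rewrite cy yd.
  move/andP: xP yP => [xP1 xP2] /andP[yP1 yP2].
  rewrite (le_trans ax1 xP1) (le_trans xP2 bx2) (le_trans cy1 yP1) (le_trans yP2 dy2).
  split => //.
  - by rewrite (le_trans hx)// (le_trans _ (ltW tD))//; apply: ler_wpM2r; [exact: ltW|rewrite lerDl ltW].
  - by rewrite (le_trans hy)// (le_trans _ (ltW tD))//; apply: ler_wpM2r; [exact: ltW|rewrite lerDr ltW].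
  - by rewrite ler_pM2l// [leRHS]mulrDl lerD.
have ab : a <= b by rewrite lerDl ltW.
have cd : c <= d by rewrite lerDl ltW.
have hu y' : c <= y' <= d ->
  `|U b y' - U a y' - (u x y - q * (y' - y)) * (b - a)
    - p * ((b - x) ^+ 2 - (a - x) ^+ 2) / 2| <= e * ((w + h) * t) * (b - a).
  move=> y'P; apply: (@primitive_affine_bound (U ^~ y') (u ^~ y')) => // s sab.
    by have [? ? _ _ _] := m_bound s y' sab y'P; apply: (prim s y' _ _).1.
  have [h1 h2 h3 h4 h5] := m_bound s y' sab y'P.
  have [h6 _] := D s y' h1 h2 h3 h4; rewrite (le_trans _ (le_trans h6 h5))//.
  by rewrite le_eqVlt; apply/orP; left; apply/eqP; congr `|_|; ring.
have hv x' : a <= x' <= b ->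
  `|V x' d - V x' c - (v x y + q * (x' - x)) * (d - c)
    - p * ((d - y) ^+ 2 - (c - y) ^+ 2) / 2| <= e * ((w + h) * t) * (d - c).
  move=> x'P; apply: (@primitive_affine_bound (V x') (v x')) => // s scd.
    by have [? ? _ _ _] := m_bound x' s x'P scd; apply: (prim x' s _ _).2.
  have [h1 h2 h3 h4 h5] := m_bound x' s x'P scd.
  have [_ h6] := D x' s h1 h2 h3 h4; rewrite (le_trans _ (le_trans h6 h5))//.
  by rewrite le_eqVlt; apply/orP; left; apply/eqP; congr `|_|; ring.
have aa : a <= a <= b by rewrite lexx. have bb : a <= b <= b by rewrite lexx ab.
have cc : c <= c <= d by rewrite lexx. have dd : c <= d <= d by rewrite lexx cd.
have mm : 2 * (e * ((w + h) * t) * (b - a)) + 2 * (e * ((w + h) * t) * (d - c))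
    < kap * ((b - a) * (d - c)).
  have -> : b - a = w * t by rewrite /b; ring.
  have -> : d - c = h * t by rewrite /d; ring.
  have -> : 2 * (e * ((w + h) * t) * (w * t)) + 2 * (e * ((w + h) * t) * (h * t))
      = kap * (w * t * (h * t)) / 2 by rewrite /e; field; exact: lt0r_neq0.
  by rewrite ltr_pdivrMr// ltr_pMr; [rewrite ltr1n|apply: mulr_gt0 => //; exact: mulr_gt0].
apply/negP; rewrite -ltNge; apply: le_lt_trans mm.
have -> : J (a, b, (c, d)) =
    (U b c - U a c - (u x y - q * (c - y)) * (b - a) - p * ((b - x) ^+ 2 - (a - x) ^+ 2) / 2)
  - (V b d - V b c - (v x y + q * (b - x)) * (d - c) - p * ((d - y) ^+ 2 - (c - y) ^+ 2) / 2)
  - (U b d - U a d - (u x y - q * (d - y)) * (b - a) - p * ((b - x) ^+ 2 - (a - x) ^+ 2) / 2)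
  + (V a d - V a c - (v x y + q * (a - x)) * (d - c) - p * ((d - y) ^+ 2 - (c - y) ^+ 2) / 2).
  by rewrite /J /rect_flux /=; ring.
exact: norm_alternating_le (hu c cc) (hv b bb) (hu d dd) (hv a aa).
Qed.

End Goursat.

(** * The exponential *)

Section DeriveEps.

Lemma is_deriveE (K : numFieldType) (f : K -> K) (x df : K) :
  is_derive x 1 f df <->
  h^-1 * (f (h + x) - f x) @[h --> (0 : K)^'] --> df.
Proof.
have E : (fun h => h^-1 * (f (h + x) - f x)) =
         (fun h : K => h^-1 *: ((f \o shift x) (h *: (1 : K)) - f x)).
  by apply/funext => h /=; rewrite /GRing.scale /= mulr1.
split.
  by move=> [d1 d2]; rewrite E -d2; exact: d1.
rewrite E => H; split; first by apply/cvg_ex; exists df.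
by rewrite /derive; apply: cvg_lim => //; exact: norm_hausdorff.
Qed.

Lemma derive_epsP (K : numFieldType) (f : K -> K) (x df : K) :
  is_derive x 1 f df <->
  forall e, 0 < e -> \forall h \near (0 : K), `|f (h + x) - f x - df * h| <= e * `|h|.
Proof.
rewrite is_deriveE; split => [/cvgrPdist_le H|H].
  move=> e e0; have := H _ e0; rewrite near_withinE => Hn.
  apply: filterS Hn => h hh; have [->|h0] := eqVneq h 0.
    by rewrite add0r subrr mulr0 subr0 normr0 mulr0.
  have hn : 0 < `|h| by rewrite normr_gt0.
  move: (hh h0); rewrite -(ler_pM2r hn) -normrM mulrBl mulrAC mulVf// mul1r distrC //.
apply/cvgrPdist_le => e e0; rewrite near_withinE.
have := H _ e0; apply: filterS => h hh h0.
have hn : 0 < `|h| by rewrite normr_gt0.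
by rewrite -(ler_pM2r hn) -normrM mulrBl mulrAC mulVf// mul1r distrC; exact: hh.
Qed.

End DeriveEps.

Section ComplexExp.
Variable R : realType.
Local Notation C := (Cplx R).
Implicit Types z w : C.

Lemma near_normc (z : C) (P : C -> Prop) : (\forall w \near z, P w) <->
  exists2 e : R, 0 < e & forall w, normc (w - z) < e -> P w.
Proof.
split.
  move=> /nbhs_ballP [e e0 H].
  have [Re0 eE] := gt0C e0.
  exists (complex.Re e) => // w wz; apply: H; rewrite -ball_normE /ball_ /=.
  by rewrite eE normc_lt normcB.
move=> [e e0 H]; apply/nbhs_ballP; exists (e%:C%C); first by rewrite /= ltcR.
by move=> w; rewrite -ball_normE /ball_ /= normc_lt normcB => /H.
Qed.

Lemma cderive_epsP (f : C -> C) z df :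
  is_derive z 1 f df <->
  forall e : R, 0 < e -> exists2 d : R, 0 < d & forall h : C, normc h < d ->
    normc (f (h + z) - f z - df * h) <= e * normc h.
Proof.
rewrite derive_epsP; split => H e e0.
  have e0' : (0 : C) < e%:C%C by rewrite ltcR.
  have /near_normc [d d0 D] := H _ e0'; exists d => // h hd.
  by have := D h; rewrite subr0 => /(_ hd); rewrite !normcE -rmorphM lecR.
have [Re0 eE] := gt0C e0.
have [d d0 D] := H _ Re0; apply/near_normc; exists d => // h; rewrite subr0 => /D.
by rewrite eE !normcE -rmorphM lecR.
Qed.

Lemma rderive_eps (f : R -> R) (x df e : R) : is_derive x 1 f df -> 0 < e ->
  exists2 d, 0 < d & forall h, `|h| < d -> `|f (h + x) - f x - df * h| <= e * `|h|.
Proof.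
move=> /derive_epsP /[apply] /nbhs_ballP [d d0 D]; exists d => // h hd.
by apply: D; rewrite -ball_normE /ball_ /= sub0r normrN.
Qed.

Lemma cexpD z w : cexp (z + w) = cexp z * cexp w.
Proof.
case: z => a b; case: w => c d; rewrite /cexp /=.
rewrite expRD cosD sinD; apply: complex_ext; rewrite ?ReM ?ImM /=; ring.
Qed.

Lemma cexp0 : cexp (0 : C) = 1.
Proof. by rewrite /cexp /= expR0 cos0 sin0 mulr1 mulr0. Qed.

Lemma normc_cexp z : normc (cexp z) = expR (complex.Re z).
Proof.
rewrite /cexp /= !exprMn -mulrDr cos2Dsin2 mulr1 sqrtr_sqr ger0_norm//.
Qed.

Lemma is_derive_cexp z : is_derive z 1 (@cexp R) (cexp z).
Proof.
suff D0 : is_derive (0 : C) 1 (@cexp R) 1.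
  apply/cderive_epsP => e e0; move/cderive_epsP: D0 => D0.
  have n0 : 0 < normc (cexp z) by rewrite normc_cexp expR_gt0.
  have [d d0 D] := D0 _ (divr_gt0 e0 n0); exists d => // h hd.
  have -> : cexp (h + z) - cexp z - cexp z * h = cexp z * (cexp (h + 0) - cexp 0 - 1 * h).
    by rewrite addr0 cexpD cexp0; ring.
  rewrite normcM (le_trans (ler_wpM2l (normc_ge0 _) (D h hd)))//.
  by rewrite mulrA mulrCA mulfV ?gt_eqF// mulr1.
apply/cderive_epsP => e e0.
pose e1 := Num.min (e / 8) 1.
have e10 : 0 < e1 by rewrite lt_min ltr01 andbT divr_gt0.
have e1e : e1 <= e / 8 by rewrite ge_min lexx.
have e11 : e1 <= 1 by rewrite ge_min lexx orbT.
have [d1 d10 D1] := rderive_eps (is_derive_expR 0) e10.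
have [d2 d20 D2] := rderive_eps (is_derive_cos 0) e10.
have [d3 d30 D3] := rderive_eps (is_derive_sin 0) e10.
exists (Num.min (Num.min d1 d2) (Num.min d3 (e1 / 2))).
  by rewrite !lt_min d10 d20 d30 divr_gt0.
move=> h; rewrite !lt_min => /andP[/andP[h1 h2] /andP[h3 h4]].
case: h h1 h2 h3 h4 => a b h1 h2 h3 h4; set h := (Complex a b : C) in h1 h2 h3 h4 *.
have ha : `|a| <= normc h := Re_le h.
have hb : `|b| <= normc h := Im_le h.
have hn := normc_ge0 h.
have := D1 a (le_lt_trans ha h1); rewrite addr0 expR0 mul1r => A1.
have := D2 b (le_lt_trans hb h2); rewrite addr0 cos0 sin0 oppr0 mul0r subr0 => A2.
have := D3 b (le_lt_trans hb h3); rewrite addr0 cos0 sin0 subr0 mul1r => A3.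
have ea : `|expR a - 1| <= e1.
  have : `|expR a - 1| <= `|expR a - 1 - a| + `|a| by rewrite -{1}(subrK a (expR a - 1)) ler_normD.
  have : e1 * `|a| <= 1 * `|a| by rewrite ler_wpM2r.
  lra.
have ea2 : `|expR a| <= 2.
  have : `|expR a| <= `|expR a - 1| + 1 by rewrite -{1}(subrK 1 (expR a)) (le_trans (ler_normD _ _))// normr1.
  lra.
apply: le_trans (normc_ReIm _) _.
rewrite ReB ImB ReB ImB addr0 cexp0 mul1r /= oppr0 addr0.
have -> : expR a * cos b - 1 - a = (expR a - 1 - a) + expR a * (cos b - 1) by ring.
have -> : expR a * sin b - b = expR a * (sin b - b) + (expR a - 1) * b by ring.
have B1 : `|expR a * (cos b - 1)| <= 2 * (e1 * `|b|) by rewrite normrM ler_pM.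
have B2 : `|expR a * (sin b - b)| <= 2 * (e1 * `|b|) by rewrite normrM ler_pM.
have B3 : `|(expR a - 1) * b| <= e1 * `|b| by rewrite normrM ler_wpM2r.
have C1 := ler_normD (expR a - 1 - a) (expR a * (cos b - 1)).
have C2 := ler_normD (expR a * (sin b - b)) ((expR a - 1) * b).
have E1 : e1 * `|a| <= e1 * normc h by rewrite ler_wpM2l// ltW.
have E2 : e1 * `|b| <= e1 * normc h by rewrite ler_wpM2l// ltW.
have E3 : e1 * normc h <= e / 8 * normc h by rewrite ler_wpM2r.
rewrite -[X in _ <= e * X]/(normc h); have en : 0 <= e * normc h by rewrite mulr_ge0 ?normc_ge0 ?ltW//.
lra.
Qed.

Lemma derivable_cexp z : derivable (@cexp R) z 1.
Proof. exact: (@ex_derive _ _ _ _ _ _ _ (is_derive_cexp z)). Qed.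

Lemma cexp_expi (x t : R) : cexp (Complex x t : C) = (expR x)%:C%C * expi t.
Proof. by apply: complex_ext; rewrite ?ReM ?ImM /= ?mul0r ?subr0 ?addr0. Qed.

End ComplexExp.

(** * Bounded integrals on the circle *)

Section CircleIntegral.
Variable R : realType.
Local Notation C := (Cplx R).
Local Notation T := (@circle R).

Definition bmeas (f : C -> C) : Prop :=
  [/\ measurable_fun T (fun z : CplxB R => complex.Re (f z)),
      measurable_fun T (fun z : CplxB R => complex.Im (f z)) &
      exists M : R, forall z, T z -> normc (f z) <= M].

Lemma circle_normc (z : C) : T z <-> normc z = 1.
Proof.
rewrite /circle /= normcE; split => [/eqP|->//].
by rewrite -[1]/((1 : R)%:C%C) => /eqP /complexI.
Qed.

Lemma continuous_normc : continuous (@normc R : C -> R).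
Proof.
by move=> z; apply: (@cvg_normc _ _ (nbhs z) _ (fun w : C => w) z); exact: cvg_id.
Qed.

Lemma open_measurableC (U : set C) : open U -> measurable (U : set (CplxB R)).
Proof. by move=> oU; apply: sub_sigma_algebra. Qed.

Lemma measurable_circle : measurable T.
Proof.
rewrite -(setCK T); apply: measurableC; apply: open_measurableC.
have -> : ~` T = (@normc R : C -> R) @^-1` (~` [set (1:R)]).
  by apply/seteqP; split => z /= h k; apply: h; apply/circle_normc.
apply: open_comp; first by move=> z _; exact: continuous_normc.
by apply: closed_openC; apply: accessible_closed_set1; apply: hausdorff_accessible; exact: norm_hausdorff.
Qed.

Lemma measurable_circle_cont (g : C -> R) :
  (forall z, T z -> {for z, continuous g}) ->
  measurable_fun T (g : CplxB R -> R).
Proof.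
move=> gc; apply: (measurability _ (measurable_realfun.RGenOInfty.measurableE R)) => //.
move=> _ [_ [x ->] <-].
have -> : T `&` (g : CplxB R -> R) @^-1` `]x, +oo[ = T `&` (interior (g @^-1` `]x, +oo[)).
  apply/seteqP; split => z /= [Tz h]; split => //; last exact: interior_subset h.
  have : nbhs (g z) `]x, +oo[%classic.
    by apply: open_nbhs_nbhs; split => //; exact: rray_open.
  by move/(gc z Tz).
apply: measurableI; first exact: measurable_circle.
by apply: open_measurableC; exact: open_interior.
Qed.

Lemma expi_circle (t : R) : T (expi t).
Proof. by apply/circle_normc; rewrite /expi /= cos2Dsin2 sqrtr1. Qed.

Lemma circle_expi z : T z -> exists2 t, 0 <= t <= 2 * pi & z = expi t.
Proof.
move=> /circle_normc; case: z => a b h.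
have ab : a ^+ 2 + b ^+ 2 = 1.
  have := normc_sqr (Complex a b : C); rewrite h expr1n /= => ->//.
have a1 : -1 <= a <= 1.
  by rewrite -ler_norml -(@ler_pXn2r _ 2)// ?nnegrE// expr1n real_normK ?num_real// -ab lerDl sqr_ge0.
have [t0 tpi] : 0 <= acos a /\ acos a <= pi by split; [exact: acos_ge0|exact: acos_lepi].
have pi0 := @pi_gt0 R.
have sa : sin (acos a) = `|b|.
  by rewrite sin_acos// -ab [_ + b ^+ 2]addrC addrK sqrtr_sqr.
have [b0|b0] := leP 0 b.
  exists (acos a); first by apply/andP; split; lra.
  by rewrite /expi acosK ?in_itv// sa ger0_norm.
exists (2 * pi - acos a); first by apply/andP; split; lra.
rewrite /expi cosB sinB sa acosK ?in_itv//.
have c2 : cos (2 * pi) = 1 :> R by rewrite mulr_natl cos2pi.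
have s2 : sin (2 * pi) = 0 :> R by rewrite mulr_natl sin2pi.
by rewrite c2 s2 ltr0_norm//; congr Complex; ring.
Qed.

Lemma cont_expi_comp (K : topologicalType) (g : C -> K) :
  (forall z, T z -> {for z, continuous g}) -> continuous (g \o @expi R).
Proof.
move=> gc t; apply: continuous_comp; first exact: continuous_expi.
exact: gc (expi_circle t).
Qed.

Lemma circle_cont_bounded (g : C -> R) :
  (forall z, T z -> {for z, continuous g}) ->
  exists M, forall z, T z -> g z <= M.
Proof.
move=> /cont_expi_comp gc.
have pi0 := @pi_gt0 R.
have p0 : 0 <= 2 * (pi : R) by rewrite mulr_ge0// ltW.
have [c _ cM] := EVT_max p0 (continuous_subspaceT gc).
exists (g (expi c)) => z /circle_expi [t t01 ->].
by apply: cM; rewrite in_itv.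
Qed.

Lemma bmeas_cont (f : C -> C) : (forall z, T z -> {for z, continuous f}) -> bmeas f.
Proof.
move=> fc; split.
- by apply: measurable_circle_cont => z Tz; exact: (cvg_Re (fc z Tz)).
- by apply: measurable_circle_cont => z Tz; exact: (cvg_Im (fc z Tz)).
apply: (@circle_cont_bounded (fun z => normc (f z))) => z Tz; exact: (cvg_normc (fc z Tz)).
Qed.

Lemma bmeas_cst (c : C) : bmeas (cst c).
Proof. by apply: bmeas_cont => z _; exact: (@cst_continuous C C). Qed.

Lemma bmeas_ext (f g : C -> C) : (forall z, T z -> f z = g z) -> bmeas f -> bmeas g.
Proof.
move=> fg [h1 h2 [M h3]]; split.
- by apply: eq_measurable_fun h1 => z; rewrite inE => /fg ->.
- by apply: eq_measurable_fun h2 => z; rewrite inE => /fg ->.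
by exists M => z Tz; rewrite -fg// h3.
Qed.

Lemma bmeasD (f g : C -> C) : bmeas f -> bmeas g -> bmeas (fun z => f z + g z).
Proof.
move=> [f1 f2 [M fM]] [g1 g2 [N gN]]; split.
- by under [X in measurable_fun _ X]eq_fun do rewrite ReD; exact: measurable_realfun.measurable_funD.
- by under [X in measurable_fun _ X]eq_fun do rewrite ImD; exact: measurable_realfun.measurable_funD.
by exists (M + N) => z Tz; rewrite (le_trans (normcD_le _ _))// lerD ?fM ?gN.
Qed.

Lemma bmeasM (f g : C -> C) : bmeas f -> bmeas g -> bmeas (fun z => f z * g z).
Proof.
move=> [f1 f2 [M fM]] [g1 g2 [N gN]]; split.
- under [X in measurable_fun _ X]eq_fun do rewrite ReM.
  by apply: measurable_realfun.measurable_funB; exact: measurable_realfun.measurable_funM.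
- under [X in measurable_fun _ X]eq_fun do rewrite ImM.
  by apply: measurable_realfun.measurable_funD; exact: measurable_realfun.measurable_funM.
by exists (M * N) => z Tz; rewrite normcM ler_pM ?normc_ge0 ?fM ?gN.
Qed.

Lemma bmeas_conj (f : C -> C) : bmeas f -> bmeas (fun z => (f z)^*%C).
Proof.
move=> [f1 f2 [M fM]]; split.
- by apply: eq_measurable_fun f1 => z _; case: (f z).
- have := measurable_realfun.measurable_funN f2; apply: eq_measurable_fun => z _.
  by rewrite /=; case: (f z).
by exists M => z Tz; rewrite normc_conj fM.
Qed.

Lemma bmeasB (f g : C -> C) : bmeas f -> bmeas g -> bmeas (fun z => f z - g z).
Proof.
move=> hf hg; have := bmeasD hf (bmeasM (bmeas_cst (-1)) hg).
by apply: bmeas_ext => z _; rewrite mulN1r.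
Qed.

Lemma bmeas_sum (I : Type) (s : seq I) (F : I -> C -> C) :
  (forall i, bmeas (F i)) -> bmeas (fun z => \sum_(i <- s) F i z).
Proof.
move=> hF; elim: s => [|i s IH].
  by apply: bmeas_ext (bmeas_cst 0) => z _; rewrite big_nil.
by apply: bmeas_ext (bmeasD (hF i) IH) => z _; rewrite big_cons.
Qed.

Lemma bmeasX (f : C -> C) n : bmeas f -> bmeas (fun z => f z ^+ n).
Proof.
move=> hf; elim: n => [|n IH]; first by apply: bmeas_ext (bmeas_cst 1) => z _.
by apply: bmeas_ext (bmeasM hf IH) => z _; rewrite exprS.
Qed.

Variable mu : {finite_measure set (CplxB R) -> \bar R}.
Local Notation rint g := (\int[mu]_(x in T) (g x))%R.
Definition cint (f : C -> C) : C := cintegral mu T (f : CplxB R -> C).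
Definition cmass : R := fine (mu T).

Let muT : (mu T < +oo)%E.
Proof. by rewrite ltey_eq fin_num_measure//; exact: measurable_circle. Qed.

Lemma bmeas_integrable (f : C -> C) : bmeas f ->
  mu.-integrable T (EFin \o (fun z : CplxB R => complex.Re (f z))) /\
  mu.-integrable T (EFin \o (fun z : CplxB R => complex.Im (f z))).
Proof.
move=> [f1 f2 [M fM]]; split; apply: measurable_bounded_integrable => //;
  try exact: measurable_circle; exists M; split; rewrite ?num_real// => x Mx z Tz /=;
  apply: le_trans (ltW Mx); apply: le_trans (fM z Tz); [exact: Re_le|exact: Im_le].
Qed.

Lemma eq_cint (f g : C -> C) : (forall z, T z -> f z = g z) -> cint f = cint g.
Proof.
by move=> fg; rewrite /cint /cintegral; congr Complex; apply: eq_Rintegral => z;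
  rewrite inE => Tz; rewrite fg.
Qed.

Lemma cintD (f g : C -> C) : bmeas f -> bmeas g ->
  cint (fun z => f z + g z) = cint f + cint g.
Proof.
move=> hf hg; have [f1 f2] := bmeas_integrable hf; have [g1 g2] := bmeas_integrable hg.
have mT := measurable_circle.
apply: complex_ext; rewrite ?ReD ?ImD /= -RintegralD//; apply: eq_Rintegral => z _.
  by rewrite ReD.
by rewrite ImD.
Qed.

Lemma cintZ (c : C) (f : C -> C) : bmeas f -> cint (fun z => c * f z) = c * cint f.
Proof.
move=> hf; have [f1 f2] := bmeas_integrable hf.
have mT := measurable_circle.
have iZ k (g : CplxB R -> R) : mu.-integrable T (EFin \o g) ->
    mu.-integrable T (EFin \o (fun x => k * g x)).
  move=> ig; have := integrableZl mT k ig.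
  by apply: (eq_integrable mT) => z _; rewrite /= EFinM.
case: c => a b; apply: complex_ext; rewrite ?ReM ?ImM /= -!RintegralZl//.
  rewrite -RintegralB//; [|exact: iZ..].
  by apply: eq_Rintegral => z _; rewrite ReM.
rewrite -RintegralD//; [|exact: iZ..].
by apply: eq_Rintegral => z _; rewrite ImM.
Qed.

Lemma cintB (f g : C -> C) : bmeas f -> bmeas g ->
  cint (fun z => f z - g z) = cint f - cint g.
Proof.
move=> hf hg; rewrite -[- cint g]mulN1r -cintZ// -cintD//; last first.
  exact: bmeasM (bmeas_cst (-1)) hg.
by apply: eq_cint => z _; rewrite mulN1r.
Qed.

Lemma cint_cst (c : C) : cint (cst c) = c * (cmass)%:C%C.
Proof.
case: c => a b; apply: complex_ext; rewrite ?ReM ?ImM /= Rintegral_cst//;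
  try exact: measurable_circle; by rewrite mulr0 ?subr0 ?add0r.
Qed.

Lemma cint_sum (I : Type) (s : seq I) (F : I -> C -> C) :
  (forall i, bmeas (F i)) ->
  cint (fun z => \sum_(i <- s) F i z) = \sum_(i <- s) cint (F i).
Proof.
move=> hF; elim: s => [|i s IH].
  rewrite big_nil (eq_cint (g := cst 0)) ?cint_cst ?mul0r// => z _.
  by rewrite big_nil.
rewrite big_cons -IH -cintD//; last exact: bmeas_sum.
by apply: eq_cint => z _; rewrite big_cons.
Qed.

Lemma cint_conj (f : C -> C) : bmeas f -> cint (fun z => (f z)^*%C) = (cint f)^*%C.
Proof.
move=> hf; have [f1 f2] := bmeas_integrable hf.
have mT := measurable_circle.
apply: complex_ext => /=; first by apply: eq_Rintegral => z _; case: (f z).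
rewrite -mulN1r -RintegralZl//; apply: eq_Rintegral => z _.
by rewrite mulN1r; case: (f z).
Qed.

Lemma Re_cint_le (f g : C -> C) : bmeas f -> bmeas g ->
  (forall z, T z -> complex.Re (f z) <= complex.Re (g z)) ->
  complex.Re (cint f) <= complex.Re (cint g).
Proof.
move=> hf hg h; have [f1 _] := bmeas_integrable hf; have [g1 _] := bmeas_integrable hg.
by apply: le_Rintegral => //; exact: measurable_circle.
Qed.

Lemma cmass_ge0 : 0 <= cmass.
Proof. exact/fine_ge0. Qed.

Lemma cint_norm_le (f : C -> C) (M : R) : bmeas f ->
  (forall z, T z -> normc (f z) <= M) -> normc (cint f) <= M * cmass.
Proof.
move=> hf fM; have [c0|c0] := eqVneq (cint f) 0.
  rewrite c0 normc0 mulr_ge0 ?cmass_ge0// (le_trans (normc_ge0 (f 1)))// fM//.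
  by apply/circle_normc; rewrite normc1.
pose n := normc (cint f); have n0 : 0 < n by rewrite normc_gt0.
pose c : C := (cint f)^*%C / (n%:C)%C.
have nc : normc c = 1.
  by rewrite normcM normc_conj normcV normc_real ger0_norm ?mulfV ?gt_eqF ?normc_ge0.
have E : c * cint f = (n%:C)%C.
  rewrite /c mulrAC (_ : (cint f)^*%C * cint f = (n%:C)%C ^+ 2).
    by rewrite expr2 mulfK// -normc_gt0 normc_real ger0_norm ?ltW.
  by rewrite -rmorphXn /= -conj_normc.
have -> : normc (cint f) = complex.Re (cint (fun z => c * f z)) by rewrite cintZ// E.
have -> : M * cmass = complex.Re (cint (cst (M%:C)%C)) by rewrite cint_cst ReM /= mul0r subr0.
apply: Re_cint_le => [||z Tz]; [exact: bmeasM (bmeas_cst c) hf|exact: bmeas_cst|].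
rewrite /= (le_trans (ler_norm _))// (le_trans (Re_le _))// normcM nc mul1r.
exact: fM.
Qed.

Lemma cint_cvg (f_ : nat -> C -> C) (f : C -> C) (M : R) :
  (forall n, bmeas (f_ n)) ->
  (forall n z, T z -> normc (f_ n z) <= M) ->
  (forall z, T z -> f_ n z @[n --> \oo] --> f z) ->
  bmeas f /\ cint (f_ n) @[n --> \oo] --> cint f.
Proof.
move=> hf fM fc.
have fM' z : T z -> normc (f z) <= M.
  move=> Tz; apply: (cvgr_to_le (cvg_normc (fc z Tz))); apply: nearW => n; exact: fM.
have mT := measurable_circle.
have hf' : bmeas f.
  split; last by exists M.
  - apply: (measurable_realfun.measurable_fun_cvg (h := fun n (z : CplxB R) => complex.Re (f_ n z))).
      by move=> n; case: (hf n).
    by move=> z Tz; exact: cvg_Re (fc z Tz).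
  - apply: (measurable_realfun.measurable_fun_cvg (h := fun n (z : CplxB R) => complex.Im (f_ n z))).
      by move=> n; case: (hf n).
    by move=> z Tz; exact: cvg_Im (fc z Tz).
split => //.
have real_dct (g_ : nat -> CplxB R -> R) (g : CplxB R -> R) :
    (forall n, measurable_fun T (g_ n)) ->
    (forall z, T z -> g_ n z @[n --> \oo] --> g z) ->
    (forall n z, T z -> `|g_ n z| <= M) ->
    mu.-integrable T (EFin \o g) ->
    rint (g_ n) @[n --> \oo] --> rint g.
  move=> mg cg bg ig; rewrite /Rintegral; apply: fine_cvg.
  rewrite fineK; last exact: integrable_fin_num.
  apply: (@dominated_cvg _ _ _ _ _ mT (fun n z => (g_ n z)%:E) _ (cst M%:E)).
  - by move=> n; apply/measurable_realfun.measurable_EFinP.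
  - by move=> z Tz; apply: cvg_EFin; [exact: nearW|exact: cg].
  - by [].
  - exact: finite_measure_integrable_cst.
  - by move=> n z Tz; rewrite /= lee_fin bg.
have [i1 i2] := bmeas_integrable hf'.
apply: cvg_ReIm.
  apply: real_dct => //; first by move=> n; case: (hf n).
    by move=> z Tz; exact: cvg_Re (fc z Tz).
  by move=> n z Tz; rewrite (le_trans (Re_le _))// fM.
apply: real_dct => //; first by move=> n; case: (hf n).
  by move=> z Tz; exact: cvg_Im (fc z Tz).
by move=> n z Tz; rewrite (le_trans (Im_le _))// fM.
Qed.

End CircleIntegral.

(** * Integrals on the circle through primitives *)

Section CircleMean.
Variable R : realType.
Local Notation C := (Cplx R).
Local Notation T := (@circle R).
Local Notation m := (@circle_measure R).

Lemma expiB_preimage_circle : (@expiB R) @^-1` T = setT.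
Proof. by apply/seteqP; split => // t _; exact: expi_circle. Qed.

Lemma circle_measure_circle : m T = 1%E.
Proof.
rewrite -[LHS]/(pushforward (uniform_prob (@pi2_gt0 R)) (@expiB R) T).
by rewrite /pushforward expiB_preimage_circle probability_setT.
Qed.

Lemma cmass_circle : cmass m = 1.
Proof. exact: (congr1 fine circle_measure_circle). Qed.

Lemma primitive_exists (k : R -> R) (a b : R) : (forall x, a < x < b -> {for x, continuous k}) ->
  forall c d, a < c -> c <= d -> d < b -> exists K : R -> R, forall x, c <= x <= d -> is_derive x 1 K (k x).
Proof.
move=> kc c d ac cd db.
pose a' := (a + c) / 2; pose b' := (d + b) / 2.
have [aa ac'] : a < a' /\ a' < c by rewrite /a'; split; lra.
have [db' bb] : d < b' /\ b' < b by rewrite /b'; split; lra.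
have ki : lebesgue_measure.-integrable `[a', b'] (EFin \o k).
  apply: continuous_compact_integrable; first exact: segment_compact.
  apply: continuous_in_subspaceT => x; rewrite inE /= in_itv /= => /andP[h1 h2].
  by apply: kc; apply/andP; split; lra.
exists (fun x => \int[lebesgue_measure]_(t in [set` Interval (BLeft a') (BRight x)]) k t)%R.
move=> x /andP[cx xd].
have xb : x < b' by lra.
have [] := @continuous_FTC1 R k (BLeft a') x b' xb ki.
- by rewrite /= lte_fin; lra.
- by apply: kc; apply/andP; split; lra.
by move=> h1 h2; split; rewrite // -derive1E.
Qed.

Lemma Rintegral_circle (h : C -> R) (K : R -> R) :
  (forall z, T z -> {for z, continuous h}) ->
  (forall t, 0 <= t <= 2 * pi -> is_derive t 1 K (h (expi t))) ->
  (\int[m]_(z in T) h z)%R = (K (2 * pi) - K 0) / (2 * pi).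
Proof.
move=> hc hK.
have pi2 := @pi2_gt0 R.
have [M hM] : exists M, forall z, T z -> - h z <= M.
  by apply: (circle_cont_bounded (g := fun z => - h z)) => z Tz; exact: (cvgN (hc z Tz)).
pose k t := h (expi t) + M.
have kc : continuous k.
  move=> t; apply: cvgD; last exact: cvg_cst.
  exact: (cont_expi_comp hc).
have k0 t : 0 <= k t by have := hM _ (expi_circle t); rewrite /k; lra.
have mh : measurable_fun T (h : CplxB R -> R) := measurable_circle_cont hc.
have mT := @measurable_circle R.
have ih : m.-integrable T (EFin \o (h : CplxB R -> R)).
  have [N hN] := circle_cont_bounded hc.
  apply: measurable_bounded_integrable => //; first by apply: (@le_lt_trans _ _ 1%E);
    [rewrite le_eqVlt; apply/orP; left; apply/eqP; exact: circle_measure_circle|exact: ltry].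
  exists (Num.max N M); split; rewrite ?num_real// => x Mx z Tz /=.
  move: Mx; rewrite gt_max => /andP[Nx Mx].
  rewrite ler_norml; have := hN z Tz; have := hM z Tz => ? ?; apply/andP; split; lra.
have E1 : (\int[m]_(z in T) (h z + M))%R = (\int[m]_(z in T) h z)%R + M.
  rewrite RintegralD//; last exact: finite_measure_integrable_cst.
  congr (_ + _); rewrite Rintegral_cst// -[RHS]mulr1; congr (_ * _).
  exact: cmass_circle.
suff E2 : (\int[m]_(z in T) (h z + M))%R = (K (2 * pi) - K 0) / (2 * pi) + M.
  by apply: (addIr M); rewrite -E1 E2.
rewrite /Rintegral.
have -> : (\int[m]_(z in T) (h z + M)%:E)%E =
    ((2 * pi - 0)^-1%:E * \int[lebesgue_measure]_(t in `[0%R, (2 * pi)%R]) (k t)%:E)%E.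
  rewrite -[LHS]/((\int[pushforward (uniform_prob (@pi2_gt0 R)) (@expiB R)]_(z in T) (h z + M)%:E)%E).
  rewrite ge0_integral_pushforward//.
  - rewrite expiB_preimage_circle integral_uniform//.
      apply/measurable_realfun.measurable_EFinP.
      exact: measurable_realfun.continuous_measurable_fun.
  - by apply/measurable_realfun.measurable_EFinP; apply: measurable_realfun.measurable_funD.
  - by move=> z; rewrite inE => Tz; rewrite lee_fin; have := hM _ Tz; lra.
pose G t := K t + M * t.
have dG t : 0 <= t <= 2 * pi -> is_derive t 1 G (k t).
  move=> t01; have := hK t t01 => dK; rewrite /G /k.
  by apply: is_derive_eq; rewrite /GRing.scale /= mulr1.
have cG t : 0 <= t <= 2 * pi -> {for t, continuous G}.
  by move=> /dG [dGt _]; apply: differentiable_continuous; exact/derivable1_diffP.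
have cG0 : {for 0, continuous G} by apply: cG; rewrite lexx ltW.
have cG1 : {for 2 * pi, continuous G} by apply: cG; rewrite lexx ltW.
rewrite (@continuous_FTC2 R k G)//; first last.
- move=> t; rewrite in_itv /= => /andP[t0 t1]; rewrite derive1E.
  by have [] : is_derive t 1 G (k t) by apply: dG; rewrite !ltW.
- split.
  + move=> t; rewrite in_itv /= => /andP[t0 t1].
    by have [] : is_derive t 1 G (k t) by apply: dG; rewrite !ltW.
  + exact: (cvg_at_right_filter cG0).
  + exact: (cvg_at_left_filter cG1).
- exact: (continuous_subspaceT kc).
rewrite /G /= subr0; have := @pi_gt0 R; move: (pi : R) => p p0; field.
exact: lt0r_neq0.
Qed.

End CircleMean.

(** * Circle means in an annulus *)

Section MeanValue.
Variable R : realType.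
Local Notation C := (Cplx R).
Local Notation T := (@circle R).
Local Notation m := (@circle_measure R).

Lemma is_derive_comp_C (f g : C -> C) (z a b : C) :
  is_derive (g z) 1 f a -> is_derive z 1 g b -> is_derive z 1 (f \o g) (a * b).
Proof.
move=> /cderive_epsP df /cderive_epsP dg; apply/cderive_epsP => e e0.
pose na := normc a; pose nb := normc b.
have na0 : 0 <= na := normc_ge0 a. have nb0 : 0 <= nb := normc_ge0 b.
pose e1 := e / (2 * (nb + 1)); pose e2 := Num.min 1 (e / (2 * (na + 1))).
have e10 : 0 < e1 by rewrite divr_gt0// mulr_gt0// ltr_wpDl.
have e20 : 0 < e2 by rewrite lt_min ltr01 divr_gt0// mulr_gt0// ltr_wpDl.
have [d1 d10 D1] := df e1 e10; have [d2 d20 D2] := dg e2 e20.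
exists (Num.min d2 (d1 / (nb + 1))).
  by rewrite lt_min d20 divr_gt0// ltr_wpDl.
move=> h; rewrite lt_min => /andP[hd2 hd1].
have h0 := normc_ge0 h.
pose k := g (h + z) - g z.
have kb : normc (k - b * h) <= e2 * normc h by exact: D2.
have e2_1 : e2 <= 1 by rewrite ge_min lexx.
have e2_2 : na * e2 <= e / 2.
  have : e2 <= e / (2 * (na + 1)) by rewrite ge_min lexx orbT.
  move=> /(ler_wpM2l na0) /le_trans; apply.
  rewrite mulrA ler_pdivrMr ?mulr_gt0 ?ltr_wpDl//.
  have -> : e / 2 * (2 * (na + 1)) = e * (na + 1) by field.
  rewrite mulrC; apply: ler_wpM2l; [exact: ltW|by rewrite lerDl].
have kn : normc k <= (nb + 1) * normc h.
  have : normc k <= normc (k - b * h) + normc (b * h) by rewrite -{1}(subrK (b * h) k) normcD_le.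
  rewrite normcM -/nb; have : e2 * normc h <= 1 * normc h by rewrite ler_wpM2r.
  lra.
have kd : normc k < d1.
  by apply: le_lt_trans kn _; rewrite mulrC -ltr_pdivlMr// ltr_wpDl.
have := D1 k kd; rewrite /k subrK -/k => E1.
have E2 : e1 * normc k <= e / 2 * normc h.
  apply: le_trans (ler_wpM2l (ltW e10) kn) _; rewrite mulrA.
  have -> : e1 * (nb + 1) = e / 2 by rewrite /e1; field; rewrite gt_eqF// ltr_wpDl.
  by [].
have -> : (f \o g) (h + z) - (f \o g) z - a * b * h =
    (f (g (h + z)) - f (g z) - a * k) + a * (k - b * h) by rewrite /=; ring.
apply: le_trans (normcD_le _ _) _; rewrite normcM -/na.
have : na * normc (k - b * h) <= e / 2 * normc h.
  apply: le_trans (ler_wpM2l na0 kb) _; rewrite mulrA.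
  exact: ler_wpM2r.
lra.
Qed.

Lemma derivable_comp_C (f g : C -> C) (z : C) :
  derivable f (g z) 1 -> derivable g z 1 -> derivable (f \o g) z 1.
Proof.
move=> /derivableP df /derivableP dg.
exact: (@ex_derive _ _ _ _ _ _ _ (is_derive_comp_C df dg)).
Qed.

Lemma derivable_continuous_C (f : C -> C) (z : C) :
  derivable f z 1 -> {for z, continuous f}.
Proof. by move=> /derivable1_diffP; exact: differentiable_continuous. Qed.

Lemma continuous_ReIm (x y : R) :
  {for x, continuous (fun s : R => Complex s y : C)} /\
  {for y, continuous (fun s : R => Complex x s : C)}.
Proof.
by split; apply: cvg_ReIm => /=; (exact: cvg_id || exact: cvg_cst).
Qed.

Lemma Im_circle_mean_annulus (f : C -> C) (a b r1 r2 : R) :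
  0 < a -> a < r1 -> r1 < r2 -> r2 < b ->
  (forall z : C, a < normc z < b -> derivable f z 1) ->
  complex.Im (cint m (fun z => f ((r1%:C%C : C) * z))) =
  complex.Im (cint m (fun z => f ((r2%:C%C : C) * z))).
Proof.
move=> a0 ar1 r12 r2b df.
have r10 : 0 < r1 by lra. have r20 : 0 < r2 by lra. have b0 : 0 < b by lra.
pose g := f \o @cexp R.
have dg x y : ln a < x < ln b -> derivable g (Complex x y : C) 1.
  move=> /andP[xa xb]; apply: derivable_comp_C; last exact: derivable_cexp.
  apply: df; rewrite normc_cexp /=.
  by rewrite -{1}[a]lnK ?posrE// -[b]lnK ?posrE// !ltr_expR xa xb.
pose u x y := complex.Re (g (Complex x y)); pose v x y := complex.Im (g (Complex x y)).
pose x1 := ln r1; pose x2 := ln r2.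
have [ax1 x12 x2b] : [/\ ln a < x1, x1 < x2 & x2 < ln b].
  by rewrite /x1 /x2 !ltr_ln ?posrE.
have pi2 := @pi2_gt0 R.
have dgx x y : x1 <= x <= x2 -> derivable g (Complex x y : C) 1.
  by move=> /andP[? ?]; apply: dg; apply/andP; split; lra.
have uc y x : ln a < x < ln b -> {for x, continuous (u ^~ y)}.
  move=> xab; apply: cvg_Re.
  have [c1 _] := continuous_ReIm x y.
  exact: (continuous_comp c1 (derivable_continuous_C (dg x y xab))).
have vc x y : x1 <= x <= x2 -> {for y, continuous (v x)}.
  move=> xab; apply: cvg_Im.
  have [_ c1] := continuous_ReIm x y.
  exact: (continuous_comp c1 (derivable_continuous_C (dgx x y xab))).
have [U UP] : exists U : R -> R -> R, forall y x, x1 <= x <= x2 -> is_derive x 1 (U y) (u x y).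
  have ex y : exists K : R -> R, forall x, x1 <= x <= x2 -> is_derive x 1 K (u x y).
    exact: (primitive_exists (uc y) ax1 (ltW x12) x2b).
  by have [U UP] := choice ex; exists U.
have [V VP] : exists V : R -> R -> R, forall x, x1 <= x <= x2 -> forall y, 0 <= y <= 2 * pi ->
    is_derive y 1 (V x) (v x y).
  have ex x : exists K : R -> R, x1 <= x <= x2 -> forall y, 0 <= y <= 2 * pi -> is_derive y 1 K (v x y).
    have [xx|nx] := boolP (x1 <= x <= x2); last by exists id.
    have h1 : -1 < 0 :> R by lra.
    have h2 : 2 * pi < 2 * pi + 1 :> R by lra.
    have [K KP] := primitive_exists (fun y _ => vc x y xx) h1 (ltW pi2) h2.
    by exists K.
  by have [V VP] := choice ex; exists V.
have per x : cexp (Complex x (2 * pi) : C) = cexp (Complex x 0 : C).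
  by rewrite /cexp /= mulr_natl cos2pi sin2pi cos0 sin0.
have flux := @goursat_rect R u v (fun x y => U y x) V x1 x2 0 (2 * pi) x12 pi2.
have {flux} : rect_flux (fun x y => U y x) V x1 x2 0 (2 * pi) = 0.
  apply: flux => x y xx yy; first by split; [exact: UP|exact: VP].
  have := dgx x y xx; move=> /derivableP /cderive_epsP; set D := 'D_1 g _ => H.
  exists (complex.Re D), (complex.Im D) => e e0.
  have [d d0 dP] := H e e0; exists (d / 3); first by rewrite divr_gt0.
  move=> x' y' _ _ hx hy.
  pose h : C := Complex (x' - x) (y' - y).
  have hn : normc h <= `|x' - x| + `|y' - y| := normc_ReIm h.
  have hd : normc h < d by lra.
  have hz : h + Complex x y = Complex x' y' :> C.
    by apply: complex_ext; rewrite ?ReD ?ImD /= subrK.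
  have := dP h hd; rewrite hz => E.
  have E' : normc (g (Complex x' y') - g (Complex x y) - D * h) <= e * (`|x' - x| + `|y' - y|).
    by rewrite (le_trans E)// ler_wpM2l// ltW.
  split.
    by apply: le_trans E'; apply: le_trans (Re_le _); rewrite !ReB ReM.
  apply: le_trans E'; apply: le_trans (Im_le _); rewrite !ImB ImM /=.
  by rewrite [complex.Im D * _ + _]addrC.
have UE : U (2 * pi) x2 - U (2 * pi) x1 = U 0 x2 - U 0 x1.
  have dW x : x1 <= x <= x2 -> is_derive x 1 (fun s => U (2 * pi) s - U 0 s) 0.
    move=> xx; have := UP (2 * pi) x xx; have := UP 0 x xx => d1 d2.
    by apply: is_derive_eq; rewrite /u /g /= per subrr.
  have [c _] : exists2 c, c \in `[x1, x2] & (U (2 * pi) x2 - U 0 x2) - (U (2 * pi) x1 - U 0 x1)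
      = 0 * (x2 - x1).
    apply: (@MVT_segment _ (fun s => U (2 * pi) s - U 0 s) (fun=> 0)) => //; first exact: ltW.
      by move=> s; rewrite in_itv /= => /andP[/ltW ? /ltW ?]; apply: dW; apply/andP.
    apply: derivable_within_continuous => s; rewrite in_itv /= => ss.
    by have [] := dW s ss.
  by rewrite mul0r; lra.
rewrite /rect_flux UE => flux.
have mean r x : 0 < r -> x = ln r -> x1 <= x <= x2 ->
    complex.Im (cint m (fun z => f ((r%:C%C : C) * z))) = (V x (2 * pi) - V x 0) / (2 * pi).
  move=> r0 xr xx.
  have h1 (z : C) : T z -> {for z, continuous (fun z : C => complex.Im (f ((r%:C%C : C) * z)) : R)}.
    move=> /circle_normc nz.
    have c1 : {for z, continuous (fun z : C => (r%:C%C : C) * z)}.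
      exact: (@mulrl_continuous C).
    have c2 : {for (r%:C%C : C) * z, continuous f}.
      apply: derivable_continuous_C; apply: df.
      rewrite normcM nz mulr1 normc_real gtr0_norm//.
      move: xx; rewrite xr /x1 /x2 !ler_ln ?posrE// => /andP[? ?]; apply/andP; split; lra.
    exact: (cvg_Im (continuous_comp c1 c2)).
  have h2 t : 0 <= t <= 2 * pi -> is_derive t 1 (V x) (complex.Im (f ((r%:C%C : C) * expi t))).
    by move=> tt; have := VP x xx t tt; rewrite /v /g /= cexp_expi {2}xr lnK ?posrE.
  exact: Rintegral_circle h1 h2.
rewrite (mean r1 x1)// ?(mean r2 x2)// ?lexx ?ltW//.
by congr (_ / _); lra.
Qed.

End MeanValue.

(** * The mean value property *)

Section CauchyMean.
Variable R : realType.
Local Notation C := (Cplx R).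
Local Notation T := (@circle R).
Local Notation m := (@circle_measure R).
Local Notation "x %:CC" := (x%:C%C : C) (at level 2, format "x %:CC").

Lemma cont_scale (f : C -> C) (r : R) : 0 <= r ->
  (forall z : C, normc z = r -> {for z, continuous f}) ->
  forall z, T z -> {for z, continuous (fun z : C => f (r%:CC * z))}.
Proof.
move=> r0 fc z /circle_normc nz.
have c1 : {for z, continuous (fun z : C => r%:CC * z)} by exact: (@mulrl_continuous C).
apply: (continuous_comp c1); apply: fc.
by rewrite normcM nz mulr1 normc_real ger0_norm.
Qed.

(** In the logarithmic coordinate s, where z = e ^ s, the circle mean is an integral
    over a vertical segment of length 2 pi; by Goursat's theorem on rectangles and
    by periodicity it does not depend on the segment. *)
Lemma circle_mean_annulus (f : C -> C) (a b r1 r2 : R) :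
  0 < a -> a < r1 -> r1 < r2 -> r2 < b ->
  (forall z : C, a < normc z < b -> derivable f z 1) ->
  cint m (fun z => f (r1%:CC * z)) = cint m (fun z => f (r2%:CC * z)).
Proof.
move=> a0 ar1 r12 r2b df.
have bm r : a < r -> r < b -> bmeas (fun z => f (r%:CC * z)).
  move=> ar rb; apply: bmeas_cont; apply: cont_scale; first lra.
  by move=> z nz; apply: derivable_continuous_C; apply: df; rewrite nz ar rb.
have b1 : bmeas (fun z => f (r1%:CC * z)) by apply: bm; lra.
have b2 : bmeas (fun z => f (r2%:CC * z)) by apply: bm; lra.
apply: complex_ext; last exact: (Im_circle_mean_annulus a0 ar1 r12 r2b df).
have := @Im_circle_mean_annulus R (fun z => Complex 0 1 * f z) a b r1 r2 a0 ar1 r12 r2b.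
rewrite !cintZ// !ImM /= !mul0r !mul1r !add0r; apply.
move=> z zab; apply: derivableM; [exact: derivable_cst|exact: df].
Qed.

Lemma disc_bounded (f : C -> C) (r : R) :
  (forall z : C, normc z <= r -> {for z, continuous f}) ->
  exists M, forall z : C, normc z <= r -> normc (f z) <= M.
Proof.
move=> fc; have [r0|r0] := ltP r 0.
  by exists 0 => z zr; have := normc_ge0 z; lra.
pose p (st : R * R) : C := st.1%:CC * expi st.2.
pose A : set (R * R) := `[0, r]%classic `*` `[0, 2 * pi]%classic.
have cA : compact A by apply: compact_setX; exact: segment_compact.
have np st : normc (p st) = `|st.1|.
  rewrite normcM normc_real; have /circle_normc -> := expi_circle st.2.
  by rewrite mulr1.
have cp st : {for st, continuous p}.
  apply: (@cvgM C).
    exact: (cvg_RC (@cvg_fst _ _ (nbhs st.1) (nbhs st.2) _)).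
  have c2 : {for st, continuous (@snd R R)} by exact: (@cvg_snd _ _ (nbhs st.1) (nbhs st.2) _).
  exact: (continuous_comp c2 (@continuous_expi R st.2)).
pose h (st : R * R) : R := normc (f (p st)).
have ch : {within A, continuous h}.
  apply: continuous_in_subspaceT => st; rewrite inE => -[/=].
  rewrite !in_itv /= => /andP[s0 sr] _.
  apply: cvg_normc; apply: (continuous_comp (cp st)); apply: fc.
  by rewrite np ger0_norm.
have := compact_bounded (continuous_compact ch cA).
move=> [M [_ hM]]; exists (M + 1) => z zr.
have zE : exists2 t, 0 <= t <= 2 * pi & z = p (normc z, t).
  have [->|z0] := eqVneq z (0 : C).
    exists 0; first by rewrite lexx ltW// pi2_gt0.
    by rewrite normc0C; apply/esym; exact: mul0r.
  have n0 : 0 < normc z by rewrite normc_gt0.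
  have [|t tt e] := @circle_expi R (z / (normc z)%:CC).
    by apply/circle_normc; rewrite normcM normcV normc_real ger0_norm ?ltW// mulfV ?gt_eqF.
  exists t => //; rewrite /p /= -e mulrC divfK//.
  by rewrite -normc_gt0 normc_real gtr0_norm.
case: zE => t tt zE.
have M1 : M < M + 1 by rewrite ltrDl.
have := hM _ M1 (h (normc z, t)).
rewrite /= {1}/h => /(_ _) H.
have : `|h (normc z, t)| <= M + 1.
  apply: H; exists (normc z, t) => //; split => /=; rewrite in_itv/=.
    by rewrite normc_ge0 zr.
  by [].
by rewrite /h -zE ger0_norm ?normc_ge0.
Qed.

Lemma circle_mean_cvg (f : C -> C) (rn : nat -> R) (r rho : R) (c : C) :
  (forall n, 0 <= rn n <= rho) -> 0 <= r <= rho ->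
  (forall z : C, normc z <= rho -> {for z, continuous f}) ->
  rn n @[n --> \oo] --> r ->
  (forall n, cint m (fun z => f ((rn n)%:CC * z)) = c) ->
  cint m (fun z => f (r%:CC * z)) = c.
Proof.
move=> hrn /andP[r0 rr] fc rc cc.
have [M hM] := disc_bounded fc.
have nn s z : T z -> 0 <= s -> normc (s%:CC * z) = s.
  by move=> /circle_normc nz s0; rewrite normcM nz mulr1 normc_real ger0_norm.
have bm s : 0 <= s <= rho -> bmeas (fun z => f (s%:CC * z)).
  move=> /andP[s0 sr]; apply: bmeas_cont; apply: cont_scale => // z nz.
  by apply: fc; rewrite nz.
have h1 n : bmeas (fun z => f ((rn n)%:CC * z)) by exact: bm.
have h2 n z : T z -> normc (f ((rn n)%:CC * z)) <= M.
  by move=> Tz; apply: hM; rewrite nn//; case/andP: (hrn n).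
have h3 z : T z -> f ((rn n)%:CC * z) @[n --> \oo] --> f (r%:CC * z).
  move=> Tz; have /fc h : normc (r%:CC * z) <= rho by rewrite nn.
  apply: (@cvg_comp _ _ _ (fun n => (rn n)%:CC * z) f _ _ _ _ h).
  by apply: (@cvgM C); [exact: cvg_RC|exact: cvg_cst].
have [_ H] := @cint_cvg R m _ _ M h1 h2 h3.
have : (fun n => cint m (fun z => f ((rn n)%:CC * z))) @ \oo --> c.
  by under eq_fun do rewrite cc; exact: cvg_cst.
by move=> H'; exact: (cvg_unique _ H H').
Qed.

(** An exceptional point, where only continuity is known, is allowed so that the
    result applies to difference quotients. *)
Lemma mean_value (f : C -> C) (w : C) (rho r : R) : 0 <= r -> r < rho ->
  (forall z : C, normc z < rho -> {for z, continuous f}) ->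
  (forall z : C, normc z < rho -> z != w -> derivable f z 1) ->
  cint m (fun z => f (r%:CC * z)) = f 0.
Proof.
move=> r0 rr fc df; pose D r := cint m (fun z => f (r%:CC * z)).
have D0 : D 0 = f 0.
  rewrite /D (_ : cint m _ = cint m (cst (f 0))); last by apply: eq_cint => z _; rewrite mul0r.
  by rewrite cint_cst cmass_circle mulr1.
rewrite -[LHS]/(D r) -D0.
have lim (rn : nat -> R) s c : (forall n, 0 <= rn n <= r) -> 0 <= s <= r ->
    rn n @[n --> \oo] --> s -> (forall n, D (rn n) = c) -> D s = c.
  move=> h1 h2; apply: (circle_mean_cvg (rho := r)) => // z zr; apply: fc; lra.
have ann a b r1 r2 : 0 < a -> a < r1 -> r1 < r2 -> r2 < b -> b <= rho ->
    (forall z : C, a < normc z < b -> z != w) -> D r1 = D r2.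
  move=> a0 ar1 r12 r2b brho nw; apply: (circle_mean_annulus a0 ar1 r12 r2b) => z zab.
  by apply: df; [case/andP: zab => _; lra|exact: nw].
pose t n : R := n.+2%:R^-1.
have t0 n : 0 < t n by rewrite invr_gt0.
have t1 n : t n < 1 by rewrite invf_lt1// ltr1n.
have tc : t n @[n --> \oo] --> (0 : R).
  have := @cvg_harmonic R; rewrite -(cvg_shiftS _); apply: cvg_trans.
  by apply: near_eq_cvg; apply: nearW.
have [->//|rn0] := eqVneq r 0.
have rp : 0 < r by rewrite lt_def rn0.
have inner s : 0 < s -> s <= r -> s < normc w \/ normc w = 0 -> D 0 = D s.
  move=> s0 sr hs; apply: (lim (fun n => s * t n)).
  - move=> n; have := t0 n; have := t1 n => ? ?; apply/andP; split; nra.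
  - by rewrite lexx ltW.
  - by rewrite -[0](mulr0 s); apply: cvgM => //; exact: cvg_cst.
  move=> n; case: hs => hs.
    apply: (ann (s * t n / 2) (Num.min (normc w) rho)).
    - by rewrite divr_gt0 ?mulr_gt0.
    - have : 0 < s * t n by rewrite mulr_gt0. lra.
    - by have := t1 n; nra.
    - by rewrite lt_min hs; lra.
    - by rewrite ge_min lexx orbT.
    - by move=> z /andP[_ zw]; apply: contraTneq zw => ->; rewrite -leNgt ge_min lexx.
  apply: (ann (s * t n / 2) rho) => //.
  - by rewrite divr_gt0 ?mulr_gt0.
  - have : 0 < s * t n by rewrite mulr_gt0. lra.
  - by have := t1 n; nra.
  - lra.
  - move=> z /andP[z0 _]; apply: contraTneq z0 => ->; rewrite hs -leNgt.
    by rewrite divr_ge0// mulr_ge0// ltW.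
have [w0|w0] := eqVneq (normc w) 0; first by rewrite -(inner r)//; right.
have wp : 0 < normc w by rewrite lt_def w0 normc_ge0.
have [rw|wr] := ltP r (normc w); first by rewrite -(inner r)//; left.
have Dw : D (normc w) = D 0.
  apply: (lim (fun n => normc w * (1 - t n))).
  - move=> n; have := t0 n; have := t1 n => ? ?; apply/andP; split; nra.
  - by rewrite ltW.
  - have : normc w * (1 - t n) @[n --> \oo] --> normc w * (1 - 0).
      by apply: cvgM; [exact: cvg_cst|apply: cvgB => //; exact: cvg_cst].
    by rewrite subr0 mulr1.
  move=> n; apply/esym/inner.
  - by rewrite mulr_gt0// subr_gt0.
  - by have := t0 n; nra.
  - by left; have := t0 n; nra.
rewrite -Dw; have [->//|rw] := eqVneq r (normc w).
have wr' : normc w < r by rewrite lt_def rw wr.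
apply/esym; apply: (lim (fun n => normc w + (r - normc w) * t n)).
- move=> n; have := t0 n; have := t1 n => ? ?; apply/andP; split; nra.
- by rewrite ltW.
- have : normc w + (r - normc w) * t n @[n --> \oo] --> normc w + (r - normc w) * 0.
    apply: cvgD; first exact: cvg_cst.
    by apply: cvgM => //; exact: cvg_cst.
  by rewrite mulr0 addr0.
move=> n; apply: (ann (normc w) rho) => //.
- by have := t0 n; nra.
- by have := t1 n; nra.
- by move=> z /andP[zw _]; apply: contraTneq zw => ->; rewrite ltxx.
Qed.

End CauchyMean.

(** * Power series *)

Section PowerSeries.
Variable R : realType.
Local Notation C := (Cplx R).
Implicit Types (a : nat -> C) (z w h : C) (r s : R).

Lemma geometric_sum_le (t : R) N : 0 <= t -> t < 1 ->
  \sum_(0 <= i < N) t ^+ i <= (1 - t)^-1.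
Proof.
move=> t0 t1; have h : 0 < 1 - t by rewrite subr_gt0.
rewrite -(ler_pM2l h) mulfV ?gt_eqF//.
have -> : (1 - t) * \sum_(0 <= i < N) t ^+ i = 1 - t ^+ N.
  elim: N => [|N IH]; first by rewrite big_geq// mulr0 expr0 subrr.
  by rewrite big_nat_recr//= mulrDr IH exprS; ring.
by rewrite gerBl exprn_ge0.
Qed.

Lemma cvg_series_C (b : nat -> C) (K : R) :
  (forall N, \sum_(0 <= i < N) normc (b i) <= K) ->
  exists l : C, series b @ \oo --> l.
Proof.
move=> hK.
have real (g : nat -> R) : (forall n, `|g n| <= normc (b n)) -> cvgn (series g).
  move=> hg; apply: normed_cvg.
  have nd : nondecreasing_seq [normed series g].
    by apply: nondecreasing_series => n _ _; exact: normr_ge0.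
  apply: nondecreasing_is_cvgn => //; exists K => _ [N _ <-].
  rewrite /normed_series_of /series /=; apply: le_trans (hK N).
  by apply: ler_sum => i _.
have /cvg_ex [lr hr] := real (fun n => complex.Re (b n)) (fun n => Re_le _).
have /cvg_ex [li hi] := real (fun n => complex.Im (b n)) (fun n => Im_le _).
exists (Complex lr li); apply: cvg_ReIm => /=.
  by apply: cvg_trans hr; apply: near_eq_cvg; apply: nearW => N; rewrite /series /= Re_sum.
by apply: cvg_trans hi; apply: near_eq_cvg; apply: nearW => N; rewrite /series /= Im_sum.
Qed.

Lemma expr_taylor2_le z h s n : 0 < s -> normc z <= s -> normc (z + h) <= s ->
  normc ((z + h) ^+ n - z ^+ n - n%:R * z ^+ n.-1 * h) * s ^+ 2
    <= n%:R ^+ 2 * s ^+ n * normc h ^+ 2.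
Proof.
move=> s0 zs zhs; elim: n => [|n IH].
  by rewrite !expr0 subrr mul0r mul0r subr0 normc0C !mul0r expr0n /= !mul0r.
have -> : (z + h) ^+ n.+1 - z ^+ n.+1 - n.+1%:R * z ^+ n.+1.-1 * h =
    (z + h) * ((z + h) ^+ n - z ^+ n - n%:R * z ^+ n.-1 * h) + n%:R * z ^+ n.-1 * h ^+ 2.
  case: n IH => [|n] _; rewrite ?expr0 ?expr1 /=; first by ring.
  by rewrite !exprS -!natr1; ring.
have h1 : normc ((z + h) * ((z + h) ^+ n - z ^+ n - n%:R * z ^+ n.-1 * h)) * s ^+ 2
    <= s * (n%:R ^+ 2 * s ^+ n * normc h ^+ 2).
  by rewrite normcM -mulrA ler_pM ?normc_ge0// mulr_ge0 ?normc_ge0// exprn_ge0// ltW.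
have h2 : normc (n%:R * z ^+ n.-1 * h ^+ 2) * s ^+ 2 <= n%:R * s ^+ n.+1 * normc h ^+ 2.
  case: n {IH h1} => [|n]; first by rewrite !mul0r normc0C mul0r.
  rewrite !normcM normc_nat !normcX /=.
  have q : normc z ^+ n <= s ^+ n by rewrite lerXn2r// ?nnegrE ?normc_ge0 ?(ltW s0).
  have -> : n.+1%:R * normc z ^+ n * normc h ^+ 2 * s ^+ 2 =
    n.+1%:R * normc h ^+ 2 * s ^+ 2 * normc z ^+ n by ring.
  have -> : n.+1%:R * s ^+ n.+2 * normc h ^+ 2 =
    n.+1%:R * normc h ^+ 2 * s ^+ 2 * s ^+ n by rewrite -addn2 exprD; ring.
  apply: ler_wpM2l q; apply: mulr_ge0; last exact: sqr_ge0.
  by apply: mulr_ge0; [exact: ler0n|exact: sqr_ge0].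
have sn : 0 <= s ^+ n.+1 * normc h ^+ 2 by rewrite mulr_ge0 ?sqr_ge0// exprn_ge0// ltW.
apply: (@le_trans _ _ ((n%:R ^+ 2 + n%:R) * (s ^+ n.+1 * normc h ^+ 2))).
  apply: le_trans (ler_wpM2r (sqr_ge0 s) (normcD_le _ _)) _.
  rewrite [leLHS]mulrDl [leRHS]mulrDl; apply: lerD; last by rewrite mulrA.
  apply: le_trans h1 _; rewrite [s ^+ n.+1]exprS le_eqVlt; apply/orP; left; apply/eqP; ring.
rewrite -mulrA ler_wpM2r// -natr1; have : 0 <= n%:R :> R by []. nra.
Qed.

(** Cauchy-Hadamard type bound: the coefficients are bounded on every smaller
    circle *)
Definition psbound a r := forall s, 0 < s -> s < r ->
  exists M, forall n, normc (a n) * s ^+ n <= M.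

Lemma psbound_sqr_sum a r s : psbound a r -> 0 < s -> s < r ->
  exists K, forall N, \sum_(0 <= n < N) n%:R ^+ 2 * normc (a n) * s ^+ n <= K.
Proof.
move=> ab s0 sr.
pose x := Num.min 1 ((r / s - 1) / 8).
have x0 : 0 < x by rewrite lt_min ltr01/= divr_gt0// subr_gt0 ltr_pdivlMr// mul1r.
have x1 : x <= 1 by rewrite ge_min lexx.
have x8 : x <= (r / s - 1) / 8 by rewrite ge_min lexx orbT.
have p0 : 0 < 1 + x by lra.
have r3 : s * (1 + x) ^+ 3 < r.
  rewrite mulrC -ltr_pdivlMr//; apply: (@lt_le_trans _ _ (1 + 8 * x)); last lra.
  have -> : (1 + x) ^+ 3 = 1 + x * (3 + 3 * x + x * x) by ring.
  by nra.
have [M hM] := ab _ (mulr_gt0 s0 (exprn_gt0 3 p0)) r3.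
have M0 : 0 <= M by apply: le_trans (hM 0%N); rewrite mulr_ge0 ?normc_ge0 ?exprn_ge0// mulr_ge0 ?exprn_ge0// ltW.
pose t := (1 + x)^-1.
have t0 : 0 < t by rewrite invr_gt0.
have t1 : t < 1 by rewrite invf_lt1//; lra.
exists (M / x ^+ 2 * (1 - t)^-1) => N.
apply: (@le_trans _ _ (\sum_(0 <= n < N) M / x ^+ 2 * t ^+ n)); last first.
  rewrite -mulr_sumr; apply: ler_wpM2l; last exact: geometric_sum_le (ltW t0) t1.
  exact: divr_ge0 M0 (sqr_ge0 _).
apply: ler_sum => n _.
have bern : n%:R * x <= (1 + x) ^+ n.
  elim: n => [|n IH]; first by rewrite mul0r expr0.
  rewrite exprS -natr1; have : 0 <= n%:R :> R by [].
  have : 1 <= (1 + x) ^+ n by rewrite exprn_ege1//; lra.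
  nra.
have pn0 : 0 < (1 + x) ^+ n by rewrite exprn_gt0.
have E : n%:R ^+ 2 * normc (a n) * s ^+ n =
    (n%:R * x * t ^+ n) ^+ 2 / x ^+ 2 * t ^+ n * (normc (a n) * (s * (1 + x) ^+ 3) ^+ n).
  have -> : (s * (1 + x) ^+ 3) ^+ n = s ^+ n * ((1 + x) ^+ n) ^+ 3.
    by rewrite exprMn -!exprM mulnC.
  have -> : t ^+ n = ((1 + x) ^+ n)^-1 by rewrite exprVn.
  by move: pn0; move: ((1 + x) ^+ n) => P P0; field; rewrite !gt_eqF.
have q1 : (n%:R * x * t ^+ n) ^+ 2 <= 1.
  have q0 : n%:R * x * t ^+ n <= 1 by rewrite /t exprVn ler_pdivrMr// mul1r.
  by apply: exprn_ile1 => //; rewrite mulr_ge0 ?exprn_ge0 ?(ltW t0)// mulr_ge0 ?ler0n ?(ltW x0).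
rewrite E; have := hM n; set A := _ * (_ ^+ n) => hA.
have A0 : 0 <= A.
  by rewrite mulr_ge0 ?normc_ge0 ?exprn_ge0// mulr_ge0 ?exprn_ge0// ltW.
have x20 : 0 <= x ^- 2 by rewrite invr_ge0 sqr_ge0.
have tn0 : 0 <= t ^+ n by rewrite exprn_ge0// ltW.
have -> : M / x ^+ 2 * t ^+ n = 1 / x ^+ 2 * t ^+ n * M by rewrite mul1r; ring.
apply: ler_pM => //.
  by apply: mulr_ge0 => //; apply: mulr_ge0 => //; exact: sqr_ge0.
by do 2 apply: ler_wpM2r => //.
Qed.

Lemma pseries_derive a r (f : C -> C) : psbound a r ->
  (forall z, normc z < r -> series (fun n => a n * z ^+ n) @ \oo --> f z) ->
  psbound (fun n => n.+1%:R * a n.+1) r /\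
  forall z, normc z < r -> exists2 d, is_derive z 1 f d &
    series (fun n => n.+1%:R * a n.+1 * z ^+ n) @ \oo --> d.
Proof.
move=> ab af.
have dsum s : 0 < s -> s < r -> exists K, forall N,
    \sum_(0 <= n < N) n.+1%:R * normc (a n.+1) * s ^+ n <= K.
  move=> s0 sr; have [K hK] := psbound_sqr_sum ab s0 sr.
  exists (K / s) => N; rewrite ler_pdivlMr//; apply: le_trans (hK N.+1).
  rewrite big_nat_recl//= expr0n /= !mul0r add0r mulr_suml; apply: ler_sum => n _.
  have -> : n.+1%:R * normc (a n.+1) * s ^+ n * s = n.+1%:R * (normc (a n.+1) * s ^+ n.+1).
    by rewrite exprS; ring.
  rewrite -mulrA; apply: ler_wpM2r.
    by rewrite mulr_ge0 ?normc_ge0// exprn_ge0// ltW.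
  by rewrite expr2 ler_peMl// ler1n.
split.
  move=> s s0 sr; have [K hK] := dsum s s0 sr; exists K => n.
  apply: le_trans (hK n.+1); rewrite big_nat_recr//= normcM normc_nat lerDr.
  by apply: sumr_ge0 => i _; rewrite !mulr_ge0 ?normc_ge0 ?exprn_ge0 ?ltW.
move=> z zr.
pose s := (normc z + r) / 2.
have zn := normc_ge0 z.
have [s0 zs sr] : [/\ 0 < s, normc z < s & s < r] by rewrite /s; split; lra.
have [K1 hK1] := dsum s s0 sr.
have [d hd] : exists d : C, series (fun n => n.+1%:R * a n.+1 * z ^+ n) @ \oo --> d.
  apply: (@cvg_series_C _ K1) => N; apply: le_trans (hK1 N); apply: ler_sum => n _.
  rewrite !normcM normc_nat normcX ler_wpM2l ?mulr_ge0 ?normc_ge0//.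
  by rewrite lerXn2r// ?nnegrE ?normc_ge0 ?(ltW s0) ?(ltW zs).
exists d; last exact: hd.
have [K hK] := psbound_sqr_sum ab s0 sr.
have K0 : 0 <= K by have := hK 0%N; rewrite big_geq.
have est h : normc h < s - normc z -> normc (f (h + z) - f z - d * h) * s ^+ 2 <= K * normc h ^+ 2.
  move=> hs.
  have zh : normc (z + h) <= s by have := normcD_le z h; lra.
  have c1 : series (fun n => a n * (h + z) ^+ n) @ \oo --> f (h + z).
    by apply: af; rewrite addrC; lra.
  have c2 := af z zr.
  have c3 : (fun N => series (fun n => n%:R * a n * z ^+ n.-1) N) @ \oo --> d.
    rewrite -(cvg_shiftS _); apply: cvg_trans hd; apply: near_eq_cvg.
    apply: nearW => N; rewrite /series /= big_nat_recl//= !mul0r add0r.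
    by [].
  have c4 : (normc (series (fun n => a n * (h + z) ^+ n) N - series (fun n => a n * z ^+ n) N
      - series (fun n => n%:R * a n * z ^+ n.-1) N * h) * s ^+ 2) @[N --> \oo]
      --> normc (f (h + z) - f z - d * h) * s ^+ 2.
    apply: cvgM; last exact: cvg_cst.
    exact: (cvg_normc (cvgB (cvgB c1 c2) (cvgM c3 (cvg_cst h)))).
  apply: (cvgr_to_le c4); apply: nearW => N.
  rewrite /series /= mulr_suml -sumrB -sumrB.
  apply: le_trans (ler_wpM2r (sqr_ge0 s) (normc_sum_le _ _ _)) _.
  rewrite mulr_suml; apply: le_trans (ler_wpM2r (sqr_ge0 _) (hK N)).
  rewrite mulr_suml; apply: ler_sum => n _.
  have -> : a n * (h + z) ^+ n - a n * z ^+ n - n%:R * a n * z ^+ n.-1 * h =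
     a n * ((z + h) ^+ n - z ^+ n - n%:R * z ^+ n.-1 * h) by rewrite [h + z]addrC; ring.
  have := expr_taylor2_le n s0 (ltW zs) zh => e.
  rewrite normcM -[leLHS]mulrA; apply: le_trans (ler_wpM2l (normc_ge0 (a n)) e) _.
  by rewrite le_eqVlt; apply/orP; left; apply/eqP; ring.
apply/cderive_epsP => e e0.
pose K' := K / s ^+ 2 + 1.
have s20 : 0 < s ^+ 2 by rewrite exprn_gt0.
have K'0 : 0 < K' by rewrite ltr_wpDl// divr_ge0// ltW.
exists (Num.min (s - normc z) (e / K')).
  by rewrite lt_min subr_gt0 zs divr_gt0.
move=> h; rewrite lt_min => /andP[h1 h2].
have hn := normc_ge0 h.
apply: (@le_trans _ _ (K * normc h ^+ 2 / s ^+ 2)); first by rewrite ler_pdivlMr// est.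
rewrite mulrAC expr2 mulrA ler_wpM2r//.
have : K / s ^+ 2 * normc h <= K' * normc h by rewrite ler_wpM2r// lerDl.
by move=> /le_trans; apply; rewrite mulrC -ler_pdivlMr// ltW.
Qed.

Lemma pseries_taylor a r (f : C -> C) : 0 < r -> psbound a r ->
  (forall z, normc z < r -> series (fun n => a n * z ^+ n) @ \oo --> f z) ->
  forall n, taylor f n = a n.
Proof.
move=> r0 ab af.
pose b k n : C := ((n + k) ^_ k)%N%:R * a (n + k)%N.
have H k : psbound (b k) r /\ forall z, normc z < r ->
    series (fun n => b k n * z ^+ n) @ \oo --> derive1n k f z.
  elim: k => [|k [IH1 IH2]].
    have -> : b 0%N = a by apply/funext => n; rewrite /b ffactn0 mul1r addn0.
    by split; [exact: ab|exact: af].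
  have [h1 h2] := pseries_derive IH1 IH2.
  have bE : b k.+1 = (fun n => n.+1%:R * b k n.+1).
    apply/funext => n; rewrite /b mulrA -natrM addnS addSn; congr (_%:R * _).
    by rewrite ffactnSr mulnC; congr (_ * _)%N; lia.
  rewrite bE; split; first exact: h1.
  move=> z zr; have [d dd hd] := h2 z zr.
  suff -> : derive1n k.+1 f z = d by exact: hd.
  by rewrite derive1nS derive1E; exact: (@derive_val _ _ _ _ _ _ _ dd).
move=> n; rewrite /taylor.
have [_ /(_ 0)] := H n; rewrite normc0C => /(_ r0) c.
have c' : series (fun i => b n i * (0 : C) ^+ i) @ \oo --> b n 0%N.
  rewrite -(cvg_shiftS _); apply: (@cvg_trans _ ((fun=> b n 0%N) @ \oo)); last exact: cvg_cst.
  apply: near_eq_cvg.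
  apply: nearW => N; rewrite /series /= big_nat_recl//= expr0 mulr1 big1 ?addr0// => i _.
  by rewrite expr0n /= mulr0.
have -> : derive1n n f 0 = b n 0%N.
  by apply: (cvg_unique _ c c').
rewrite /b add0n ffactnn mulrC mulrA mulVf ?mul1r//.
Qed.

End PowerSeries.

(** * Cauchy's formula *)

Section CauchyFormula.
Variable R : realType.
Local Notation C := (Cplx R).
Local Notation T := (@circle R).
Local Notation m := (@circle_measure R).
Local Notation "x %:CC" := (x%:C%C : C) (at level 2, format "x %:CC").

Lemma circle_neq0 (z : C) : T z -> z != 0.
Proof. by move=> /circle_normc nz; rewrite -normc_gt0 nz. Qed.

Lemma circle_inv (z : C) : T z -> z^-1 = (z^*)%C.
Proof.
move=> Tz; have /circle_normc nz := Tz; apply: (mulIf (circle_neq0 Tz)).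
by rewrite mulVf ?circle_neq0// conj_normc nz expr1n.
Qed.

Lemma inv_continuous_C (z : C) : z != 0 -> {for z, continuous (fun z : C => z^-1)}.
Proof. by move=> z0; exact: (@inv_continuous C). Qed.

Lemma bmeas_id : bmeas (fun z : C => z).
Proof. by apply: bmeas_cont => z _; exact: cvg_id. Qed.

Lemma bmeas_inv : bmeas (fun z : C => z^-1).
Proof. by apply: bmeas_cont => z /circle_neq0; exact: inv_continuous_C. Qed.

Lemma kernel_denom (u z : C) : T z -> 1 - normc u <= normc (1 - u * z^-1).
Proof.
move=> /circle_normc nz.
have := normcD_le (1 - u * z^-1) (u * z^-1); rewrite subrK normc1C normcM normcV nz invr1 mulr1.
lra.
Qed.

Lemma kernel_denom_neq0 (u z : C) : normc u < 1 -> T z -> 1 - u * z^-1 != 0.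
Proof. by move=> u1 Tz; rewrite -normc_gt0; have := kernel_denom u Tz; lra. Qed.

Lemma bmeas_kernel (u : C) : normc u < 1 -> bmeas (fun z => (1 - u * z^-1)^-1).
Proof.
move=> u1; apply: bmeas_cont => z Tz.
have c : {for z, continuous (fun z : C => 1 - u * z^-1)}.
  exact: (cvgB (cvg_cst (1 : C)) (cvgM (cvg_cst u) (inv_continuous_C (circle_neq0 Tz)))).
exact: (cvgV (kernel_denom_neq0 u1 Tz) c).
Qed.

Section AnyMeasure.
Variable mu : {finite_measure set (CplxB R) -> \bar R}.

(** The Fourier coefficient of index n of the measure F mu *)
Definition fcoef (F : C -> C) (n : nat) : C := cint mu (fun z => F z * z^-1 ^+ n).

Lemma fcoef_le (F : C -> C) (M : R) n : bmeas F -> (forall z, T z -> normc (F z) <= M) ->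
  normc (fcoef F n) <= M * cmass mu.
Proof.
move=> bF hF; apply: cint_norm_le; first exact: bmeasM bF (bmeasX _ bmeas_inv).
move=> z Tz; rewrite normcM normcX normcV; have /circle_normc -> := Tz.
by rewrite invr1 expr1n mulr1 hF.
Qed.

Lemma kernel_series (F : C -> C) (u : C) : bmeas F -> normc u < 1 ->
  series (fun n => fcoef F n * u ^+ n) @ \oo -->
    cint mu (fun z => F z * (1 - u * z^-1)^-1).
Proof.
move=> bF u1; have [_ _ [M hM]] := bF.
have bK := bmeas_kernel u1.
have bG n : bmeas (fun z => u ^+ n * (F z * z^-1 ^+ n)).
  exact: bmeasM (bmeas_cst _) (bmeasM bF (bmeasX _ bmeas_inv)).
have bFK := bmeasM bF bK.
have un := normc_ge0 u.
have E N : series (fun n => fcoef F n * u ^+ n) N =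
    cint mu (fun z => \sum_(0 <= n < N) u ^+ n * (F z * z^-1 ^+ n)).
  rewrite cint_sum//; apply: eq_bigr => n _; rewrite cintZ 1?mulrC//.
  exact: bmeasM bF (bmeasX _ bmeas_inv).
have key N : normc (series (fun n => fcoef F n * u ^+ n) N -
    cint mu (fun z => F z * (1 - u * z^-1)^-1))
    <= M * (1 - normc u)^-1 * cmass mu * normc u ^+ N.
  rewrite E -cintB//; last exact: bmeas_sum.
  rewrite mulrAC; apply: cint_norm_le.
    by apply: bmeasB => //; exact: bmeas_sum.
  move=> z Tz.
  have -> : \sum_(0 <= n < N) u ^+ n * (F z * z^-1 ^+ n) - F z * (1 - u * z^-1)^-1 =
     - (F z * (1 - u * z^-1)^-1 * (u * z^-1) ^+ N).
    have k0 := kernel_denom_neq0 u1 Tz.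
    apply: (mulIf k0); rewrite mulrBl mulNr mulfVK// mulrAC mulfVK//.
    elim: N => [|N IH]; first by rewrite big_geq// mul0r expr0 mulr1 sub0r.
    rewrite big_nat_recr//= mulrDl addrAC IH exprS exprMn; ring.
  rewrite normcN !normcM normcX normcM !normcV; have /circle_normc -> := Tz.
  rewrite invr1 mulr1 ler_wpM2r ?exprn_ge0// ler_pM ?normc_ge0 ?invr_ge0 ?normc_ge0 ?hM//.
  by rewrite lef_pV2 ?posrE ?kernel_denom ?subr_gt0// normc_gt0 kernel_denom_neq0.
apply: (@cvg_normc0 R _ _ _ _ _ (fun N => M * (1 - normc u)^-1 * cmass mu * normc u ^+ N)).
  by apply: nearW => N; exact: key.
rewrite -[0](mulr0 (M * (1 - normc u)^-1 * cmass mu)); apply: cvgM; first exact: cvg_cst.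
by apply: cvg_expr; rewrite ger0_norm.
Qed.

End AnyMeasure.

Lemma derivable_expr (n : nat) (z : C) : derivable (fun z : C => z ^+ n) z 1.
Proof. exact: exprn_derivable. Qed.

Lemma circle_moment (n : nat) : cint m (fun z => z ^+ n) = (n == 0%N)%:R.
Proof.
have := @mean_value R (fun z : C => z ^+ n) 0 2 1 ler01 _ _ _.
have h1 : (1 : R) < 2 by rewrite ltr1n.
have h2 (z : C) : normc z < 2 -> {for z, continuous (fun z : C => z ^+ n)}.
  by move=> _; apply: derivable_continuous_C; exact: derivable_expr.
have h3 (z : C) : normc z < 2 -> z != 0 -> derivable (fun z : C => z ^+ n) z 1.
  by move=> _ _; exact: derivable_expr.
move=> /(_ h1 h2 h3); rewrite expr0n => <-.
by apply: eq_cint => z _; rewrite mul1r.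
Qed.

Lemma circle_moment_inv (n : nat) : cint m (fun z => z^-1 ^+ n) = (n == 0%N)%:R.
Proof.
rewrite (_ : cint m _ = cint m (fun z => (z ^+ n)^*%C)).
  rewrite cint_conj ?circle_moment; last exact: bmeasX bmeas_id.
  by case: (n == 0%N); rewrite ?conjc0 ?conjc1.
by apply: eq_cint => z Tz; rewrite circle_inv// rmorphXn.
Qed.

Lemma cint_kernel (u : C) : normc u < 1 -> cint m (fun z => (1 - u * z^-1)^-1) = 1.
Proof.
move=> u1; have := @kernel_series m (fun=> 1) u (bmeas_cst 1) u1.
rewrite (_ : cint m _ = cint m (fun z => (1 - u * z^-1)^-1)); last first.
  by apply: eq_cint => z _; rewrite mul1r.
move=> c.
have E n : fcoef m (fun=> 1) n = (n == 0%N)%:R.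
  by rewrite -circle_moment_inv; apply: eq_cint => z _; rewrite mul1r.
have c' : series (fun n => fcoef m (fun=> 1) n * u ^+ n) @ \oo --> (1 : C).
  rewrite -(cvg_shiftS _); apply: (@cvg_trans _ ((fun=> (1 : C)) @ \oo)); last exact: cvg_cst.
  apply: near_eq_cvg; apply: nearW => N.
  rewrite /series /= big_nat_recl//= E expr0 mulr1 big1 ?addr0// => i _.
  by rewrite E mul0r.
exact: (cvg_unique _ c c').
Qed.

(** The mean value property of z (f z - f w) / (z - w), which is merely
    continuous at w, is Cauchy's formula for f at w. *)
Lemma cauchy_formula (f : C -> C) (rho r : R) (w : C) : 0 < r -> r < rho -> normc w < r ->
  (forall z : C, normc z < rho -> derivable f z 1) ->
  cint m (fun z => f (r%:CC * z) * (1 - (w / r%:CC) * z^-1)^-1) = f w.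
Proof.
move=> r0 rr wr df; pose u := w / r%:CC.
have rn0 : r%:CC != 0 by rewrite -normc_gt0 normc_real gtr0_norm.
have u1 : normc u < 1 by rewrite normcM normcV normc_real gtr0_norm// ltr_pdivrMr// mul1r.
have wrho : normc w < rho by lra.
have [d dd] : exists d, is_derive w 1 f d by exists ('D_1 f w); apply/derivableP; exact: df.
pose q (z : C) := if z == w then d else (f z - f w) / (z - w).
pose k (z : C) := z * q z.
have fcont (z : C) : normc z < rho -> {for z, continuous f}.
  by move=> zr; apply: derivable_continuous_C; exact: df.
have dk (z : C) : normc z < rho -> z != w -> derivable k z 1.
  move=> zr zw; have z1 : 0 < normc (z - w) by rewrite normc_gt0 subr_eq0.
  pose k' (z : C) := z * ((f z - f w) * (z - w)^-1).
  have ne : {near z, k' =1 k}.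
    apply/near_normc; exists (normc (z - w)) => // y yz; rewrite /k /k' /q.
    case: eqP => // yw; move: yz; rewrite yw -normcB ltxx//.
  apply: (near_eq_derivable ne); apply: derivableM; first exact: derivable_id.
  apply: derivableM.
    by apply: derivableB; [exact: df|exact: derivable_cst].
  apply: derivableV; first by rewrite subr_eq0.
  by apply: derivableB; [exact: derivable_id|exact: derivable_cst].
have ck (z : C) : normc z < rho -> {for z, continuous k}.
  move=> zr; have [->|zw] := eqVneq z w; last by apply: derivable_continuous_C; exact: dk.
  have cq : {for w, continuous q}.
    apply/(@cvgCP R _ (nbhs w)); apply/cvgrPdist_le => e e0; apply/near_normc.
    move/cderive_epsP : dd => /(_ e e0) [dl dl0 D]; exists dl => // y yw.
    rewrite sub0r normrN ger0_norm ?normc_ge0// /q eqxx.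
    have [_|ny] := eqVneq y w; first by rewrite subrr normc0C ltW.
    have y0 : y - w != 0 by rewrite subr_eq0.
    have yp : 0 < normc (y - w) by rewrite normc_gt0.
    have := D (y - w) yw; rewrite subrK => h.
    have -> : (f y - f w) / (y - w) - d = (f y - f w - d * (y - w)) / (y - w).
      by rewrite [RHS]mulrBl mulfK.
    by rewrite normcM normcV ler_pdivrMr.
  have ci : {for w, continuous (fun z : C => z)} by exact: cvg_id.
  exact: (cvgM ci cq).
have := mean_value (ltW r0) rr ck dk; rewrite [k 0]mul0r => mk.
have bf : bmeas (fun z => f (r%:CC * z)).
  apply: bmeas_cont; apply: cont_scale; first exact: ltW.
  by move=> z zr; apply: fcont; rewrite zr.
have bK := bmeas_kernel u1.
have : cint m (fun z => f (r%:CC * z) * (1 - u * z^-1)^-1) -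
    cint m (fun z => f w * (1 - u * z^-1)^-1) = 0.
  rewrite -cintB -?mk; [|exact: bmeasM bf bK|exact: bmeasM (bmeas_cst _) bK].
  apply: eq_cint => z Tz; have k0 := kernel_denom_neq0 u1 Tz; have z0 := circle_neq0 Tz.
  have /circle_normc nz := Tz.
  rewrite /k /q ifN; last first.
    apply/eqP => e; move: wr; rewrite -e normcM nz mulr1 normc_real gtr0_norm// ltxx//.
  rewrite -mulrBl.
  have -> : (1 - u * z^-1)^-1 = r%:CC * z / (r%:CC * z - w).
    have -> : r%:CC * z - w = r%:CC * z * (1 - u * z^-1).
      by rewrite mulrBr mulr1 /u; congr (_ - _); field; rewrite z0 rn0.
    by rewrite invfM mulrA mulfV ?mul1r// mulf_neq0.
  by rewrite mulrCA !mulrA.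
rewrite cintZ// cint_kernel// mulr1 => /eqP; rewrite subr_eq0 => /eqP.
exact.
Qed.

Lemma taylor_circle (f : C -> C) (rho r : R) : 0 < r -> r < rho ->
  (forall z : C, normc z < rho -> derivable f z 1) ->
  (forall n, taylor f n * r%:CC ^+ n = fcoef m (fun z => f (r%:CC * z)) n) /\
  forall w : C, normc w < r -> series (fun n => taylor f n * w ^+ n) @ \oo --> f w.
Proof.
move=> r0 rr df; pose F (z : C) := f (r%:CC * z).
have rn0 : r%:CC != 0 by rewrite -normc_gt0 normc_real gtr0_norm.
have bF : bmeas F.
  apply: bmeas_cont; apply: cont_scale; first exact: ltW.
  by move=> z zr; apply: derivable_continuous_C; apply: df; rewrite zr.
pose a n := fcoef m F n / r%:CC ^+ n.
have ab : psbound a r.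
  have [_ _ [M hM]] := bF; move=> s s0 sr; exists M => n.
  rewrite /a normcM normcV normcX normc_real gtr0_norm// -mulrA.
  apply: (@le_trans _ _ (M * 1)); last by rewrite mulr1.
  apply: ler_pM; rewrite ?normc_ge0//.
  - by rewrite mulr_ge0// ?invr_ge0 exprn_ge0// ltW.
  - by have := fcoef_le m n bF hM; rewrite cmass_circle mulr1.
  rewrite mulrC ler_pdivrMr ?exprn_gt0// mul1r lerXn2r// ?nnegrE; exact: ltW.
have af (w : C) : normc w < r -> series (fun n => a n * w ^+ n) @ \oo --> f w.
  move=> wr.
  have u1 : normc (w / r%:CC) < 1 by rewrite normcM normcV normc_real gtr0_norm// ltr_pdivrMr// mul1r.
  have := @kernel_series m F _ bF u1; rewrite (cauchy_formula r0 rr wr df).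
  suff -> : (fun n => fcoef m F n * (w / r%:CC) ^+ n) = (fun n => a n * w ^+ n) by [].
  by apply/funext => n; rewrite /a expr_div_n mulrAC mulrA.
have E := pseries_taylor r0 ab af.
split=> [n|w wr]; first by rewrite E /a mulfVK// expf_neq0.
by under eq_fun do rewrite E; exact: af.
Qed.

End CauchyFormula.

(** * Taylor coefficients *)

Section TaylorTools.
Variable R : realType.
Local Notation C := (Cplx R).
Local Notation T := (@circle R).
Local Notation m := (@circle_measure R).
Local Notation "x %:CC" := (x%:C%C : C) (at level 2, format "x %:CC").

(** Sealed, so that automation does not look for derivatives *)
Variant hol (rho : R) (f : C -> C) : Prop :=
  Hol of forall z : C, normc z < rho -> derivable f z 1.

Lemma holP rho f : hol rho f -> forall z : C, normc z < rho -> derivable f z 1.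
Proof. by case. Qed.

Lemma hol_cont rho f (z : C) : hol rho f -> normc z < rho -> {for z, continuous f}.
Proof. by move=> hf zr; apply: derivable_continuous_C; exact: (holP hf). Qed.

Lemma hol_bmeas rho f (r : R) : hol rho f -> 0 <= r -> r < rho ->
  bmeas (fun z => f (r%:CC * z)).
Proof.
move=> hf r0 rr; apply: bmeas_cont; apply: cont_scale => // z zr.
by apply: hol_cont hf _; rewrite zr.
Qed.

Lemma hol_bmeas1 rho f : hol rho f -> 1 < rho -> bmeas f.
Proof.
move=> hf r1; apply: bmeas_cont => z /circle_normc nz.
by apply: hol_cont hf _; rewrite nz.
Qed.

Lemma holM rho f g : hol rho f -> hol rho g -> hol rho (fun z => f z * g z).
Proof. by case=> hf [hg]; split=> z zr; apply: derivableM; [exact: hf|exact: hg]. Qed.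

Lemma holD rho f g : hol rho f -> hol rho g -> hol rho (fun z => f z + g z).
Proof. by case=> hf [hg]; split=> z zr; apply: derivableD; [exact: hf|exact: hg]. Qed.

Lemma hol_cst rho (c : C) : hol rho (fun=> c).
Proof. by split=> z _; exact: derivable_cst. Qed.

Lemma holX rho n : hol rho (fun z : C => z ^+ n).
Proof. by split=> z _; exact: derivable_expr. Qed.

Lemma hol_cexp rho f : hol rho f -> hol rho (fun z => cexp (f z)).
Proof.
case=> hf; split=> z zr; apply: (@derivable_comp_C R (@cexp R) f); last exact: hf.
exact: derivable_cexp.
Qed.

Lemma hol_poly rho (p : {poly C}) : hol rho (fun z : C => p.[z]).
Proof.
elim/poly_ind : p => [|p c IH].
  have -> : (fun z : C => (0 : {poly C}).[z]) = (fun=> 0) by apply/funext => z; rewrite horner0.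
  exact: hol_cst.
have -> : (fun z : C => (p * 'X + c%:P).[z]) = (fun z => p.[z] * z ^+ 1 + c).
  by apply/funext => z; rewrite hornerMXaddC expr1.
by apply: holD; [apply: holM; [exact: IH|exact: holX]|exact: hol_cst].
Qed.

Lemma fcoef_taylor rho f : hol rho f -> 1 < rho -> forall n, taylor f n = fcoef m f n.
Proof.
move=> hf r1 n; have [h _] := taylor_circle ltr01 r1 (holP hf).
have := h n; rewrite expr1n mulr1 => ->.
by apply: eq_cint => z _; rewrite mul1r.
Qed.

Lemma taylor_sum rho f (w : C) : hol rho f -> normc w < rho ->
  series (fun n => taylor f n * w ^+ n) @ \oo --> f w.
Proof.
move=> hf wr; have w0 := normc_ge0 w.
pose r := (normc w + rho) / 2.
have [r0 rr wr'] : [/\ 0 < r, r < rho & normc w < r] by rewrite /r; split; lra.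
by have [_] := taylor_circle r0 rr (holP hf); apply.
Qed.

Lemma taylor0_eq0 rho f : hol rho f -> (forall n, taylor f n = 0) ->
  forall z : C, normc z < rho -> f z = 0.
Proof.
move=> hf t0 z zr; have c := taylor_sum hf zr.
have c' : series (fun n => taylor f n * z ^+ n) @ \oo --> (0 : C).
  apply: (@cvg_trans _ ((fun=> (0 : C)) @ \oo)); last exact: cvg_cst.
  apply: near_eq_cvg; apply: nearW => N; rewrite /series /= big1// => i _.
  by rewrite t0 mul0r.
exact: (cvg_unique _ c c').
Qed.

Lemma hol_ext rho f g : (forall z : C, normc z < rho -> f z = g z) -> hol rho f -> hol rho g.
Proof.
move=> fg [hf]; split=> z zr; apply: (@near_eq_derivable _ _ _ f g); last exact: hf.
apply/near_normc; exists (rho - normc z); first by rewrite subr_gt0.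
move=> w wz; apply: fg; have := normcD_le (w - z) z; rewrite subrK; lra.
Qed.

Lemma taylor_ext rho f g : 0 < rho -> (forall z : C, normc z < rho -> f z = g z) ->
  hol rho f -> forall n, taylor f n = taylor g n.
Proof.
move=> rho0 fg hf n; have hg := hol_ext fg hf.
have r0 : 0 < rho / 2 by lra. have rr : rho / 2 < rho by lra.
have [hF _] := taylor_circle r0 rr (holP hf); have [hG _] := taylor_circle r0 rr (holP hg).
have r1 : (rho / 2)%:CC ^+ n != 0 by rewrite expf_neq0// -normc_gt0 normc_real gtr0_norm.
apply: (mulIf r1); rewrite hF hG; apply: eq_cint => z /circle_normc nz.
by rewrite fg// normcM nz mulr1 normc_real gtr0_norm.
Qed.

Lemma cint_pos_moment rho f (j : nat) (r : R) : hol rho f -> 0 <= r -> r < rho ->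
  cint m (fun z => f (r%:CC * z) * z ^+ j.+1) = 0.
Proof.
move=> hf; rewrite le_eqVlt => /orP[/eqP <- _|r0 rr].
  rewrite (_ : cint m _ = cint m (fun z => f 0 * z ^+ j.+1)).
    by rewrite cintZ ?circle_moment ?mulr0//; exact: bmeasX (@bmeas_id R).
  by apply: eq_cint => z _; rewrite mul0r.
have rn0 : r%:CC != 0 by rewrite -normc_gt0 normc_real gtr0_norm.
pose g (z : C) := f z * z ^+ j.+1.
have hg : hol rho g by apply: holM => //; exact: holX.
have : cint m (fun z => g (r%:CC * z)) = g 0.
  apply: (@mean_value R g 0 rho r) => //; first exact: ltW.
    by move=> z zr; exact: hol_cont hg zr.
  by move=> z zr _; exact: (holP hg).
rewrite /g expr0n mulr0 => h.
apply: (mulfI (expf_neq0 j.+1 rn0)); rewrite mulr0 -[RHS]h -cintZ.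
  by apply: eq_cint => z _; rewrite exprMn; ring.
by apply: bmeasM; [exact: hol_bmeas hf (ltW r0) rr|exact: bmeasX (@bmeas_id R)].
Qed.

Lemma taylor_mulXn rho f (k n : nat) : 0 < rho -> hol rho f ->
  taylor (fun z => z ^+ k * f z) n = if (k <= n)%N then taylor f (n - k)%N else 0.
Proof.
move=> rho0 hf; pose r := rho / 2.
have r0 : 0 < r by rewrite /r; lra. have rr : r < rho by rewrite /r; lra.
have hg : hol rho (fun z => z ^+ k * f z) by apply: holM => //; exact: holX.
have [hF _] := taylor_circle r0 rr (holP hf); have [hG _] := taylor_circle r0 rr (holP hg).
have rn0 : r%:CC != 0 by rewrite -normc_gt0 normc_real gtr0_norm.
have bf := hol_bmeas hf (ltW r0) rr.
apply: (mulIf (expf_neq0 n rn0)); rewrite hG.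
have [kn|nk] := leqP k n.
  have -> : taylor f (n - k)%N * r%:CC ^+ n = r%:CC ^+ k * (taylor f (n - k)%N * r%:CC ^+ (n - k)).
    have -> : r%:CC ^+ n = r%:CC ^+ (n - k) * r%:CC ^+ k by rewrite -exprD subnK.
    by ring.
  rewrite hF -cintZ; last exact: bmeasM bf (bmeasX _ (@bmeas_inv R)).
  apply: eq_cint => z Tz; rewrite exprMn.
  have -> : z^-1 ^+ n = z^-1 ^+ (n - k) * z^-1 ^+ k by rewrite -exprD subnK.
  have z0 := circle_neq0 Tz.
  have e : z ^+ k * z^-1 ^+ k = 1 by rewrite -exprMn mulfV// expr1n.
  rewrite -[RHS]mulr1 -e; ring.
rewrite mul0r; have [j jE] : exists j, (k = n + j.+1)%N.
  by exists (k - n).-1; rewrite prednK ?subn_gt0// subnKC// ltnW.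
transitivity (r%:CC ^+ k * cint m (fun z => f (r%:CC * z) * z ^+ j.+1)).
  rewrite -cintZ; last exact: bmeasM bf (bmeasX _ (@bmeas_id R)).
  apply: eq_cint => z Tz; rewrite exprMn {2}jE [z ^+ (n + _)]exprD.
  have z0 := circle_neq0 Tz.
  have e : z ^+ n * z^-1 ^+ n = 1 by rewrite -exprMn mulfV// expr1n.
  rewrite -[RHS]mulr1 -e; ring.
by rewrite (cint_pos_moment _ hf (ltW r0) rr) mulr0.
Qed.

(** Multiplication by z ^ k shifts the Taylor coefficients. *)
Lemma cint_shifted rho f (k n : nat) : hol rho f -> 1 < rho ->
  cint m (fun z => f z * z ^+ k * z^-1 ^+ n) = if (k <= n)%N then taylor f (n - k)%N else 0.
Proof.
move=> hf r1; have rho0 : 0 < rho by lra.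
rewrite -(taylor_mulXn k n rho0 hf).
rewrite (fcoef_taylor (rho := rho))//; last by apply: holM => //; exact: holX.
by apply: eq_cint => z _; ring.
Qed.

Lemma taylor_cvg (f_ : nat -> C -> C) (f : C -> C) (M : R) :
  (forall j, hol 1 (f_ j)) -> hol 1 f ->
  (forall j (z : C), normc z < 1 -> normc (f_ j z) <= M) ->
  (forall z : C, normc z < 1 -> f_ j z @[j --> \oo] --> f z) ->
  forall n, taylor (f_ j) n @[j --> \oo] --> taylor f n.
Proof.
move=> hf_ hf hM hc n; pose r : R := 2^-1.
have r0 : 0 < r by rewrite /r; lra. have r1 : r < 1 by rewrite /r; lra.
have rn0 : r%:CC != 0 by rewrite -normc_gt0 normc_real gtr0_norm.
have nz z : T z -> normc (r%:CC * z) < 1.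
  by move=> /circle_normc nz; rewrite normcM nz mulr1 normc_real gtr0_norm.
have E (g : C -> C) : hol 1 g -> taylor g n = (r%:CC ^+ n)^-1 * fcoef m (fun z => g (r%:CC * z)) n.
  by move=> hg; have [<- _] := taylor_circle r0 r1 (holP hg); rewrite mulrC mulfK// expf_neq0.
have h1 j : bmeas (fun z => f_ j (r%:CC * z) * z^-1 ^+ n).
  exact: bmeasM (hol_bmeas (hf_ j) (ltW r0) r1) (bmeasX _ (@bmeas_inv R)).
have h2 j z : T z -> normc (f_ j (r%:CC * z) * z^-1 ^+ n) <= M.
  move=> Tz; have /circle_normc z1 := Tz.
  by rewrite normcM normcX normcV z1 invr1 expr1n mulr1 hM// nz.
have h3 z : T z -> f_ j (r%:CC * z) * z^-1 ^+ n @[j --> \oo] --> f (r%:CC * z) * z^-1 ^+ n.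
  by move=> Tz; exact: (cvgM (hc _ (nz z Tz)) (cvg_cst _)).
have [_ H] := @cint_cvg R m _ _ M h1 h2 h3.
rewrite (E f hf).
have -> : (fun j => taylor (f_ j) n) = (fun j => (r%:CC ^+ n)^-1 * fcoef m (fun z => f_ j (r%:CC * z)) n).
  by apply/funext => j; rewrite E.
exact: (cvgM (cvg_cst _) H).
Qed.

Lemma taylor_summable rho f : hol rho f -> 1 < rho -> exists M (q : R),
  [/\ 0 <= M, 0 < q, q < 1 & forall n, normc (taylor f n) <= M * q ^+ n].
Proof.
move=> hf r1; pose r := (1 + rho) / 2.
have [r0 rr r1'] : [/\ 0 < r, r < rho & 1 < r] by rewrite /r; split; lra.
have bF := hol_bmeas hf (ltW r0) rr; have [_ _ [M hM]] := bF.
have [hF _] := taylor_circle r0 rr (holP hf).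
exists M, r^-1; split.
- by apply: le_trans (hM 1 _); rewrite ?normc_ge0//; apply/circle_normc; exact: normc1C.
- by rewrite invr_gt0.
- by rewrite invf_lt1.
move=> n; rewrite exprVn ler_pdivlMr ?exprn_gt0//.
have -> : normc (taylor f n) * r ^+ n = normc (taylor f n * r%:CC ^+ n).
  by rewrite [RHS]normcM normcX normc_real gtr0_norm.
by rewrite hF; have := @fcoef_le R m _ _ n bF hM; rewrite cmass_circle mulr1.
Qed.

Lemma parseval rho f : hol rho f -> 1 < rho ->
  (fun N => \sum_(0 <= n < N) normc (taylor f n) ^+ 2) @ \oo -->
    complex.Re (cint m (fun z => (normc (f z) ^+ 2)%:CC)).
Proof.
move=> hf r1.
have bf := hol_bmeas1 hf r1.
have bS N : bmeas (fun z => \sum_(0 <= n < N) (taylor f n)^*%C * (z^-1) ^+ n).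
  by apply: bmeas_sum => n; exact: bmeasM (bmeas_cst _) (bmeasX _ (@bmeas_inv R)).
have E N : \sum_(0 <= n < N) normc (taylor f n) ^+ 2 =
   complex.Re (cint m (fun z => f z * \sum_(0 <= n < N) (taylor f n)^*%C * (z^-1) ^+ n)).
  rewrite (_ : cint m _ = \sum_(0 <= n < N) (taylor f n)^*%C * taylor f n); last first.
    rewrite (_ : cint m _ = cint m (fun z => \sum_(0 <= n < N) (taylor f n)^*%C * (f z * (z^-1) ^+ n))).
      rewrite cint_sum; last first.
        by move=> n; exact: bmeasM (bmeas_cst _) (bmeasM bf (bmeasX _ (@bmeas_inv R))).
      apply: eq_bigr => n _; rewrite cintZ ?(fcoef_taylor hf)//.
      exact: bmeasM bf (bmeasX _ (@bmeas_inv R)).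
    by apply: eq_cint => z _; rewrite mulr_sumr; apply: eq_bigr => n _; ring.
  by rewrite Re_sum; apply: eq_bigr => n _; rewrite conj_normc.
have -> : (fun N => \sum_(0 <= n < N) normc (taylor f n) ^+ 2) =
   (fun N => complex.Re (cint m (fun z => f z * \sum_(0 <= n < N) (taylor f n)^*%C * (z^-1) ^+ n))).
  by apply/funext.
apply: cvg_Re.
have [M [q [M0 q0 q1 hq]]] := taylor_summable hf r1.
have [_ _ [K hK]] := bf.
have h2 N z : T z -> normc (f z * \sum_(0 <= n < N) (taylor f n)^*%C * (z^-1) ^+ n) <= K * (M / (1 - q)).
  move=> Tz; have /circle_normc nz := Tz.
  rewrite normcM ler_pM ?normc_ge0 ?hK//.
  apply: le_trans (normc_sum_le _ _ _) _.
  apply: (@le_trans _ _ (\sum_(0 <= n < N) M * q ^+ n)).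
    by apply: ler_sum => n _; rewrite normcM normc_conj normcX normcV nz invr1 expr1n mulr1 hq.
  by rewrite -mulr_sumr ler_wpM2l// geometric_sum_le// ltW.
have h3 z : T z -> f z * (\sum_(0 <= n < N) (taylor f n)^*%C * (z^-1) ^+ n) @[N --> \oo]
    --> (normc (f z) ^+ 2)%:CC.
  move=> Tz; have /circle_normc nz := Tz.
  have zrho : normc z < rho by rewrite nz.
  have c : (series (fun n => taylor f n * z ^+ n) N)^*%C @[N --> \oo] --> ((f z)^*%C : C).
    exact: cvg_conj (taylor_sum hf zrho).
  have -> : (fun N => f z * (\sum_(0 <= n < N) (taylor f n)^*%C * (z^-1) ^+ n)) =
      (fun N => f z * (series (fun n => taylor f n * z ^+ n) N)^*%C).
    apply/funext => N; congr (_ * _); rewrite /series /= rmorph_sum; apply: eq_bigr => n _.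
    by rewrite circle_inv// [RHS]rmorphM [in RHS]rmorphXn.
  rewrite -conj_normc mulrC; exact: (cvgM (cvg_cst _) c).
have h1 N : bmeas (fun z => f z * \sum_(0 <= n < N) (taylor f n)^*%C * (z^-1) ^+ n).
  exact: bmeasM bf (bS N).
by have [_ H] := @cint_cvg R m _ _ _ h1 h2 h3; exact: H.
Qed.

Lemma bessel rho f (M : R) N : hol rho f -> 1 < rho ->
  (forall z, T z -> normc (f z) <= M) -> \sum_(0 <= n < N) normc (taylor f n) ^+ 2 <= M ^+ 2.
Proof.
move=> hf r1 hM; have c := parseval hf r1.
have nd : nondecreasing_seq (fun N => \sum_(0 <= n < N) normc (taylor f n) ^+ 2).
  by apply: nondecreasing_series => n _ _; exact: sqr_ge0.
have bf := hol_bmeas1 hf r1.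
apply: le_trans (nondecreasing_cvgn_le nd _ N) _; first by apply/cvg_ex; eexists; exact: c.
rewrite (cvg_lim _ c)//.
have -> : M ^+ 2 = complex.Re (cint m (cst ((M ^+ 2)%:CC))) by rewrite cint_cst cmass_circle mulr1.
apply: Re_cint_le; [|exact: bmeas_cst|] => [|z Tz] /=.
  by apply: bmeas_ext (bmeasM (bmeas_conj bf) bf) => z _; rewrite conj_normc.
by rewrite lerXn2r ?nnegrE ?normc_ge0 ?hM// (le_trans (normc_ge0 _) (hM _ Tz)).
Qed.

End TaylorTools.

(** * Exponentials with a lacunary perturbation *)

Section StepLemma.
Variable R : realType.
Local Notation C := (Cplx R).
Local Notation T := (@circle R).
Local Notation m := (@circle_measure R).
Local Notation "x %:CC" := (x%:C%C : C) (at level 2, format "x %:CC").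

Lemma taylor_cexp n : taylor (@cexp R) n = (n`!%:R)^-1.
Proof.
have -> : taylor (@cexp R) n = derive1n n (@cexp R) 0 / n`!%:R by [].
suff -> : derive1n n (@cexp R) = @cexp R by rewrite cexp0 mul1r.
elim: n => [//|n IH]; rewrite derive1nS IH; apply/funext => z.
by rewrite derive1E; exact: (@derive_val _ _ _ _ _ _ _ (is_derive_cexp z)).
Qed.

Lemma cexp_sum (x : C) :
  series (fun n => x ^+ n / n`!%:R) @ \oo --> cexp x.
Proof.
have hc : hol (normc x + 1) (@cexp R) by split=> z _; exact: derivable_cexp.
have h : normc x < normc x + 1 by rewrite ltrDl.
have := taylor_sum hc h.
suff -> : (fun n => taylor (@cexp R) n * x ^+ n) = (fun n => x ^+ n / n`!%:R) by [].
by apply/funext => n; rewrite taylor_cexp mulrC.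
Qed.

Definition exp_tail (L : R) (K : nat) : R := expR L - \sum_(0 <= k < K) L ^+ k / k`!%:R.

Lemma expR_sum (x : R) : series (fun n => x ^+ n / n`!%:R) @ \oo --> expR x.
Proof.
have -> : (fun n => x ^+ n / n`!%:R) = exp_coeff x by apply/funext => n; rewrite /exp_coeff.
exact: is_cvg_series_exp_coeff.
Qed.

Lemma cexp_tail (L : R) (x : C) (K : nat) : normc x <= L ->
  normc (cexp x - \sum_(0 <= k < K) x ^+ k / k`!%:R) <= exp_tail L K.
Proof.
move=> xL; rewrite /exp_tail.
set S := \sum_(0 <= k < K) x ^+ k / _; set S' := \sum_(0 <= k < K) L ^+ k / _.
have c1 : (fun N => normc (series (fun n => x ^+ n / n`!%:R) N - S)) @ \oo --> normc (cexp x - S).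
  apply: cvg_normc.
  have c0 : (fun N : nat => S) @ \oo --> S by exact: cvg_cst.
  exact: (cvgB (@cexp_sum x) c0).
have c2 : (fun N => series (fun n => L ^+ n / n`!%:R) N - S') @ \oo --> expR L - S'.
  exact: (cvgB (@expR_sum L) (cvg_cst S')).
apply: (ler_cvg_to c1 c2); exists K => // N /= KN.
rewrite /series /= /S /S'.
rewrite (big_cat_nat (n := K))//= addrAC subrr add0r.
rewrite (big_cat_nat (n := K) (F := fun k => L ^+ k / k`!%:R))//= [X in _ <= X]addrAC subrr add0r.
apply: le_trans (normc_sum_le _ _ _) _; apply: ler_sum => k _.
rewrite normcM normcV normc_nat normcX ler_wpM2r ?invr_ge0//.
by rewrite lerXn2r// nnegrE ?normc_ge0// (le_trans (normc_ge0 x)).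
Qed.

Lemma exp_tail_cvg0 (L : R) : exp_tail L K @[K --> \oo] --> (0 : R).
Proof.
rewrite -(subrr (expR L)); exact: (cvgB (cvg_cst (expR L)) (@expR_sum L)).
Qed.

Lemma exp_term_le (x : R) k : 0 <= x -> x ^+ k / k`!%:R <= expR x.
Proof.
move=> x0; have nd : nondecreasing_seq (series (fun n => x ^+ n / n`!%:R)).
  by apply: nondecreasing_series => n _ _; rewrite divr_ge0// exprn_ge0.
have c := @expR_sum x.
have cc : cvgn (series (fun n => x ^+ n / n`!%:R)) by apply/cvg_ex; eexists; exact: c.
have := nondecreasing_cvgn_le nd cc k.+1; rewrite (cvg_lim _ c)//; apply: le_trans.
rewrite /series /= big_nat_recr//= lerDr; apply: sumr_ge0 => i _.
by rewrite divr_ge0// exprn_ge0.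
Qed.

Lemma window_disjoint (x y D r n : nat) : (x <= n)%N -> (n - x < r)%N -> (r < D)%N ->
  (D + x <= y)%N -> (y <= n)%N -> False.
Proof. lia. Qed.

(** The frequency windows of the powers of a high frequency perturbation are
    disjoint, so that at most one power contributes to a given coefficient. *)
Lemma sum_one_active_le (x : nat -> R) (act : pred nat) (M d : R) K : 0 <= M -> 0 <= d ->
  (forall k, (k < K)%N -> x k <= if act k then M else d) ->
  (forall k l, act k -> act l -> k = l) ->
  \sum_(0 <= k < K) x k <= M + K%:R * d.
Proof.
move=> M0 d0 hx uniq.
suff H J : (J <= K)%N -> \sum_(0 <= k < J) x k <=
    (if [exists k : 'I_J, act k] then M else 0) + J%:R * d.
  apply: le_trans (H K (leqnn K)) _; rewrite lerD2r; case: ifP => //.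
elim: J => [|J IH] JK; first by rewrite big_geq// mul0r addr0; case: ifP.
rewrite big_nat_recr//=; have IH' := IH (ltnW JK); have hJ := hx J JK.
rewrite -natr1 mulrDl mul1r.
case: (boolP (act J)) hJ => aJ hJ.
  have -> : [exists k : 'I_J.+1, act k] by apply/existsP; exists ord_max.
  move: IH'; have -> : [exists k : 'I_J, act k] = false.
    apply/existsP => -[k ak]; have := uniq _ _ ak aJ => kJ.
    by have := ltn_ord k; rewrite kJ ltnn.
  by move=> h; lra.
have -> : [exists k : 'I_J.+1, act k] = [exists k : 'I_J, act k].
  apply/existsP/existsP => -[k ak].
    have kJ : (k < J)%N.
      have := ltn_ord k; rewrite ltnS leq_eqVlt => /orP[/eqP kJ|//].
      by move: ak; rewrite kJ => h; rewrite h in aJ.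
    by exists (Ordinal kJ).
  by exists (widen_ord (leqnSn J) k).
lra.
Qed.

(** Multiplying by the exponential of a small high frequency term spreads the
    expansion over disjoint frequency windows: in the k-th window only
    F phi^k / k! is visible, and its coefficients are at most a B. *)
Lemma coef_step (F : C -> C) (p : {poly C}) (d : nat) (phi : C -> C) (B a eps : R) :
  hol 2 F -> (forall z, T z -> p.[z] = z ^+ d * phi z) ->
  (forall z, T z -> normc (F z) * expR (normc (phi z)) <= B) ->
  0 < a -> a <= 1 -> 0 < eps ->
  exists N0, forall N, (N0 <= N)%N -> forall n, (0 < n)%N ->
    normc (taylor (fun z => F z * cexp (- (a%:CC * (z ^+ (N - d) * p.[z])))) n)
      <= Num.max (normc (taylor F n)) (a * B) + eps.
Proof.
move=> hF pphi hB a0 a1 eps0.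
have r1 : (1 : R) < 2 by rewrite ltr1n.
have bF := hol_bmeas1 hF r1.
have [_ _ [MF hMF]] := bF.
have bp : bmeas (fun z : C => p.[z]) := hol_bmeas1 (hol_poly 2 p) r1.
have [_ _ [L hL]] := bp.
have T1 : T 1 by apply/circle_normc; exact: normc1C.
have L0 : 0 <= L by apply: le_trans (hL 1 T1); rewrite normc_ge0.
have MF0 : 0 <= MF by apply: le_trans (hMF 1 T1); rewrite normc_ge0.
have B0 : 0 <= B by apply: le_trans (hB 1 T1); rewrite mulr_ge0 ?normc_ge0 ?expR_ge0.
have nphi z : T z -> normc (phi z) = normc p.[z].
  by move=> Tz; rewrite pphi// normcM normcX; have /circle_normc -> := Tz; rewrite expr1n mul1r.
have [K hK] : exists K, MF * exp_tail L K <= eps / 2.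
  have MF1 : 0 < MF + 1 by rewrite ltr_wpDl.
  have : \forall K \near \oo, exp_tail L K < eps / 2 / (MF + 1).
    have := @exp_tail_cvg0 L => /cvgrPdist_lt /(_ (eps / 2 / (MF + 1))).
    rewrite divr_gt0 ?divr_gt0// => /(_ isT); apply: filterS => K; rewrite sub0r normrN.
    by move=> h; apply: le_lt_trans h; exact: ler_norm.
  case=> K _ /(_ K (leqnn K)) /= h; exists K.
  have e0 : 0 <= exp_tail L K.
    by have := @cexp_tail L 0 K; rewrite normc0C => /(_ L0) => h'; apply: le_trans h'; exact: normc_ge0.
  move: h; rewrite ltr_pdivlMr// => h.
  by move: (exp_tail L K) e0 h => e e0 h; lra.
pose G k (z : C) := F z * (p ^+ k).[z].
have hG k : hol 2 (G k) by apply: (holM hF); exact: hol_poly.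
pose del := eps / (2 * (K%:R + 1)).
have K10 : 0 < K%:R + 1 :> R by rewrite ltr_wpDl.
have del0 : 0 < del by rewrite divr_gt0// mulr_gt0.
have Kdel : K%:R * del <= eps / 2.
  rewrite /del mulrA ler_pdivrMr ?mulr_gt0//.
  have -> : eps / 2 * (2 * (K%:R + 1)) = (K%:R + 1) * eps by field.
  by rewrite ler_wpM2r ?(ltW eps0)// lerDl.
have [Rb hRb] : exists Rb : nat, forall k, (k < K)%N -> forall n, (Rb <= n)%N -> normc (taylor (G k) n) <= del.
  have one k : exists Rb : nat, forall n, (Rb <= n)%N -> normc (taylor (G k) n) <= del.
    have [M [q [M0 q0 q1 hq]]] := taylor_summable (hG k) r1.
    have : M * q ^+ n @[n --> \oo] --> (0 : R).
      by rewrite -(mulr0 M); apply: cvgM; [exact: cvg_cst|apply: cvg_expr; rewrite ger0_norm// ltW].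
    move=> /cvgrPdist_lt /(_ del del0) [Rb _ h]; exists Rb => n Rn.
    apply: le_trans (hq n) _; have := h n Rn; rewrite /= sub0r normrN => h'.
    by apply: le_trans (ltW h'); exact: ler_norm.
  suff gen J : exists Rb : nat, forall k, (k < J)%N -> forall n, (Rb <= n)%N ->
      normc (taylor (G k) n) <= del by exact: gen.
  elim: J => [|J [R1 h1]]; first by exists 0%N.
  have [R2 h2] := one J.
  exists (maxn R1 R2) => k; rewrite ltnS leq_eqVlt => /orP[/eqP ->|kK] n; rewrite geq_max => /andP[n1 n2].
    exact: h2.
  exact: h1.
exists (d + Rb.+1)%N => N N0 n n0.
have dN : (d <= N)%N := leq_trans (leq_addr _ _) N0.
pose P (z : C) := z ^+ (N - d) * p.[z].
have hP : hol 2 P by apply: holM; [exact: holX|exact: hol_poly].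
have hE : hol 2 (fun z => F z * cexp (- (a%:CC * P z))).
  apply: (holM hF); apply: hol_cexp.
  have -> : (fun z => - (a%:CC * P z)) = (fun z => (- a%:CC) * P z) by apply/funext => z; rewrite mulNr.
  by apply: holM => //; exact: hol_cst.
rewrite (fcoef_taylor hE)//.
pose S (z : C) := \sum_(0 <= k < K) (- a%:CC) ^+ k / k`!%:R * (G k z * z ^+ (k * (N - d)) * z^-1 ^+ n).
have bG k : bmeas (fun z => G k z * z ^+ (k * (N - d)) * z^-1 ^+ n).
  apply: bmeasM; last exact: bmeasX (@bmeas_inv R).
  by apply: bmeasM; [exact: hol_bmeas1 (hG k) r1|exact: bmeasX (@bmeas_id R)].
have bS : bmeas S by apply: bmeas_sum => k; exact: bmeasM (bmeas_cst _) (bG k).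
have bE : bmeas (fun z => F z * cexp (- (a%:CC * P z)) * z^-1 ^+ n).
  exact: bmeasM (hol_bmeas1 hE r1) (bmeasX _ (@bmeas_inv R)).
have ES z : T z -> F z * cexp (- (a%:CC * P z)) * z^-1 ^+ n - S z =
    F z * (cexp (- (a%:CC * P z)) - \sum_(0 <= k < K) (- (a%:CC * P z)) ^+ k / k`!%:R) * z^-1 ^+ n.
  move=> Tz; rewrite mulrBr mulrBl; congr (_ - _).
  rewrite /S mulr_sumr mulr_suml; apply: eq_bigr => k _.
  rewrite /G /P -mulNr !exprMn horner_exp -exprM [((N - d) * k)%N]mulnC; ring.
have err : normc (fcoef m (fun z => F z * cexp (- (a%:CC * P z))) n - cint m S) <= eps / 2.
  rewrite /fcoef -cintB//.
  rewrite (_ : cint m _ = cint m (fun z => F z * (cexp (- (a%:CC * P z)) -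
     \sum_(0 <= k < K) (- (a%:CC * P z)) ^+ k / k`!%:R) * z^-1 ^+ n)); last exact: eq_cint.
  apply: le_trans hK; rewrite -[X in _ <= X]mulr1 -(@cmass_circle R); apply: cint_norm_le.
    by apply: bmeas_ext (bmeasB bE bS).
  move=> z Tz; have /circle_normc nz := Tz.
  rewrite normcM normcM normcX normcV nz invr1 expr1n mulr1 ler_pM ?normc_ge0 ?hMF//.
  apply: cexp_tail; rewrite normcN normcM normc_real gtr0_norm// /P normcM normcX nz expr1n mul1r.
  by apply: le_trans (hL z Tz); rewrite ler_piMl ?normc_ge0.
have cS : cint m S = \sum_(0 <= k < K) (- a%:CC) ^+ k / k`!%:R *
    (if (k * (N - d) <= n)%N then taylor (G k) (n - k * (N - d))%N else 0).
  rewrite cint_sum; last by move=> k; exact: bmeasM (bmeas_cst _) (bG k).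
  by apply: eq_bigr => k _; rewrite cintZ// (cint_shifted _ _ (hG k) r1).
pose act k := (k * (N - d) <= n)%N && (n - k * (N - d) < Rb)%N.
have main : normc (cint m S) <= Num.max (normc (taylor F n)) (a * B) + K%:R * del.
  rewrite cS; apply: le_trans (normc_sum_le _ _ _) _.
  apply: (sum_one_active_le (act := act)).
  - by rewrite le_max normc_ge0.
  - exact: ltW.
  - move=> k kK.
    have ak1 : normc ((- a%:CC) ^+ k / k`!%:R) <= 1.
      rewrite normcM normcV normc_nat normcX normcN normc_real gtr0_norm//.
      rewrite ler_pdivrMr ?ltr0n ?fact_gt0// mul1r (@le_trans _ _ 1)//.
        by rewrite exprn_ile1// ltW.
      by rewrite ler1n fact_gt0.
    case: (boolP (act k)) => [/andP[kn kR]|]; last first.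
      rewrite /act; case: (leqP (k * (N - d)) n) => /= [kn|kn _].
        rewrite -leqNgt => Rn; rewrite normcM -[del]mul1r ler_pM ?normc_ge0//.
        exact: hRb.
      by rewrite mulr0 normc0C ltW.
    rewrite kn le_max; case: k kK ak1 kn kR => [|k] kK ak1 kn kR.
      rewrite mul0n subn0 expr0 fact0 divr1 mul1r.
      have -> : G 0%N = F by apply/funext => z; rewrite /G expr0 hornerC mulr1.
      by rewrite lexx.
    apply/orP; right.
    have -> : (- a%:CC) ^+ k.+1 / k.+1`!%:R * taylor (G k.+1) (n - k.+1 * (N - d)) =
        cint m (fun z => ((- a%:CC) ^+ k.+1 / k.+1`!%:R) * (G k.+1 z * z ^+ (k.+1 * (N - d)) * z^-1 ^+ n)).
      by rewrite cintZ// (cint_shifted _ _ (hG k.+1) r1) kn.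
    rewrite -[X in _ <= X]mulr1 -(@cmass_circle R); apply: cint_norm_le.
      exact: bmeasM (bmeas_cst _) (bG k.+1).
    move=> z Tz; have /circle_normc nz := Tz.
    rewrite !normcM !normcX !normcV normcN normc_real gtr0_norm// normc_nat nz invr1 !expr1n !mulr1.
    rewrite horner_exp normcX -nphi//.
    have q1 : normc (phi z) ^+ k.+1 / k.+1`!%:R <= expR (normc (phi z)).
      by apply: exp_term_le; exact: normc_ge0.
    apply: (@le_trans _ _ (a * (normc (F z) * (normc (phi z) ^+ k.+1 / k.+1`!%:R)))).
      have -> : a ^+ k.+1 / k.+1`!%:R * (normc (F z) * normc (phi z) ^+ k.+1) =
        a * (normc (F z) * (normc (phi z) ^+ k.+1 / k.+1`!%:R)) * a ^+ k by rewrite exprS; ring.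
      rewrite ler_piMr// ?exprn_ile1// ?(ltW a0)// mulr_ge0 ?(ltW a0)// mulr_ge0 ?normc_ge0//.
      by rewrite divr_ge0// exprn_ge0// normc_ge0.
    apply: ler_wpM2l; first exact: ltW.
    by apply: le_trans (hB z Tz); rewrite ler_wpM2l ?normc_ge0.
  - move=> k l /andP[k1 k2] /andP[l1 l2].
    have D : (Rb < N - d)%N by rewrite ltn_subRL addnC addnC (leq_trans _ N0)// addnS.
    have aux i j : (i * (N - d) <= n)%N -> (n - i * (N - d) < Rb)%N -> (j * (N - d) <= n)%N -> (j <= i)%N.
      move=> h1 h2 h3; rewrite leqNgt; apply/negP => ij.
      have : (i.+1 * (N - d) <= j * (N - d))%N by rewrite leq_mul2r ij orbT.
      by rewrite mulSn => h4; exact: window_disjoint h1 h2 D h4 h3.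
    apply/eqP; rewrite eqn_leq; apply/andP; split; [exact: aux l1 l2 k1|exact: aux k1 k2 l1].
have := normcD_le (fcoef m (fun z => F z * cexp (- (a%:CC * P z))) n - cint m S) (cint m S).
rewrite subrK => /le_trans; apply.
by lra.
Qed.

End StepLemma.

(** * The block construction *)

Section Block.
Variable R : realType.
Local Notation C := (Cplx R).
Local Notation T := (@circle R).
Local Notation m := (@circle_measure R).
Local Notation "x %:CC" := (x%:C%C : C) (at level 2, format "x %:CC").

(** Trigonometric polynomials, as functions on the circle *)
Definition laurent (f : C -> C) := exists (d : nat) (p : {poly C}),
  forall z, T z -> p.[z] = z ^+ d * f z.

Lemma laurentD f g : laurent f -> laurent g -> laurent (fun z => f z + g z).
Proof.
move=> [d [p hp]] [e [q hq]]; exists (d + e)%N, ('X^e * p + 'X^d * q) => z Tz.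
by rewrite hornerD !hornerM !hornerXn hp// hq// exprD; ring.
Qed.

Lemma laurentM f g : laurent f -> laurent g -> laurent (fun z => f z * g z).
Proof.
move=> [d [p hp]] [e [q hq]]; exists (d + e)%N, (p * q) => z Tz.
by rewrite hornerM hp// hq// exprD; ring.
Qed.

Lemma laurent_poly (p : {poly C}) : laurent (fun z => p.[z]).
Proof. by exists 0%N, p => z _; rewrite expr0 mul1r. Qed.

Lemma laurent_cst (c : C) : laurent (fun=> c).
Proof. by exists 0%N, c%:P => z _; rewrite hornerC expr0 mul1r. Qed.

Lemma laurent_ext f g : (forall z, T z -> f z = g z) -> laurent f -> laurent g.
Proof. by move=> fg [d [p hp]]; exists d, p => z Tz; rewrite -fg// hp. Qed.

Lemma laurent_conj_poly (p : {poly C}) : laurent (fun z => (p.[z])^*%C).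
Proof.
elim/poly_ind : p => [|p c IH].
  by apply: laurent_ext (laurent_cst 0) => z _; rewrite horner0 conjc0.
have li : laurent (fun z => z^-1).
  by exists 1%N, 1 => z Tz; rewrite hornerC expr1 mulfV// circle_neq0.
apply: laurent_ext (laurentD (laurentM IH li) (laurent_cst (c^*)%C)) => z Tz.
by rewrite hornerMXaddC [RHS]rmorphD [in RHS]rmorphM circle_inv.
Qed.

Definition rv (V : {poly C}) (z : C) : R := complex.Re V.[z].
Definition rl (g : C -> R) := laurent (fun z => (g z)%:CC).

Lemma rl_rv V : rl (rv V).
Proof.
apply: laurent_ext (laurentM (laurent_cst (2^-1)) (laurentD (laurent_poly V) (laurent_conj_poly V))).
by move=> z _; rewrite mulrC -ReJ_add.
Qed.

Lemma rlD g h : rl g -> rl h -> rl (fun z => g z + h z).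
Proof. by move=> hg hh; apply: laurent_ext (laurentD hg hh) => z _; rewrite -rmorphD. Qed.

Lemma rlM g h : rl g -> rl h -> rl (fun z => g z * h z).
Proof. by move=> hg hh; apply: laurent_ext (laurentM hg hh) => z _; rewrite -rmorphM. Qed.

Lemma rl_cst c : rl (fun=> c).
Proof. exact: laurent_cst. Qed.

Lemma laurent_bmeas f : laurent f -> bmeas f.
Proof.
move=> [d [p hp]].
have bp : bmeas (fun z : C => p.[z]) := hol_bmeas1 (hol_poly 2 p) (ltr1n _ 2 : (1 : R) < 2).
apply: bmeas_ext (bmeasM (bmeasX d (@bmeas_inv R)) bp) => z Tz.
by rewrite hp// mulrA -exprMn mulVf ?expr1n ?mul1r// circle_neq0.
Qed.

Lemma laurent_high_freq f : laurent f -> exists N0, forall N, (N0 <= N)%N ->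
  cint m (fun z => f z * z ^+ N) = 0.
Proof.
move=> [d [p hp]]; exists d.+1 => N dN.
have r1 : (1 : R) < 2 by rewrite ltr1n.
rewrite -(@cint_pos_moment R 2 (fun z => p.[z]) (N - d).-1 1 (hol_poly 2 p) ler01 r1).
rewrite prednK ?subn_gt0//; apply: eq_cint => z Tz.
rewrite mul1r hp// -{1}(subnKC (ltnW dN)) exprD; ring.
Qed.

Definition mean (g : C -> R) : R := complex.Re (cint m (fun z => (g z)%:CC)).
Definition rbmeas (g : C -> R) := bmeas (fun z => (g z)%:CC).

Lemma rl_rbmeas g : rl g -> rbmeas g.
Proof. exact: laurent_bmeas. Qed.

Lemma meanD g h : rbmeas g -> rbmeas h -> mean (fun z => g z + h z) = mean g + mean h.
Proof.
move=> bg bh; rewrite /mean -ReD -cintD//; congr complex.Re; apply: eq_cint => z _.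
Qed.

Lemma meanZ c g : rbmeas g -> mean (fun z => c * g z) = c * mean g.
Proof.
move=> bg; rewrite /mean (_ : cint m _ = c%:CC * cint m (fun z => (g z)%:CC)).
  by rewrite ReM /= mul0r subr0.
by rewrite -cintZ//; apply: eq_cint => z _; rewrite rmorphM.
Qed.

Lemma mean_cst c : mean (fun=> c) = c.
Proof. by rewrite /mean cint_cst cmass_circle mulr1. Qed.

Lemma le_mean g h : rbmeas g -> rbmeas h -> (forall z, T z -> g z <= h z) -> mean g <= mean h.
Proof. by move=> bg bh gh; apply: Re_cint_le. Qed.

Lemma eq_mean g h : (forall z, T z -> g z = h z) -> mean g = mean h.
Proof. by move=> gh; rewrite /mean; congr complex.Re; apply: eq_cint => z Tz; rewrite gh. Qed.

Lemma mean_high_freq g : rl g -> exists N0, forall N, (N0 <= N)%N ->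
  mean (fun z => g z * complex.Re (z ^+ N)) = 0.
Proof.
move=> hg; have [N0 h] := laurent_high_freq hg; exists N0 => N /h h0.
have bg : bmeas (fun z => (g z)%:CC * z ^+ N).
  exact: bmeasM (laurent_bmeas hg) (bmeasX _ (@bmeas_id R)).
have h1 : cint m (fun z => ((g z)%:CC * z ^+ N)^*%C) = 0 by rewrite cint_conj// h0 conjc0.
rewrite /mean (_ : cint m _ = 2^-1 * (cint m (fun z => (g z)%:CC * z ^+ N) +
   cint m (fun z => ((g z)%:CC * z ^+ N)^*%C))); first by rewrite h0 h1 addr0 mulr0.
rewrite -cintD//; last exact: bmeas_conj.
rewrite -cintZ; last by apply: bmeasD => //; exact: bmeas_conj.
apply: eq_cint => z _; rewrite [RHS]mulrC -ReJ_add ReM /= mul0r subr0//.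
Qed.

Lemma mean_sqr_ge g : rl g -> mean g ^+ 2 <= mean (fun z => g z ^+ 2).
Proof.
move=> hg; have bg := rl_rbmeas hg; have bg2 := rl_rbmeas (rlM hg hg).
set mu := mean g.
have : 0 <= mean (fun z => g z * g z + ((- (2 * mu)) * g z + mu ^+ 2)).
  rewrite -(mean_cst 0); apply: le_mean.
  - exact: rl_rbmeas (rl_cst 0).
  - by apply: rl_rbmeas; apply: rlD; [exact: rlM|apply: rlD; [apply: rlM => //|]; exact: rl_cst].
  move=> z _; rewrite (_ : _ + _ = (g z - mu) ^+ 2) ?sqr_ge0//; ring.
rewrite !meanD//.
- rewrite meanZ// mean_cst -/mu.
  rewrite (@eq_mean _ (fun z => g z ^+ 2)) => [|z _]; last by rewrite expr2.
  move=> h; nra.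
- exact: rl_rbmeas (rlM (rl_cst _) hg).
- exact: rl_rbmeas (rl_cst _).
- by apply: rl_rbmeas; apply: rlD; [apply: rlM => //|]; exact: rl_cst.
Qed.

(** The strict inequality leaves room for the perturbations of the later steps. *)
Definition nsmall (V W : {poly C}) (kap : R) := exists2 k', k' < kap &
  forall n, (0 < n)%N -> normc (taylor (fun z => cexp (- (V.[z] - W.[z]))) n) <= k'.

Definition in_range (V : {poly C}) (L : R) := forall z, T z -> 0 <= rv V z <= L.

Definition energy (L : R) (V : {poly C}) := mean (fun z => rv V z * (L - rv V z)).

Lemma hol_expV rho (V W : {poly C}) : hol rho (fun z => cexp (- (V.[z] - W.[z]))).
Proof.
apply: hol_cexp; have := hol_poly rho (W - V).
by congr hol; apply/funext => z; rewrite opprB hornerD hornerN.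
Qed.

(** The amplitude is a, so that one step decreases the energy by a definite amount
    while the coefficients of the exponentials move by at most a B. *)
Lemma block_step (L : R) (V : {poly C}) (Ws : seq ({poly C} * R)) (a : R) (N0 : nat) :
  0 < L -> 0 < a -> a <= 1 -> in_range V L ->
  (forall w, w \in Ws -> exists2 B, a * B < w.2 & forall z, T z -> expR (rv w.1 z) <= B) ->
  (forall w, w \in Ws -> nsmall V w.1 w.2) ->
  exists V', [/\ in_range V' L, exists P, V' = V + 'X^N0 * P,
    energy L V' = energy L V - a ^+ 2 / 2 * mean (fun z => (rv V z * (L - rv V z) / L) ^+ 2) &
    forall w, w \in Ws -> nsmall V' w.1 w.2].
Proof.
move=> L0 a0 a1 rV hB hs.
pose v := rv V; pose phi z := v z * (L - v z) / L.
have hv : rl v := rl_rv V.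
have hLv : rl (fun z => L - v z).
  apply: laurent_ext (rlD (rl_cst L) (rlM (rl_cst (-1)) hv)) => z _.
  by rewrite mulN1r.
have hphi : rl phi by apply: rlM; [exact: rlM|exact: rl_cst].
have hpsi : rl (fun z => (L - 2 * v z) * phi z).
  apply: rlM => //; apply: laurent_ext (rlD (rl_cst L) (rlM (rl_cst (-2)) hv)) => z _.
  by rewrite mulNr.
have hphi2 : rl (fun z => phi z * phi z) by exact: rlM.
have [d [p hp]] := hphi.
have [N1 hN1] := mean_high_freq hpsi; have [N2 hN2] := mean_high_freq hphi2.
have phi_le z : T z -> 0 <= phi z <= v z.
  move=> /rV /andP[v0 vL]; rewrite /phi -/v in v0 vL *.
  rewrite divr_ge0 ?mulr_ge0 ?subr_ge0 ?(ltW L0)//=.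
  rewrite ler_pdivrMr//; nra.
have coef : exists N3, forall N, (N3 <= N)%N -> forall w, w \in Ws -> nsmall (V + a%:CC *: ('X^(N - d) * p)) w.1 w.2.
  elim: Ws hB hs => [|w Ws IH] hB hs; first by exists 0%N.
  have sub w' : w' \in Ws -> w' \in w :: Ws by move=> h; rewrite in_cons h orbT.
  have [N3 h3] := IH (fun w' h => hB w' (sub w' h)) (fun w' h => hs w' (sub w' h)).
  have wW : w \in w :: Ws by rewrite in_cons eqxx.
  have [B aB hBw] := hB w wW; have [k' k'w hk'] := hs w wW.
  pose M := Num.max k' (a * B); have Mw : M < w.2 by rewrite gt_max k'w.
  have eps0 : 0 < (w.2 - M) / 2 by lra.
  have hF := hol_expV 2 V w.1.
  have hBF z : T z -> normc (cexp (- (V.[z] - w.1.[z]))) * expR (normc ((phi z)%:CC)) <= B.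
    move=> Tz; rewrite normc_cexp normc_real -expRD.
    have /andP[p0 pv] := phi_le z Tz; rewrite ger0_norm//.
    apply: le_trans (hBw z Tz); rewrite ler_expR ReN ReB -/(rv V z) -/(rv w.1 z).
    by rewrite -/v; lra.
  have [N4 h4] := coef_step hF hp hBF a0 a1 eps0.
  exists (maxn N3 N4) => N; rewrite geq_max => /andP[n3 n4] w'.
  rewrite in_cons => /orP[/eqP ->|w'Ws]; last exact: h3.
  exists (M + (w.2 - M) / 2); first lra.
  move=> n n0; have := h4 N n4 n n0.
  have -> : (fun z => cexp (- (V.[z] - (w.1).[z])) * cexp (- (a%:CC * (z ^+ (N - d) * p.[z])))) =
     (fun z => cexp (- ((V + a%:CC *: ('X^(N - d) * p)).[z] - (w.1).[z]))).
    apply/funext => z; rewrite -cexpD; congr cexp.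
    by rewrite hornerD hornerZ hornerM hornerXn; ring.
  move=> /le_trans; apply; rewrite lerD2r /M ge_max !le_max lexx orbT andbT.
  by rewrite hk'.
have [N3 hN3] := coef.
pose N := (maxn (maxn N1 N2) (maxn N3 (N0 + d)))%N.
have n1 : (N1 <= N)%N by rewrite !leq_max leqnn.
have n2 : (N2 <= N)%N by rewrite !leq_max leqnn orbT.
have n3 : (N3 <= N)%N by rewrite !leq_max leqnn !orbT.
have n4 : (N0 + d <= N)%N by rewrite !leq_max leqnn !orbT.
have dN : (d <= N)%N by apply: leq_trans n4; rewrite leq_addl.
pose V' := V + a%:CC *: ('X^(N - d) * p).
have v'E z : T z -> rv V' z = v z + a * (phi z * complex.Re (z ^+ N)).
  move=> Tz; rewrite /rv hornerD hornerZ hornerM hornerXn hp//.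
  have -> : z ^+ (N - d) * (z ^+ d * (phi z)%:CC) = z ^+ N * (phi z)%:CC.
    by rewrite mulrA -exprD subnK.
  rewrite ReD -/(rv V z) -/v [complex.Re (a%:CC * _)]ReM /= mul0r subr0; congr (_ + a * _).
  by rewrite [complex.Re (z ^+ N * _)]ReM /= mulr0 subr0 mulrC.
have c1 z : T z -> -1 <= complex.Re (z ^+ N) <= 1.
  move=> /circle_normc nz; rewrite -ler_norml (le_trans (Re_le _))// normcX nz expr1n//.
exists V'; split.
- move=> z Tz; rewrite v'E//; have /andP[p0 pv] := phi_le z Tz; have /andP[c0 c1'] := c1 z Tz.
  have /andP[v0 vL] := rV z Tz; rewrite -/v in v0 vL.
  have pL : phi z <= L - v z.
    by rewrite /phi ler_pdivrMr//; nra.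
  have [q0 q1] : - phi z <= phi z * complex.Re (z ^+ N) /\ phi z * complex.Re (z ^+ N) <= phi z.
    by split; nra.
  have q2 : a * (phi z * complex.Re (z ^+ N)) <= phi z.
    apply: (@le_trans _ _ (a * phi z)); first by rewrite ler_pM2l.
    by rewrite ler_piMl.
  have q3 : - phi z <= a * (phi z * complex.Re (z ^+ N)).
    apply: (@le_trans _ _ (a * (- phi z))); last by rewrite ler_pM2l.
    by rewrite mulrN lerN2 ler_piMl.
  by apply/andP; split; lra.
- exists ('X^(N - d - N0) * (a%:CC *: p)).
  rewrite mulrA -exprD subnKC; last by rewrite leq_subRL// addnC.
  by rewrite /V' scalerAr.
- have E z : T z -> rv V' z * (L - rv V' z) = (v z * (L - v z) +
      a * (((L - 2 * v z) * phi z) * complex.Re (z ^+ N))) +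
      ((- (a ^+ 2 / 2)) * (phi z * phi z) + (- (a ^+ 2 / 2)) * (phi z * phi z * complex.Re (z ^+ (N + N)))).
    move=> Tz; rewrite v'E//.
    have -> : complex.Re (z ^+ (N + N)) = 2 * complex.Re (z ^+ N) ^+ 2 - 1.
      have : normc (z ^+ N) ^+ 2 = 1 by have /circle_normc nz := Tz; rewrite normcX nz !expr1n.
      rewrite normc_sqr exprD ReM => e; lra.
    by field.
  have hc M : rl (fun z => complex.Re (z ^+ M)).
    apply: laurent_ext (rl_rv 'X^M) => z _; by rewrite /rv hornerXn.
  have h1 : rl (fun z => v z * (L - v z)) by exact: rlM.
  have h2 := rlM hpsi (hc N); have h3 := rlM hphi2 (hc (N + N)%N).
  have g2 := rlM (rl_cst a) h2.
  have g3 := rlM (rl_cst (- (a ^+ 2 / 2))) hphi2; have g4 := rlM (rl_cst (- (a ^+ 2 / 2))) h3.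
  rewrite /energy (eq_mean E) (meanD (rl_rbmeas (rlD h1 g2)) (rl_rbmeas (rlD g3 g4))).
  rewrite (meanD (rl_rbmeas h1) (rl_rbmeas g2)) (meanD (rl_rbmeas g3) (rl_rbmeas g4)).
  rewrite (meanZ a (rl_rbmeas h2)) hN1// mulr0 addr0.
  rewrite (meanZ _ (rl_rbmeas h3)) hN2 ?mulr0 ?addr0; last by rewrite (leq_trans n2)// leq_addr.
  rewrite (meanZ _ (rl_rbmeas hphi2)) mulNr.
  by rewrite (_ : mean (fun z => (rv V z * (L - rv V z) / L) ^+ 2) = mean (fun z => phi z * phi z)).
- exact: hN3.
Qed.

Lemma step_size (Ws : seq ({poly C} * R)) : (forall w, w \in Ws -> 0 < w.2) ->
  exists2 a, 0 < a <= 1 &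
  forall w, w \in Ws -> exists2 B, a * B < w.2 & forall z, T z -> expR (rv w.1 z) <= B.
Proof.
elim: Ws => [|w Ws IH] h; first by exists 1; rewrite ?ltr01 ?lexx.
have sub w' : w' \in Ws -> w' \in w :: Ws by move=> h'; rewrite in_cons h' orbT.
have [a /andP[a0 a1] ha] := IH (fun w' h' => h w' (sub w' h')).
have w0 : 0 < w.2 by apply: h; rewrite in_cons eqxx.
have [B hB] : exists B, forall z, T z -> expR (rv w.1 z) <= B.
  apply: circle_cont_bounded => z Tz.
  have c : {for z, continuous (rv w.1)}.
    have n2 : normc z < 2 by move/circle_normc: Tz => ->; rewrite ltr1n.
    exact: (cvg_Re (hol_cont (hol_poly 2 w.1) n2)).
  exact: (continuous_comp c (@continuous_expR R _)).
have T1 : T 1 by apply/circle_normc; exact: normc1C.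
have B0 : 0 < B by apply: lt_le_trans (hB 1 T1); exact: expR_gt0.
exists (Num.min a (w.2 / (2 * B))).
  by rewrite lt_min a0 divr_gt0 ?mulr_gt0// ge_min a1.
move=> w'; rewrite in_cons => /orP[/eqP ->|w'Ws].
  exists B => //; apply: (@le_lt_trans _ _ (w.2 / (2 * B) * B)).
    by rewrite ler_wpM2r ?(ltW B0)// ge_min lexx orbT.
  have -> : w.2 / (2 * B) * B = w.2 / 2 by field; rewrite gt_eqF.
  lra.
have [B' aB hB'] := ha w' w'Ws; exists B' => //; apply: le_lt_trans aB.
rewrite ler_wpM2r ?ge_min ?lexx//; apply: le_trans (hB' 1 T1); exact: expR_ge0.
Qed.

(** The martingale v' = v + a v (L - v) / L cos (N t) is iterated until it has
    almost reached its absorbing states 0 and L: every step lowers the mean of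
    v (L - v) by a fixed amount as long as that mean exceeds tol. *)
Lemma block (L : R) (V0 : {poly C}) (Ws : seq ({poly C} * R)) (tol : R) (N0 : nat) :
  0 < L -> in_range V0 L -> 0 < tol ->
  (forall w, w \in Ws -> nsmall V0 w.1 w.2) ->
  exists V, [/\ in_range V L, exists P, V = V0 + 'X^N0 * P, energy L V <= tol &
    forall w, w \in Ws -> nsmall V w.1 w.2].
Proof.
move=> L0 rV0 tol0 hs0.
have [a /andP[a0 a1] ha] : exists2 a, 0 < a <= 1 &
    forall w, w \in Ws -> exists2 B, a * B < w.2 & forall z, T z -> expR (rv w.1 z) <= B.
  apply: step_size => w /hs0 [k' k'w hk]; apply: le_lt_trans k'w.
  by apply: le_trans (hk 1%N isT); exact: normc_ge0.
pose dl := a ^+ 2 / 2 * (tol / L) ^+ 2.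
have dl0 : 0 < dl by rewrite mulr_gt0 ?divr_gt0 ?exprn_gt0 ?divr_gt0.
suff H k (V : {poly C}) : in_range V L -> (exists P, V = V0 + 'X^N0 * P) ->
    (forall w, w \in Ws -> nsmall V w.1 w.2) -> energy L V <= k%:R * dl + tol ->
    exists V, [/\ in_range V L, exists P, V = V0 + 'X^N0 * P, energy L V <= tol &
    forall w, w \in Ws -> nsmall V w.1 w.2].
  pose k := Num.truncn (energy L V0 / dl).
  apply: (H k.+1 V0) => //; first by exists 0; rewrite mulr0 addr0.
  have : energy L V0 / dl < k.+1%:R by exact: truncnS_gt.
  by rewrite ltr_pdivrMr// => h; lra.
elim: k V => [|k IH] V rV hP hs hE.
  by exists V; split => //; move: hE; rewrite mul0r add0r.
have [small|big] := leP (energy L V) tol; first by exists V.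
have [V' [rV' [P' V'E] E' hs']] := block_step N0 L0 a0 a1 rV ha hs.
apply: (IH V') => //.
  have [P PE] := hP; exists (P + P'); rewrite V'E PE; ring.
have hphi : rl (fun z => rv V z * (L - rv V z) / L).
  apply: rlM; last exact: rl_cst.
  apply: rlM; first exact: rl_rv.
  apply: laurent_ext (rlD (rl_cst L) (rlM (rl_cst (-1)) (rl_rv V))) => z _.
  by rewrite mulN1r.
have hphi' : rl (fun z => rv V z * (L - rv V z)).
  apply: laurent_ext (rlM (rl_cst L) hphi) => z _; congr (_ %:CC).
  by rewrite mulrC divfK// gt_eqF.
have := mean_sqr_ge hphi.
have -> : mean (fun z => rv V z * (L - rv V z) / L) = energy L V / L.
  rewrite [RHS]mulrC -(meanZ L^-1 (rl_rbmeas hphi')); apply: eq_mean => z _.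
  by rewrite mulrC.
move=> h.
have h2 : (tol / L) ^+ 2 <= (energy L V / L) ^+ 2.
  have tL : 0 <= tol / L by rewrite divr_ge0// ltW.
  have tE : tol / L <= energy L V / L by rewrite ler_pM2r ?invr_gt0// ltW.
  by rewrite lerXn2r// nnegrE// (le_trans tL).
have h3 : dl <= a ^+ 2 / 2 * mean (fun z => (rv V z * (L - rv V z) / L) ^+ 2).
  apply: ler_wpM2l; first by rewrite divr_ge0// sqr_ge0.
  exact: le_trans h2 h.
move: hE; rewrite -natr1 mulrDl mul1r E' => hE; lra.
Qed.

End Block.

(** * Duality and Herglotz integrals *)

Section Duality.
Variable R : realType.
Local Notation C := (Cplx R).
Local Notation T := (@circle R).
Local Notation m := (@circle_measure R).
Local Notation "x %:CC" := (x%:C%C : C) (at level 2, format "x %:CC").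

Lemma young_ge0 (Phi : R -> R) x : young_function Phi -> 0 <= x -> 0 <= Phi x.
Proof.
move=> [_ P0 Ppos _]; rewrite le_eqVlt => /orP[/eqP <-|x0]; first by rewrite P0.
exact/ltW/Ppos.
Qed.

Lemma young_slope (Phi : R -> R) x x0 : young_function Phi -> 0 < x0 -> x0 <= x ->
  x * Phi x0 <= x0 * Phi x.
Proof.
move=> [cvx P0 _ _] x00 x0x; have xp : 0 < x by lra.
have p0 : 0 <= x0 / x by rewrite divr_ge0// ltW.
have p1 : x0 / x <= 1 by rewrite ler_pdivrMr// mul1r.
have mem y : 0 <= y -> y \in (`[0, +oo[%classic : set R).
  by move=> y0; rewrite inE /= in_itv /= y0.
have := cvx (Itv01 p0 p1) x 0 (mem x (ltW xp)) (mem 0 (lexx 0)).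
rewrite convRE /= P0 !mulr0 !addr0.
set y := conv _ _ _; have -> : y = x0.
  transitivity (x0 / x * x + (1 - x0 / x) * 0); first by [].
  by rewrite mulr0 addr0 divfK// gt_eqF.
move=> h.
have := ler_wpM2l (ltW xp) h.
by have -> : x * (x0 / x * Phi x) = x0 * Phi x by field; rewrite gt_eqF.
Qed.

(** Small coefficients of bounded l2 norm act on the Phi-summable sequences as
    functionals of small norm, since Phi x / x ^ 2 is large for small x. *)
Lemma orlicz_duality (Phi : R -> R) (eps M : R) : young_function Phi ->
  (Phi x / x ^+ 2) @[x --> 0^'+] --> +oo -> 0 < eps -> 0 <= M ->
  exists2 kap, 0 < kap & forall (x y : nat -> R) N,
    (forall n, 0 <= x n) -> (forall n, 0 <= y n <= kap) ->
    \sum_(0 <= n < N) y n ^+ 2 <= M ->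
    \sum_(0 <= n < N) x n * y n <= eps * (1 + \sum_(0 <= n < N) Phi (x n)).
Proof.
move=> hPhi hgr eps0 M0.
pose L := M / eps ^+ 2 + 1.
have e20 : 0 < eps ^+ 2 by rewrite exprn_gt0.
have L0 : 0 < L by rewrite ltr_wpDl// divr_ge0// ltW.
have [del del0 hdel] : exists2 del, 0 < del & forall x, 0 < x -> x < del -> L * x ^+ 2 <= Phi x.
  move/cvgryPge : hgr => /(_ L); rewrite near_withinE => /nbhs_ballP [del /= del0 h].
  exists del => // x x0 xd.
  have := h x; rewrite -ball_normE /ball_ /= sub0r normrN gtr0_norm// => /(_ xd x0).
  by rewrite ler_pdivlMr// exprn_gt0.
pose x0 := del / 2; have x00 : 0 < x0 by rewrite divr_gt0.
have x0d : x0 < del by rewrite /x0; lra.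
exists (eps * L * x0); first by rewrite !mulr_gt0.
have key x y : 0 <= x -> 0 <= y -> y <= eps * L * x0 -> x * y <= eps * Phi x + y ^+ 2 / (eps * L).
  move=> xge0 yge0 yk.
  have eL : 0 < eps * L by rewrite mulr_gt0.
  have y2 : 0 <= y ^+ 2 / (eps * L) by rewrite divr_ge0 ?sqr_ge0 ?ltW.
  have Px := young_ge0 hPhi xge0.
  have [xs|xl] := ltP x x0.
    have hP : L * x ^+ 2 <= Phi x.
      move: xge0; rewrite le_eqVlt => /orP[/eqP <-|xp]; last by apply: hdel => //; lra.
      by rewrite expr0n mulr0; exact: young_ge0.
    have h : eps * (L * x ^+ 2) <= eps * Phi x by rewrite ler_wpM2l// ltW.
    apply: (@le_trans _ _ (eps * (L * x ^+ 2) + y ^+ 2 / (eps * L))); last by rewrite lerD2r.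
    rewrite -(ler_pM2l eL).
    have -> : eps * L * (eps * (L * x ^+ 2) + y ^+ 2 / (eps * L)) = (eps * L * x) ^+ 2 + y ^+ 2.
      by field; rewrite !gt_eqF.
    have -> : eps * L * (x * y) = (eps * L * x) * y by ring.
    have : 0 <= eps * L * x by rewrite mulr_ge0// ltW.
    by move: (eps * L * x) => u u0; nra.
  have h1 := young_slope hPhi x00 xl.
  have h2 := hdel x0 x00 x0d.
  have h3 : x * (L * x0 ^+ 2) <= x0 * Phi x.
    by apply: le_trans h1; rewrite ler_wpM2l.
  have h4 : x * (L * x0) <= Phi x.
    rewrite -(ler_pM2l x00); apply: le_trans h3; rewrite le_eqVlt; apply/orP; left; apply/eqP; ring.
  have h5 : x * y <= eps * (x * (L * x0)).
    have -> : eps * (x * (L * x0)) = x * (eps * L * x0) by ring.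
    by rewrite ler_wpM2l.
  have h6 : eps * (x * (L * x0)) <= eps * Phi x by rewrite ler_wpM2l// ltW.
  lra.
move=> x y N hx hy hM.
apply: (@le_trans _ _ (\sum_(0 <= n < N) (eps * Phi (x n) + y n ^+ 2 / (eps * L)))).
  by apply: ler_sum => n _; have /andP[? ?] := hy n; apply: key.
rewrite big_split /= -mulr_sumr -mulr_suml [leRHS]mulrDr mulr1 [leRHS]addrC lerD2l.
rewrite ler_pdivrMr ?mulr_gt0//; apply: le_trans hM _.
have -> : eps * (eps * L) = M + eps ^+ 2 by rewrite /L; field; rewrite gt_eqF.
by rewrite lerDl ltW.
Qed.

(** The complex conjugate of [gh] appears because [gh] plays the role of the Taylor
    coefficients of a test function in a Hermitian pairing. *)
Lemma shifted_test (fh gh : nat -> C) (k N : nat) (e : R) : (k < N)%N -> gh 0%N = 1 ->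
  \sum_(0 <= n < N) normc (fh n) * (if (k < n)%N then normc (gh (n - k)%N) else 0) <= e ->
  normc (fh k) <= e + normc (\sum_(0 <= n < N) fh n * (if (k <= n)%N then gh (n - k)%N else 0)^*%C).
Proof.
move=> kN g0 he.
have E : \sum_(0 <= n < N) fh n * (if (k <= n)%N then gh (n - k)%N else 0)^*%C =
   fh k + \sum_(0 <= n < N) fh n * (if (k < n)%N then gh (n - k)%N else 0)^*%C.
  rewrite !big_mkord (bigD1 (Ordinal kN)) //= leqnn subnn g0 conjc1 mulr1; congr (_ + _).
  rewrite [RHS](bigD1 (Ordinal kN)) //= ltnn conjc0 mulr0 add0r.
  apply: eq_bigr => i ik; rewrite leq_eqVlt; case: eqP => // ki.
  by move: ik; rewrite -val_eqE /= ki eqxx.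
rewrite E; set S := \sum_(0 <= n < N) fh n * _.
have Se : normc S <= e.
  apply: le_trans he; apply: le_trans (normc_sum_le _ _ _) _; apply: ler_sum => n _.
  rewrite normcM normc_conj; case: ifP => // _; by rewrite normc0C.
by have := normcB_le (fh k + S) S; rewrite addrK; lra.
Qed.

(** This reduces Herglotz integrals to Cauchy integrals. *)
Lemma herglotz_kernelE (z zeta : C) : T zeta -> normc z < 1 ->
  herglotz_kernel z zeta = 2 * (1 - z * zeta^-1)^-1 - 1.
Proof.
move=> Tz z1; have k0 := kernel_denom_neq0 z1 Tz; have z0 := circle_neq0 Tz.
rewrite /herglotz_kernel.
have E : zeta - z = zeta * (1 - z * zeta^-1) by rewrite mulrBr mulr1 mulrCA mulfV ?mulr1.
have k1 : zeta - z != 0 by rewrite E mulf_neq0.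
have -> : (1 - z * zeta^-1)^-1 = zeta / (zeta - z) by rewrite E invfM mulrA mulfV// mul1r.
apply: (mulIf k1); rewrite divfK// mulrBl mul1r -mulrA divfK//; ring.
Qed.

Lemma Re_herglotz_ge (z zeta : C) : T zeta -> normc z < 1 ->
  (1 - normc z) / (1 + normc z) <= complex.Re (herglotz_kernel z zeta).
Proof.
move=> Tz z1; have n0 := normc_ge0 z; have /circle_normc nz := Tz.
have D0 : zeta - z != 0.
  by apply/eqP => /eqP; rewrite subr_eq0 => /eqP e; move: z1; rewrite -e nz ltxx.
have Dp : 0 < normc (zeta - z) by rewrite normc_gt0.
have E : complex.Re (herglotz_kernel z zeta) = (1 - normc z ^+ 2) / normc (zeta - z) ^+ 2.
  have -> : herglotz_kernel z zeta =
      (zeta + z) * (zeta - z)^*%C * ((normc (zeta - z) ^+ 2)^-1)%:CC.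
    rewrite /herglotz_kernel -mulrA; congr (_ * _); apply: (mulIf D0).
    rewrite mulVf// mulrAC conj_normc -rmorphM mulfV//.
    by rewrite expf_neq0// gt_eqF.
  rewrite ReM /= mulr0 subr0; congr (_ / _).
  have e1 : 1 = normc zeta ^+ 2 by rewrite nz expr1n.
  rewrite e1 !normc_sqr; case: (zeta) => a b; case: (z) => c d; rewrite ReM /=; ring.
rewrite E ler_pdivrMr; last by lra.
have h : normc (zeta - z) <= 1 + normc z by rewrite -nz normcB_le.
rewrite mulrAC ler_pdivlMr ?exprn_gt0//.
have h2 : normc (zeta - z) ^+ 2 <= (1 + normc z) ^+ 2 by rewrite lerXn2r// ?nnegrE ?normc_ge0 ?addr_ge0.
have -> : (1 - normc z ^+ 2) * (1 + normc z) = (1 - normc z) * (1 + normc z) ^+ 2 by ring.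
by rewrite ler_wpM2l// subr_ge0 ltW.
Qed.

Lemma bmeas_herglotz (z : C) : normc z < 1 -> bmeas (herglotz_kernel z).
Proof.
move=> z1; apply: bmeas_ext (bmeasB (bmeasM (bmeas_cst 2) (bmeas_kernel z1)) (bmeas_cst 1)).
by move=> zeta Tz; rewrite herglotz_kernelE.
Qed.

Lemma hol_herglotz (mu : {finite_measure set (CplxB R) -> \bar R}) (rho : C -> C) :
  bmeas rho -> hol 1 (fun z => cint mu (fun zeta => herglotz_kernel z zeta * rho zeta)).
Proof.
move=> brho; have [_ _ [M hM]] := brho.
pose K (z : C) := cint mu (fun zeta => rho zeta * (1 - z * zeta^-1)^-1).
have hK : hol 1 K.
  split=> z z1.
  have pb : psbound (fcoef mu rho) 1.
    move=> s s0 s1; exists (M * cmass mu) => n.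
    rewrite -[leRHS]mulr1; apply: ler_pM; rewrite ?normc_ge0 ?exprn_ge0 ?(ltW s0)//.
      exact: fcoef_le.
    by rewrite exprn_ile1 ?(ltW s0) ?(ltW s1).
  have hs (w : C) : normc w < 1 -> series (fun n => fcoef mu rho n * w ^+ n) @ \oo --> K w.
    by move=> w1; exact: kernel_series.
  have [_ /(_ z z1) [d dd _]] := pseries_derive pb hs.
  exact: (@ex_derive _ _ _ _ _ _ _ dd).
apply: (hol_ext (f := fun z => 2 * K z + (- cint mu rho))); last first.
  by apply: holD; [apply: holM; [exact: hol_cst|exact: hK]|exact: hol_cst].
move=> z z1; rewrite /K.
have b1 := bmeasM brho (bmeas_kernel z1).
rewrite -cintZ// -cintB//; last exact: bmeasM (bmeas_cst 2) b1.
by apply: eq_cint => zeta Tz; rewrite herglotz_kernelE//; ring.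
Qed.

Lemma cint_poly (V : {poly C}) : cint m (fun zeta => V.[zeta]) = V.[0].
Proof.
have r1 : (1 : R) < 2 by rewrite ltr1n.
have hV := hol_poly 2 V.
have h1 (w : C) : normc w < 2 -> {for w, continuous (fun z : C => V.[z])}.
  by move=> w1; exact: hol_cont hV w1.
have h2 (w : C) : normc w < 2 -> w != 0 -> derivable (fun z : C => V.[z]) w 1.
  by move=> w1 _; exact: (holP hV).
rewrite -(mean_value ler01 r1 h1 h2).
by apply: eq_cint => zeta _; rewrite mul1r.
Qed.

(** Schwarz's formula for polynomials *)
Lemma schwarz_formula (V : {poly C}) (z : C) : complex.Im V.[0] = 0 -> normc z < 1 ->
  cint m (fun zeta => herglotz_kernel z zeta * (rv V zeta)%:CC) = V.[z].
Proof.
move=> im0 z1.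
have r1 : (1 : R) < 2 by rewrite ltr1n.
have hV := hol_poly 2 V; have bV := hol_bmeas1 hV r1; have bK := bmeas_kernel z1.
have bcV := bmeas_conj bV.
have bv : bmeas (fun zeta => (rv V zeta)%:CC) := laurent_bmeas (rl_rv V).
have c1 : cint m (fun zeta => V.[zeta] * (1 - z * zeta^-1)^-1) = V.[z].
  rewrite -[RHS](@cauchy_formula R (fun z => V.[z]) 2 1 z ltr01 r1 z1 (holP hV)).
  by apply: eq_cint => zeta _; rewrite mul1r divr1.
have c2 : cint m (fun zeta => (V.[zeta])^*%C * (1 - z * zeta^-1)^-1) = (V.[0])^*%C.
  have c := @kernel_series R m _ z bcV z1.
  have E n : fcoef m (fun zeta => (V.[zeta])^*%C) n = (if n == 0%N then V.[0] else 0)^*%C.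
    have -> : fcoef m (fun zeta => (V.[zeta])^*%C) n = (cint m (fun zeta => V.[zeta] * zeta ^+ n))^*%C.
      rewrite -cint_conj; last exact: bmeasM bV (bmeasX _ (@bmeas_id R)).
      by apply: eq_cint => zeta Tz; rewrite [RHS]rmorphM rmorphXn circle_inv.
    congr (_^*)%C; case: n => [|n].
      transitivity (cint m (fun zeta => V.[zeta])); last exact: cint_poly.
      by apply: eq_cint => zeta _; rewrite expr0 mulr1.
    rewrite -[RHS](@cint_pos_moment R 2 (fun z => V.[z]) n 1 hV ler01 r1).
    by apply: eq_cint => zeta _; rewrite mul1r.
  have c' : series (fun n => fcoef m (fun zeta => (V.[zeta])^*%C) n * z ^+ n) @ \oo --> ((V.[0])^*%C : C).
    rewrite -(cvg_shiftS _); apply: (@cvg_trans _ ((fun=> ((V.[0])^*%C : C)) @ \oo)); last exact: cvg_cst.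
    apply: near_eq_cvg; apply: nearW => N.
    rewrite /series /= big_nat_recl//= E expr0 mulr1 big1 ?addr0// => i _.
    by rewrite E conjc0 mul0r.
  exact: (cvg_unique _ c c').
have b1 := bmeasM bV bK; have b2 := bmeasM bcV bK.
have conjV0 : (V.[0])^*%C = V.[0] by case: (V.[0]) im0 => a b /= ->; rewrite oppr0.
have m0 : cint m (fun zeta => (rv V zeta)%:CC) = V.[0].
  transitivity (cint m (fun zeta => 2^-1 * (V.[zeta] + (V.[zeta])^*%C))).
    by apply: eq_cint => zeta _; rewrite ReJ_add mulrC.
  rewrite cintZ; last exact: bmeasD.
  rewrite cintD// cint_conj// cint_poly conjV0.
  by field.
transitivity (cint m (fun zeta => (V.[zeta] * (1 - z * zeta^-1)^-1 +
    (V.[zeta])^*%C * (1 - z * zeta^-1)^-1) - (rv V zeta)%:CC)).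
  apply: eq_cint => zeta Tz; rewrite herglotz_kernelE// /rv ReJ_add.
  set x := V.[zeta]; set y := (x^*)%C; set k := (1 - _)^-1; by field.
rewrite cintB//; last exact: bmeasD.
by rewrite cintD// c1 c2 m0 conjV0 addrK.
Qed.

End Duality.

(** * Primitives of trigonometric polynomials *)

Section Primitive.
Variable R : realType.
Local Notation C := (Cplx R).
Local Notation T := (@circle R).
Local Notation m := (@circle_measure R).
Local Notation "x %:CC" := (x%:C%C : C) (at level 2, format "x %:CC").

Lemma expiX (t : R) k : expi t ^+ k = Complex (cos (k%:R * t)) (sin (k%:R * t)) :> C.
Proof.
elim: k => [|k IH]; first by rewrite expr0 mul0r cos0 sin0.
rewrite exprS IH; apply: complex_ext.
  by rewrite ReM /= mulrSr mulrDl mul1r cosD; ring.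
by rewrite ImM /= mulrSr mulrDl mul1r sinD; ring.
Qed.

Definition prim_term (c : C) (k : nat) (t : R) : R :=
  if k is 0%N then complex.Re c * t
  else (complex.Re c * sin (k%:R * t) + complex.Im c * (cos (k%:R * t) - 1)) / k%:R.

Lemma is_derive_prim_term c k (t : R) :
  is_derive t 1 (prim_term c k) (complex.Re (c * expi t ^+ k)).
Proof.
rewrite expiX ReM /=; case: k => [|k].
  rewrite mul0r cos0 sin0 mulr1 mulr0 subr0 /prim_term.
  by apply: is_derive_eq; rewrite /GRing.scale /= mulr1.
rewrite /prim_term.
have k0 : (k.+1)%:R != 0 :> R by rewrite pnatr_eq0.
have d1 : is_derive t 1 (fun t : R => (k.+1)%:R * t) (k.+1)%:R.
  by apply: is_derive_eq; rewrite /GRing.scale /= mulr1.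
have ds : is_derive t 1 (fun t : R => sin ((k.+1)%:R * t)) (k.+1%:R * cos (k.+1%:R * t)).
  rewrite mulrC; exact: (@is_derive1_comp _ sin (fun t => k.+1%:R * t) t _ _ (is_derive_sin _) d1).
have dc : is_derive t 1 (fun t : R => cos ((k.+1)%:R * t)) (k.+1%:R * - sin (k.+1%:R * t)).
  rewrite mulrC; exact: (@is_derive1_comp _ cos (fun t => k.+1%:R * t) t _ _ (is_derive_cos _) d1).
apply: is_derive_eq; rewrite /GRing.scale /= subr0.
by field.
Qed.

(** An explicit primitive of [t |-> Re V(e^{it})]; it makes visible that high
    frequencies contribute little to it. *)
Definition prim (V : {poly C}) (t : R) : R := \sum_(k < size V) prim_term V`_k k t.

Lemma prim_term0 k t : prim_term 0 k t = 0.
Proof.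
have [r0 i0] : complex.Re (0 : C) = 0 /\ complex.Im (0 : C) = 0 by [].
by case: k => [|k]; rewrite /prim_term r0 ?i0 !mul0r// addr0 mul0r.
Qed.

Lemma prim_widen (V : {poly C}) t n : (size V <= n)%N -> prim V t = \sum_(k < n) prim_term V`_k k t.
Proof.
move=> h; rewrite /prim (big_ord_widen _ (fun k => prim_term V`_k k t) h) big_mkcond /=.
apply: eq_bigr => i _; case: ltnP => // hi.
by rewrite nth_default// prim_term0.
Qed.

Lemma is_derive_prim (V : {poly C}) (t : R) : is_derive t 1 (prim V) (rv V (expi t)).
Proof.
have -> : prim V = \sum_(k < size V) prim_term V`_k k.
  by apply/funext => s; rewrite /prim fct_sumE.
rewrite /rv horner_coef Re_sum; apply: is_derive_sum => i.
exact: is_derive_prim_term.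
Qed.

Lemma prim0 (V : {poly C}) : prim V 0 = 0.
Proof.
rewrite /prim big1// => k _; case: (nat_of_ord k) => [|j]; rewrite /prim_term ?mulr0//.
by rewrite sin0 cos0 subrr !mulr0 addr0 mul0r.
Qed.

Lemma prim2pi (V : {poly C}) : prim V (2 * pi) = complex.Re V.[0] * (2 * pi).
Proof.
have per k : cos (k%:R * (2 * pi)) = 1 :> R /\ sin (k%:R * (2 * pi)) = 0 :> R.
  have E : (Complex (cos (k%:R * (2 * pi))) (sin (k%:R * (2 * pi))) : C) = 1.
    by rewrite -expiX /expi mulr_natl cos2pi sin2pi expr1n.
  by split; [exact: (congr1 (@complex.Re R) E)|exact: (congr1 (@complex.Im R) E)].
rewrite (@prim_widen V _ (size V).+1)// big_ord_recl big1 ?addr0.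
  by rewrite /prim_term /= horner_coef0.
move=> k _; rewrite /prim_term lift0; have [-> ->] := per k.+1.
by rewrite subrr !mulr0 addr0 mul0r.
Qed.

(** The imaginary part of V is controlled by its real part since the mean of
    Re V ^ 2 is nonnegative. *)
Lemma in_range_coef (V : {poly C}) (L : R) M : in_range V L -> complex.Im V.[0] = 0 ->
  \sum_(k < M) normc V`_k ^+ 2 <= 2 * L ^+ 2.
Proof.
move=> hr im0.
have r1 : (1 : R) < 2 by rewrite ltr1n.
have hV := hol_poly 2 V.
have tE n : taylor (fun z : C => V.[z]) n = V`_n.
  have pb : psbound (fun n => V`_n) 1.
    move=> s s0 s1; exists (\sum_(k < size V) normc V`_k) => j.
    have [nV|nV] := ltnP j (size V); last first.
      by rewrite nth_default// normc0C mul0r sumr_ge0// => i _; exact: normc_ge0.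
    rewrite (bigD1 (Ordinal nV))//= -[leLHS]addr0 lerD//.
      by rewrite ler_piMr ?normc_ge0// exprn_ile1 ?ltW.
    by rewrite sumr_ge0// => i _; exact: normc_ge0.
  apply: (pseries_taylor ltr01 pb) => z _.
  apply: (@cvg_trans _ ((fun=> (V.[z] : C)) @ \oo)); last exact: cvg_cst.
  apply: near_eq_cvg; exists (size V) => // N /= hN.
  rewrite /series /= horner_coef big_mkord (big_ord_widen _ (fun k => V`_k * z ^+ k) hN) big_mkcond /=.
  by apply: eq_bigr => i _; case: ltnP => // hi; rewrite nth_default// mul0r.
have c := parseval hV r1.
set E := complex.Re _ in c.
have EL : E <= 2 * L ^+ 2.
  have bv : rbmeas (fun z => rv V z ^+ 2) := rl_rbmeas (rlM (rl_rv V) (rl_rv V)).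
  have bVV : rbmeas (fun z => complex.Re (V * V).[z]) := rl_rbmeas (rl_rv (V * V)).
  have -> : E = 2 * mean (fun z => rv V z ^+ 2) + (-1) * mean (fun z => complex.Re (V * V).[z]).
    rewrite -!meanZ// -meanD; last 2 first.
    - exact: rl_rbmeas (rlM (rl_cst 2) (rlM (rl_rv V) (rl_rv V))).
    - exact: rl_rbmeas (rlM (rl_cst (-1)) (rl_rv (V * V))).
    apply: eq_mean => z _; rewrite normc_sqr hornerM ReM /rv; ring.
  have -> : mean (fun z => complex.Re (V * V).[z]) = complex.Re V.[0] ^+ 2.
    have -> : mean (fun z => complex.Re (V * V).[z]) = complex.Re (cint m (fun z => (V * V).[z])).
      by [].
    by rewrite cint_poly hornerM ReM im0 mulr0 subr0.
  have h1 : mean (fun z => rv V z ^+ 2) <= L ^+ 2.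
    rewrite -[leRHS]mean_cst; apply: le_mean => //; first exact: rl_rbmeas (rl_cst _).
    by move=> z Tz; have /andP[h0 h1] := hr z Tz; rewrite lerXn2r// nnegrE// (le_trans h0).
  have := sqr_ge0 (complex.Re V.[0]); lra.
have nd : nondecreasing_seq (fun N => \sum_(0 <= n < N) normc (taylor (fun z : C => V.[z]) n) ^+ 2).
  by apply: nondecreasing_series => n _ _; exact: sqr_ge0.
apply: le_trans EL.
have := nondecreasing_cvgn_le nd (cvgP _ c) M.
rewrite (cvg_lim _ c)// big_mkord; apply: le_trans.
by apply: ler_sum => i _; rewrite tE.
Qed.

Lemma sum_inv_sqr (N M : nat) : (0 < N)%N -> \sum_(N <= k < M) (k%:R ^+ 2)^-1 <= 2 / N%:R :> R.
Proof.
move=> N0; have [MN|NM] := leqP M N.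
  by rewrite big_geq// divr_ge0.
apply: (@le_trans _ _ (\sum_(N <= k < M) (2 / k%:R - 2 / k.+1%:R))).
  rewrite !big_nat; apply: ler_sum => k /andP[kN _].
  have k0 : (0 : R) < k%:R by rewrite ltr0n (leq_trans N0).
  have k1 : (1 : R) <= k%:R by rewrite ler1n (leq_trans N0).
  rewrite -(natr1 k); move: (k%:R : R) k0 k1 => x x0 x1.
  have -> : 2 / x - 2 / (x + 1) = 2 / (x * (x + 1)) by field; apply/andP; split; lra.
  rewrite ler_pdivlMr; last by rewrite mulr_gt0//; lra.
  have -> : (x ^+ 2)^-1 * (x * (x + 1)) = 1 + x^-1 by field; lra.
  have : x^-1 <= 1 by rewrite invf_le1.
  lra.
rewrite (telescope_sumr_eq (fun k => - (2 / k%:R : R))) ?(ltnW NM)//; last by move=> k _; rewrite opprK addrC.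
have : 0 <= 2 / M%:R :> R by rewrite divr_ge0.
lra.
Qed.

Lemma sqr_le_two (a b c : R) : 0 <= c -> c <= a + b -> c ^+ 2 <= 2 * a ^+ 2 + 2 * b ^+ 2.
Proof. move=> c0 cab; have := sqr_ge0 (a - b); nra. Qed.

Lemma trig_comb_le (S D a b n : R) : `|S| <= 1 -> `|D| <= 1 -> `|a| <= n -> `|b| <= n ->
  `|a * S + b * (D - 1)| <= 3 * n.
Proof.
move=> hS hD ha hb; apply: le_trans (ler_normD _ _) _; rewrite !normrM.
have D2 : `|D - 1| <= 2 by apply: le_trans (ler_normB _ _) _; rewrite normr1; lra.
have := normr_ge0 a; have := normr_ge0 b; have := normr_ge0 S; have := normr_ge0 (D - 1).
move: (`|D - 1|) D2 (`|a|) ha (`|b|) hb (`|S|) hS => d d2 x hx y hy z hz *; nra.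
Qed.

(** A frequency k contributes |c_k| / k to the primitive, and the sum of |c_k| ^ 2
    is at most 8 L ^ 2 by [in_range_coef]; the Cauchy-Schwarz inequality is used in
    the form 2 a b <= s a ^ 2 + b ^ 2 / s. *)
Lemma prim_close (L eps : R) : 0 < L -> 0 < eps -> exists N0, forall (V P : {poly C}) N, (N0 <= N)%N ->
  in_range V L -> in_range (V + 'X^N * P) L -> complex.Im V.[0] = 0 ->
  forall t, `|prim (V + 'X^N * P) t - prim V t| <= eps.
Proof.
move=> L0 e0; pose s := eps / (24 * L ^+ 2).
have s0 : 0 < s by rewrite divr_gt0// mulr_gt0// exprn_gt0.
exists (Num.bound (6 / (s * eps))).+1 => V P N NN hV hW im0 t.
have N0 : (0 < N)%N by apply: leq_trans NN.
set W := V + 'X^N * P.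
have low k : (k < N)%N -> W`_k = V`_k.
  by move=> kN; rewrite coefD coefXnM kN addr0.
have imW : complex.Im W.[0] = 0 by rewrite horner_coef0 low// -horner_coef0.
pose M := (N + maxn (size V) (size W))%N.
have hVM : (size V <= M)%N by rewrite /M; apply: leq_trans (leq_addl _ _); exact: leq_maxl.
have hWM : (size W <= M)%N by rewrite /M; apply: leq_trans (leq_addl _ _); exact: leq_maxr.
rewrite (prim_widen _ hWM) (prim_widen _ hVM) -sumrB.
rewrite -(big_mkord predT (fun k => prim_term W`_k k t - prim_term V`_k k t)).
rewrite (big_cat_nat (n := N))//=; last by rewrite /M leq_addr.
rewrite big_nat big1 ?add0r; last by move=> k /andP[_ kN]; rewrite low// subrr.
pose c k := W`_k - V`_k.
have hterm k : (0 < k)%N ->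
    `|prim_term W`_k k t - prim_term V`_k k t| <= (3 / 2) * (s * normc (c k) ^+ 2 + s^-1 * (k%:R ^+ 2)^-1).
  case: k => // k _; have kp : (0 : R) < k.+1%:R by rewrite ltr0n.
  have -> : prim_term W`_k.+1 k.+1 t - prim_term V`_k.+1 k.+1 t =
      (complex.Re (c k.+1) * sin (k.+1%:R * t) + complex.Im (c k.+1) * (cos (k.+1%:R * t) - 1)) / k.+1%:R.
    by rewrite /prim_term /c ReB ImB; ring.
  rewrite normrM normfV (gtr0_norm kp).
  have h1 : `|complex.Re (c k.+1) * sin (k.+1%:R * t) + complex.Im (c k.+1) * (cos (k.+1%:R * t) - 1)|
      <= 3 * normc (c k.+1).
    have := Re_le (c k.+1); have := Im_le (c k.+1).
    have := sin_max (k.+1%:R * t); have := cos_max (k.+1%:R * t).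
    move=> hD hS hb ha; exact: trig_comb_le.
  apply: (@le_trans _ _ (3 * normc (c k.+1) / k.+1%:R)).
    by rewrite ler_pM2r// invr_gt0.
  have si : s * s^-1 = 1 by rewrite mulfV// gt_eqF.
  have si0 : 0 < s^-1 by rewrite invr_gt0.
  rewrite -mulrA -exprVn; move: (normc _) (k.+1%:R^-1) => n x.
  have h : 0 <= s * (n - s^-1 * x) ^+ 2 by rewrite mulr_ge0 ?sqr_ge0// ltW.
  have h2 : s * (n - s^-1 * x) ^+ 2 = s * n ^+ 2 + s^-1 * x ^+ 2 - 2 * (n * x).
    have -> : s * (n - s^-1 * x) ^+ 2 = s * n ^+ 2 + (s * s^-1) * s^-1 * x ^+ 2 - 2 * (s * s^-1) * (n * x) by ring.
    by rewrite si mul1r mulr1.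
  by move: h; rewrite h2; lra.
apply: le_trans (ler_norm_sum _ _ _) _.
apply: (@le_trans _ _ (\sum_(N <= k < M) (3 / 2) * (s * normc (c k) ^+ 2 + s^-1 * (k%:R ^+ 2)^-1))).
  by rewrite !big_nat; apply: ler_sum => k /andP[kN _]; apply: hterm; exact: leq_trans kN.
rewrite -mulr_sumr big_split /= -!mulr_sumr.
have hc : \sum_(N <= k < M) normc (c k) ^+ 2 <= 8 * L ^+ 2.
  apply: (@le_trans _ _ (\sum_(N <= k < M) (2 * normc W`_k ^+ 2 + 2 * normc V`_k ^+ 2))).
    apply: ler_sum => k _; have := normcB_le W`_k V`_k; rewrite -/(c k).
    move=> h.
    exact: sqr_le_two (normc_ge0 _) h.
  apply: (@le_trans _ _ (\sum_(0 <= k < M) (2 * normc W`_k ^+ 2 + 2 * normc V`_k ^+ 2))).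
    rewrite [leRHS](big_cat_nat (n := N))//=; last by rewrite /M leq_addr.
    by rewrite lerDr sumr_ge0// => k _; rewrite addr_ge0// mulr_ge0// sqr_ge0.
  rewrite big_split /= -!mulr_sumr !big_mkord.
  have := in_range_coef M hV im0; have := in_range_coef M hW imW; lra.
have hk := sum_inv_sqr M N0.
have hs : s * (8 * L ^+ 2) = eps / 3.
  by rewrite /s; field; rewrite gt_eqF.
clearbody s.
have hN : s^-1 * (2 / N%:R) <= eps / 3.
  have : 6 / (s * eps) <= N%:R.
    apply: le_trans (ltW (archi_boundP _)) _; first by rewrite divr_ge0// mulr_ge0// ltW.
    by rewrite ler_nat; exact: ltnW.
  rewrite ler_pdivrMr; last by rewrite mulr_gt0.
  have Np : (0 : R) < N%:R by rewrite ltr0n.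
  move=> h; have -> : s^-1 * (2 / N%:R) = 2 / (s * N%:R) by rewrite invfM mulrCA.
  rewrite ler_pdivrMr ?mulr_gt0//; move: h; lra.
have h1 : s * \sum_(N <= k < M) normc (c k) ^+ 2 <= eps / 3 by rewrite -hs ler_pM2l.
have h2 : s^-1 * \sum_(N <= k < M) (k%:R ^+ 2)^-1 <= eps / 3.
  by apply: le_trans hN; rewrite ler_pM2l// invr_gt0.
move: h1 h2; set A := s * _; set B := s^-1 * _ => h1 h2; lra.
Qed.

End Primitive.

(** * Distribution functions *)

Section WeakLimit.
Variable R : realType.
Local Notation C := (Cplx R).
Local Notation T := (@circle R).
Local Notation m := (@circle_measure R).
Local Notation "x %:CC" := (x%:C%C : C) (at level 2, format "x %:CC").

Lemma half_pow_le (e : R) : 0 < e -> exists n, 2^-1 ^+ n <= e.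
Proof.
move=> e0; exists (Num.bound (e^-1)).
have h : e^-1 <= 2 ^+ Num.bound (e^-1).
  apply: le_trans (ltW (archi_boundP _)) _; first by rewrite invr_ge0 ltW.
  by rewrite -natrX ler_nat ltnW// ltn_expl.
by rewrite exprVn invf_ple// posrE exprn_gt0.
Qed.

Lemma le0_half_pow (c x : R) : 0 < c -> (forall n, x <= c * 2^-1 ^+ n) -> x <= 0.
Proof.
move=> c0 h; rewrite leNgt; apply/negP => x0.
have xc : 0 < x / (2 * c) by rewrite divr_gt0// mulr_gt0.
have [n hn] := half_pow_le xc.
have := h n; move: hn; rewrite ler_pdivlMr ?mulr_gt0//; lra.
Qed.

Lemma uniform_limit (u : nat -> R -> R) : (forall n t, `|u n.+1 t - u n t| <= 2^-1 ^+ n) ->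
  exists G, forall n t, `|G t - u n t| <= 2 * 2^-1 ^+ n.
Proof.
move=> hu; exists (fun t => limn (fun n => u n t - 2 * 2^-1 ^+ n)) => n t.
pose a n := u n t - 2 * 2^-1 ^+ n; pose b n := u n t + 2 * 2^-1 ^+ n.
have ha : nondecreasing_seq a.
  apply/nondecreasing_seqP => k; rewrite /a exprS; have := hu k t.
  by rewrite ler_norml => /andP[]; move: (2^-1 ^+ k) => x; lra.
have hb : nonincreasing_seq b.
  apply/nonincreasing_seqP => k; rewrite /b exprS; have := hu k t.
  by rewrite ler_norml => /andP[]; move: (2^-1 ^+ k) => x; lra.
have ab k : a k <= b k by rewrite /a /b; have : 0 <= 2^-1 ^+ k :> R by []; lra.
have abn k l : a k <= b l.
  have [kl|/ltnW kl] := leqP k l; first exact: le_trans (ha _ _ kl) (ab l).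
  exact: le_trans (ab k) (hb _ _ kl).
have cv : cvgn a.
  apply: nondecreasing_is_cvgn => //; exists (b 0%N) => _ [k _ <-]; exact: abn.
have h1 := nondecreasing_cvgn_le ha cv n.
have h2 : limn a <= b n by apply: limr_le => //; apply: nearW => k.
by rewrite ler_norml; move: h1 h2; rewrite /a /b; lra.
Qed.

Definition is_cdf (G : R -> R) := [/\ nondecreasing G, continuous G,
  forall t, t <= 0 -> G t = 0 & forall t, 2 * pi <= t -> G t = 1].

Lemma is_cdf_limit (u : nat -> R -> R) (G : R -> R) : (forall n, is_cdf (u n)) ->
  (forall n t, `|G t - u n t| <= 2 * 2^-1 ^+ n) -> is_cdf G.
Proof.
move=> hu hG; split.
- move=> s t st; rewrite -subr_le0; apply: (@le0_half_pow 4) => // n.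
  have [nd _ _ _] := hu n; have := nd s t st; have := hG n s; have := hG n t.
  by rewrite !ler_norml; lra.
- move=> t; apply/cvgrPdist_le => e e0.
  have [n hn] := half_pow_le (divr_gt0 e0 (ltr0n _ 8%N)).
  have [_ ct _ _] := hu n.
  have e2 : 0 < e / 2 by rewrite divr_gt0.
  have /cvgrPdist_le /(_ _ e2) := ct t.
  apply: filterS => s; have := hG n s; have := hG n t; rewrite !ler_norml; lra.
- move=> t t0; apply/eqP; rewrite -normr_le0; apply: (@le0_half_pow 2) => // n.
  by have [_ _ /(_ t t0) h _] := hu n; have := hG n t; rewrite h subr0.
- move=> t t0; apply/eqP; rewrite -subr_eq0 -normr_le0; apply: (@le0_half_pow 2) => // n.
  by have [_ _ _ /(_ t t0) h] := hu n; have := hG n t; rewrite h.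
Qed.

Lemma lebesgue_stieltjes_itv (F : cumulative R R) a b : a <= b ->
  lebesgue_stieltjes_measure F `]a, b]%classic = (F b - F a)%:E.
Proof.
move=> ab; rewrite /lebesgue_stieltjes_measure /measure_extension measurable_mu_extE/=; last exact: is_ocitv.
by rewrite wlength_itv_bnd.
Qed.

Lemma cdf_measure (G : R -> R) : is_cdf G -> exists P : probability (measurableTypeR R) R,
  forall a b, a <= b -> P `]a, b]%classic = (G b - G a)%:E.
Proof.
move=> [nd ct G0 G1].
have rc : right_continuous G by apply: right_continuousW.
have cN : G @ -oo --> (0 : R).
  apply: (@cvg_trans _ ((fun=> (0 : R)) @ -oo)); last exact: cvg_cst.
  by apply: near_eq_cvg; exists 0; split; rewrite ?num_real// => t /ltW t0; rewrite G0.
have cP : G @ +oo --> (1 : R).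
  apply: (@cvg_trans _ ((fun=> (1 : R)) @ +oo)); last exact: cvg_cst.
  by apply: near_eq_cvg; exists (2 * pi); split; rewrite ?num_real// => t /ltW t0; rewrite G1.
pose m1 := isCumulative.Build R _ R G nd rc.
pose m2 := isCumulativeBounded.Build R 0 1 G cN cP.
pose F : cumulativeBounded 0 1 := HB.pack G m1 m2.
exists (lebesgue_stieltjes_measure F) => a b ab.
exact: (lebesgue_stieltjes_itv F).
Qed.

Definition knot (N i : nat) : R := i%:R * (2 * pi / N%:R).

Lemma knotS N i : knot N i.+1 = knot N i + 2 * pi / N%:R.
Proof. by rewrite /knot -natr1 mulrDl mul1r. Qed.

Lemma le_knot N i : knot N i <= knot N i.+1.
Proof. by rewrite knotS lerDl divr_ge0// mulr_ge0// pi_ge0. Qed.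

Lemma knotN N : (0 < N)%N -> knot N N = 2 * pi.
Proof. by move=> N0; rewrite /knot mulrC divfK// pnatr_eq0 -lt0n. Qed.

Lemma knot_ge0 N i : 0 <= knot N i.
Proof. by rewrite mulr_ge0// divr_ge0// mulr_ge0// pi_ge0. Qed.

Definition rsum (h G : R -> R) (N : nat) :=
  \sum_(i < N) h (knot N i) * (G (knot N i.+1) - G (knot N i)).

Lemma rsum_close (h G K : R -> R) N e : (forall t, `|h t| <= 1) ->
  (forall t, `|G t - K t| <= e) -> `|rsum h G N - rsum h K N| <= N%:R * (2 * e).
Proof.
move=> h1 hGK; rewrite /rsum -sumrB; apply: le_trans (ler_norm_sum _ _ _) _.
apply: (@le_trans _ _ (\sum_(i < N) (2 * e))); last first.
  by rewrite sumr_const card_ord -[leLHS]mulr_natl.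
apply: ler_sum => i _.
have -> : h (knot N i) * (G (knot N i.+1) - G (knot N i)) - h (knot N i) * (K (knot N i.+1) - K (knot N i)) =
  h (knot N i) * ((G (knot N i.+1) - K (knot N i.+1)) - (G (knot N i) - K (knot N i))) by ring.
rewrite normrM -[leRHS]mul1r; apply: ler_pM => //.
apply: le_trans (ler_normB _ _) _; have := hGK (knot N i.+1); have := hGK (knot N i); lra.
Qed.

(** Both sides of the moment identity are compared with the same Riemann-Stieltjes
    sums, which only see the distribution function; here for a measure. *)
Lemma rsum_measure (P : probability (measurableTypeR R) R) (G h : R -> R) (om : R) N :
  is_cdf G -> (forall a b, a <= b -> P `]a, b]%classic = (G b - G a)%:E) ->
  continuous h -> (forall t, `|h t| <= 1) -> 0 <= om ->
  (forall s t, s <= t -> `|h t - h s| <= om * (t - s)) -> (0 < N)%N ->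
  `|(\int[P]_t h t)%R - rsum h G N| <= om * (2 * pi / N%:R).
Proof.
move=> hG hP ch h1 om0 hom N0.
pose d : R := 2 * pi / N%:R.
have d0 : 0 <= d by rewrite divr_ge0// mulr_ge0// pi_ge0.
have ihg (f : R -> R) M (D : set (measurableTypeR R)) : continuous f -> (forall t, `|f t| <= M) ->
    measurable D -> P.-integrable D (EFin \o (f : measurableTypeR R -> R)).
  move=> cf fM mD; apply: (@integrableS _ _ _ P setT) => //.
  apply: measurable_bounded_integrable => //.
  - exact: le_lt_trans (probability_le1 P measurableT) (ltry 1).
  - exact: measurable_realfun.continuous_measurable_fun.
  by exists M; split; rewrite ?num_real// => x x1 t _ /=; apply: le_trans (fM t) (ltW x1).
have ih (D : set (measurableTypeR R)) : measurable D -> P.-integrable D (EFin \o h).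
  exact: ihg ch h1.
have [nd _ G0 G1] := hG.
have mI a b : measurable (`]a, b]%classic : set (measurableTypeR R)) by exact: measurable_itv.
have fineP a b : a <= b -> fine (P `]a, b]%classic) = G b - G a by move=> ab; rewrite hP.
have step i : `|(\int[P]_(t in `]knot N i, knot N i.+1]) h t)%R - h (knot N i) * (G (knot N i.+1) - G (knot N i))|
    <= om * d * (G (knot N i.+1) - G (knot N i)).
  set D := `]knot N i, knot N i.+1]%classic.
  have mD : measurable (D : set (measurableTypeR R)) by exact: measurable_itv.
  have icst c : P.-integrable D (EFin \o (fun=> c : R)) by apply: finite_measure_integrable_cst.
  have E c : (\int[P]_(t in D) c)%R = c * (G (knot N i.+1) - G (knot N i)).
    by rewrite Rintegral_cst// fineP// le_knot.
  rewrite -!E -RintegralB//; last exact: ih.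
  have ihB : P.-integrable D (EFin \o (fun t => h t - h (knot N i))).
    apply: (ihg _ 2) => //; first by move=> t; exact: (cvgB (ch t) (cvg_cst _)).
    by move=> t; apply: le_trans (ler_normB _ _) _; have := h1 t; have := h1 (knot N i); lra.
  apply: le_trans (le_normr_Rintegral mD ihB) _.
  apply: le_Rintegral => //.
    apply: (ihg _ 2) => //.
      by move=> t; exact: (cvg_norm (cvgB (ch t) (cvg_cst _))).
    by move=> t; rewrite normr_id; apply: le_trans (ler_normB _ _) _; have := h1 t; have := h1 (knot N i); lra.
  move=> t; rewrite /D /= in_itv /= => /andP[t1 t2].
  apply: le_trans (hom _ _ (ltW t1)) _; rewrite ler_wpM2l//.
  by move: t2; rewrite knotS -/d; lra.
have main k : `|(\int[P]_(t in `]0%R, knot N k]) h t)%R - \sum_(i < k) h (knot N i) * (G (knot N i.+1) - G (knot N i))|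
    <= om * d * G (knot N k).
  elim: k => [|k IH].
    rewrite big_ord0 /knot mul0r subr0 set_itv_ge; last by rewrite bnd_simp ltxx.
    by rewrite Rintegral_set0 normr0 G0// mulr0.
  rewrite big_ord_recr /=.
  have -> : (\int[P]_(t in `]0%R, knot N k.+1]) h t)%R =
     (\int[P]_(t in `]0%R, knot N k]) h t)%R + (\int[P]_(t in `]knot N k, knot N k.+1]) h t)%R.
    have E : `]0%R, knot N k.+1]%classic = `]0%R, knot N k]%classic `|` `]knot N k, knot N k.+1]%classic.
      apply: itv_bndbnd_setU; rewrite bnd_simp; first exact: knot_ge0.
      exact: le_knot.
    rewrite E Rintegral_setU//.
    + by rewrite -E; apply: ih; exact: mI.
    + apply/disj_setPS => t; rewrite /= !in_itv /= => -[/andP[_ a1] /andP[a2 _]].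
      by move: a1 a2; rewrite leNgt => /negP.
  have := step k; move: IH; set S := \sum_(i < k) _.
  set A := Rintegral _ _ _; set B := Rintegral _ _ _.
  move=> IH st.
  set c := h _ * _ in st *.
  have -> : A + B - (S + c) = (A - S) + (B - c) by ring.
  apply: le_trans (ler_normD _ _) _; move: IH st; rewrite mulrBr; lra.
have -> : (\int[P]_t h t)%R = (\int[P]_(t in `]0%R, knot N N]) h t)%R.
  congr fine; rewrite [LHS](@negligible_integral _ _ _ P setT (~` `]0%R, knot N N]%classic)).
  - by rewrite setTD setCK.
  - exact: measurableC.
  - exact: measurableT.
  - exact: ih.
  - apply: (etrans (probability_setC P (mI 0 (knot N N)))).
    by rewrite hP ?knot_ge0// knotN// G1// G0// subr0 subee.
have := main N; rewrite knotN// G1// mulr1; exact.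
Qed.

Lemma le_of_derive_ge0 (f f' : R -> R) (a b : R) : a <= b ->
  (forall x, a <= x <= b -> is_derive x 1 f (f' x)) -> (forall x, a <= x <= b -> 0 <= f' x) -> f a <= f b.
Proof.
move=> ab df f0.
have [c hc E] : exists2 c, c \in `[a, b] & f b - f a = f' c * (b - a).
  apply: MVT_segment => //.
    by move=> x; rewrite in_itv /= => /andP[h1 h2]; apply: df; rewrite !ltW.
  apply: continuous_in_subspaceT => x; rewrite inE /= in_itv /= => hx.
  by apply: differentiable_continuous; apply/derivable1_diffP; have [] := df x hx.
rewrite -subr_ge0 E mulr_ge0//; last by rewrite subr_ge0.
by apply: f0; move: hc; rewrite in_itv.
Qed.

(** The same Riemann-Stieltjes sums for a measure with density [v]; [H] is a
    primitive of [h v] and [G] one of [v]. *)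
Lemma rsum_density (H G h v : R -> R) (om : R) N :
  (forall t, 0 <= t <= 2 * pi -> is_derive t 1 H (h t * v t)) ->
  (forall t, 0 <= t <= 2 * pi -> is_derive t 1 G (v t)) ->
  (forall t, 0 <= v t) -> 0 <= om ->
  (forall s t, s <= t -> `|h t - h s| <= om * (t - s)) -> (0 < N)%N ->
  `|H (2 * pi) - H 0 - rsum h G N| <= om * (2 * pi / N%:R) * (G (2 * pi) - G 0).
Proof.
move=> dH dG v0 om0 hom N0.
pose d : R := 2 * pi / N%:R.
have knot_le i : (i <= N)%N -> knot N i <= 2 * pi.
  by move=> iN; rewrite -(knotN N0) /knot ler_wpM2r ?ler_nat// divr_ge0// mulr_ge0// pi_ge0.
have step i : (i < N)%N -> `|H (knot N i.+1) - H (knot N i) - h (knot N i) * (G (knot N i.+1) - G (knot N i))|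
    <= om * d * (G (knot N i.+1) - G (knot N i)).
  move=> iN; set s := knot N i; set t := knot N i.+1.
  have st : s <= t := le_knot N i.
  have ts : t - s = d by rewrite /t knotS addrC addKr.
  have in02 x : s <= x <= t -> 0 <= x <= 2 * pi.
    by move=> /andP[h1 h2]; rewrite (le_trans (knot_ge0 N i) h1) (le_trans h2 (knot_le _ iN)).
  have hx x : s <= x <= t -> `|h x - h s| <= om * d.
    move=> /andP[h1 h2]; apply: le_trans (hom _ _ h1) _; rewrite ler_wpM2l// -ts; lra.
  have mono (sg : R) : `|sg| <= 1 -> om * d * G s + sg * (H s - h s * G s) <= om * d * G t + sg * (H t - h s * G t).
    move=> sg1; pose f x := om * d * G x + sg * (H x - h s * G x).
    pose f' x := om * d * v x + sg * (h x * v x - h s * v x).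
    apply: (@le_of_derive_ge0 f f' s t st) => x xst.
      have := dH x (in02 x xst); have := dG x (in02 x xst) => *.
      by rewrite /f /f'; apply: is_derive_eq; rewrite /GRing.scale /=; ring.
    have -> : f' x = (om * d + sg * (h x - h s)) * v x by rewrite /f'; ring.
    rewrite mulr_ge0//; have := hx x xst => hh.
    have : `|sg * (h x - h s)| <= om * d.
      by rewrite normrM; apply: le_trans hh; rewrite ler_piMl.
    by rewrite ler_norml => /andP[]; lra.
  have := mono 1; rewrite normr1 => /(_ (lexx 1)) m1.
  have := mono (-1); rewrite normrN normr1 => /(_ (lexx 1)) m2.
  by rewrite ler_norml; move: m1 m2; move: (om * d) (h s) => x y; nra.
rewrite -{1}(knotN N0) (_ : H 0 = H (knot N 0)); last by rewrite /knot mul0r.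
rewrite -(knotN N0) (_ : G 0 = G (knot N 0)); last by rewrite /knot mul0r.
have tele (F : R -> R) : F (knot N N) - F (knot N 0) = \sum_(i < N) (F (knot N i.+1) - F (knot N i)).
  by rewrite -(big_mkord predT (fun i => F (knot N i.+1) - F (knot N i))) telescope_sumr.
rewrite !tele /rsum -sumrB mulr_sumr knotN//.
apply: le_trans (ler_norm_sum _ _ _) _; apply: ler_sum => i _; exact: step.
Qed.

Lemma lipschitz_of_derive (f f' : R -> R) (k : R) : (forall t : R, is_derive t 1 f (f' t)) -> (forall t, `|f' t| <= k) ->
  forall s t, s <= t -> `|f t - f s| <= k * (t - s).
Proof.
move=> df fk s t st.
have mono (sg : R) : `|sg| <= 1 -> k * s + sg * f s <= k * t + sg * f t.
  move=> sg1; apply: (@le_of_derive_ge0 (fun x => k * x + sg * f x) (fun x => k + sg * f' x) s t st) => x _.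
    by have := df x => *; apply: is_derive_eq; rewrite /GRing.scale /=; ring.
  have : `|sg * f' x| <= k by rewrite normrM; apply: le_trans (fk x); rewrite ler_piMl.
  by rewrite ler_norml => /andP[]; lra.
have := mono 1; rewrite normr1 => /(_ (lexx 1)) m1.
have := mono (-1); rewrite normrN normr1 => /(_ (lexx 1)) m2.
by rewrite ler_norml; lra.
Qed.

Definition clamp (t : R) : R := Num.max 0 (Num.min t (2 * pi)).

Lemma clampE t : 0 <= t <= 2 * pi -> clamp t = t.
Proof. by move=> /andP[t0 t1]; rewrite /clamp min_l// max_r. Qed.

Lemma clamp_lip s t : `|clamp s - clamp t| <= `|s - t|.
Proof.
wlog st : s t / s <= t.
  move=> h; have [|/ltW] := leP s t; first exact: h.
  by move=> /h; rewrite (distrC (clamp t)) (distrC t).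
have h1 (x y p : R) : x <= y -> 0 <= Num.min y p - Num.min x p <= y - x.
  by case: (leP x p) => ?; case: (leP y p) => ?; lra.
have h2 (x y p : R) : x <= y -> 0 <= Num.max p y - Num.max p x <= y - x.
  by case: (leP p x) => ?; case: (leP p y) => ?; lra.
have /andP[a1 a2] := h1 s t (2 * pi) st; rewrite subr_ge0 in a1.
have /andP[b1 b2] := h2 _ _ 0 a1.
rewrite (distrC (clamp s)) (distrC s) (ger0_norm (x := t - s)) ?subr_ge0// ger0_norm//.
exact: le_trans b2 a2.
Qed.

Definition circle_cdf (V : {poly C}) (t : R) : R := prim V (clamp t) / (2 * pi).

Lemma circle_cdf_is_cdf (V : {poly C}) L : in_range V L -> complex.Re V.[0] = 1 ->
  is_cdf (circle_cdf V).
Proof.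
move=> hV V0; have p0 := @pi2_gt0 R; split.
- move=> s t st; rewrite ler_pM2r ?invr_gt0//.
  apply: (@le_of_derive_ge0 (prim V) (fun t => rv V (expi t))).
  + rewrite /clamp ge_max !le_max lexx /=; apply/orP; right.
    by rewrite le_min !ge_min st lexx orbT.
  + by move=> x _; exact: is_derive_prim.
  + by move=> x _; have /andP[] := hV _ (expi_circle x).
- have cc : continuous clamp.
    move=> t; apply/cvgrPdist_le => e e0; near=> s.
    apply: le_trans (clamp_lip t s) _; near: s.
    exact: cvgr_dist_le.
  have cp : continuous (prim V).
    move=> t; apply: differentiable_continuous; apply/derivable1_diffP.
    by have [] := is_derive_prim V t.
  move=> t; apply: cvgM; last exact: cvg_cst.
  exact: (continuous_comp (cc t) (cp _)).
- move=> t t0; rewrite /circle_cdf /clamp max_l ?prim0 ?mul0r//.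
  by rewrite ge_min t0.
- move=> t t1; rewrite /circle_cdf /clamp min_r// max_r ?ltW// prim2pi V0 mul1r divff//.
  by rewrite gt_eqF.
Unshelve. all: by end_near. Qed.

Lemma Rintegral_weak_limit (V : nat -> {poly C}) (L : nat -> R) (G : R -> R)
  (P : probability (measurableTypeR R) R) (hc : C -> R) (om : R) :
  (forall n, in_range (V n) (L n)) -> (forall n, complex.Re (V n).[0] = 1) -> is_cdf G ->
  (forall a b, a <= b -> P `]a, b]%classic = (G b - G a)%:E) ->
  (forall n t, `|G t - circle_cdf (V n) t| <= 2 * 2^-1 ^+ n) ->
  continuous hc -> (forall z, T z -> `|hc z| <= 1) -> 0 <= om ->
  (forall s t, s <= t -> `|hc (expi t) - hc (expi s)| <= om * (t - s)) ->
  (\int[m]_(z in T) (hc z * rv (V n) z))%R @[n --> \oo] --> (\int[P]_t hc (expi t))%R.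
Proof.
move=> hV V0 hG hP hGV chc h1 om0 hom; have p0 := @pi2_gt0 R.
pose h t := hc (expi t).
have ch : continuous h by apply: cont_expi_comp => z _; exact: chc.
have h1' t : `|h t| <= 1 by apply: h1; exact: expi_circle.
have main n N : (0 < N)%N -> `|(\int[P]_t h t)%R - (\int[m]_(z in T) (hc z * rv (V n) z))%R|
    <= om * (2 * pi) * 2 / N%:R + N%:R * (4 * 2^-1 ^+ n).
  move=> N0.
  have crv : continuous (rv (V n)).
    move=> z; have z1 : normc z < normc z + 1 by rewrite ltrDl.
    exact: (@cvg_Re R _ _ _ _ _ (hol_cont (hol_poly (normc z + 1) (V n)) z1)).
  have ck : continuous (fun t => h t * rv (V n) (expi t)).
    by move=> t; apply: cvgM; [exact: ch | exact: (cont_expi_comp (fun z _ => crv z))].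
  have [H dH] : exists H : R -> R, forall x, 0 <= x <= 2 * pi -> is_derive x 1 H (h x * rv (V n) (expi x)).
    apply: (@primitive_exists R _ (-1) (2 * pi + 1)); [|lra|lra|lra].
    by move=> x _; exact: ck.
  have E : (\int[m]_(z in T) (hc z * rv (V n) z))%R = (H (2 * pi) - H 0) / (2 * pi).
    apply: (@Rintegral_circle R (fun z => hc z * rv (V n) z) H).
    by move=> z _; exact: (cvgM (chc z) (crv z)).
  have hd := @rsum_density H (prim (V n)) h (fun t => rv (V n) (expi t)) om N dH.
  have {}hd : `|H (2 * pi) - H 0 - rsum h (prim (V n)) N| <= om * (2 * pi / N%:R) * (2 * pi).
    have Ep : prim (V n) (2 * pi) - prim (V n) 0 = 2 * pi by rewrite prim2pi prim0 V0 mul1r subr0.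
    rewrite -[X in _ <= _ * X]Ep; apply: hd => //; first by move=> t _; exact: is_derive_prim.
    by move=> t; have /andP[] := hV n _ (expi_circle t).
  have Er : rsum h (prim (V n)) N = rsum h (circle_cdf (V n)) N * (2 * pi).
    rewrite /rsum mulr_suml; apply: eq_bigr => i _.
    have k i' : (i' <= N)%N -> circle_cdf (V n) (knot N i') * (2 * pi) = prim (V n) (knot N i').
      move=> iN; rewrite /circle_cdf divfK ?gt_eqF// clampE// knot_ge0/=.
      by rewrite -(knotN N0) /knot ler_wpM2r ?ler_nat// divr_ge0// ltW.
    by rewrite -mulrA mulrBl !k// ltnW.
  have A := rsum_measure hG hP ch h1' om0 hom N0.
  have B := rsum_close N h1' (hGV n).
  have D : `|(\int[m]_(z in T) (hc z * rv (V n) z))%R - rsum h (circle_cdf (V n)) N| <= om * (2 * pi / N%:R).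
    rewrite E -(ler_pM2r p0); apply: le_trans hd; rewrite Er.
    rewrite -[X in _ * X <= _](gtr0_norm p0) -normrM mulrBl divfK//.
    by rewrite gt_eqF.
  move: A B D; set x := Rintegral _ _ _; set y := Rintegral _ _ _.
  set r1 := rsum _ _ _; set r2 := rsum _ _ _ => A B D.
  have -> : x - y = (x - r1) + (r1 - r2) - (y - r2) by ring.
  apply: le_trans (ler_normB _ _) _; have := ler_normD (x - r1) (r1 - r2).
  have -> : om * (2 * pi) * 2 / N%:R = om * (2 * pi / N%:R) * 2 by ring.
  move: A B D; set w := om * (_ / _); lra.
apply/cvgrPdist_le => e e0.
pose N := (Num.bound (om * (2 * pi) * 4 / e)).+1.
have N0 : (0 : R) < N%:R by rewrite ltr0n.
have hN : om * (2 * pi) * 2 / N%:R <= e / 2.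
  have : om * (2 * pi) * 4 / e <= N%:R.
    apply: le_trans (ltW (archi_boundP _)) _; last by rewrite ler_nat.
    by rewrite divr_ge0 ?(ltW e0)// mulr_ge0// mulr_ge0// ltW.
  rewrite ler_pdivrMr// ler_pdivrMr//; lra.
have [n0 hn0] := half_pow_le (divr_gt0 e0 (mulr_gt0 (ltr0n R 8%N) N0)).
exists n0 => // n /= n0n.
apply: le_trans (main n N _) _ => //.
have : 2^-1 ^+ n <= 2^-1 ^+ n0 :> R by apply: ler_wiXn2l; rewrite ?invr_ge0// invf_le1//; lra.
move: hn0; rewrite ler_pdivlMr ?mulr_gt0//.
move: (2^-1 ^+ n) (2^-1 ^+ n0) hN => x y hN hy xy.
have : N%:R * (4 * x) <= N%:R * (4 * y) by rewrite ler_pM2l//; lra.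
lra.
Qed.

End WeakLimit.

(** * The limit measure *)

Section WeakLimitC.
Variable R : realType.
Local Notation C := (Cplx R).
Local Notation T := (@circle R).
Local Notation m := (@circle_measure R).
Local Notation "x %:CC" := (x%:C%C : C) (at level 2, format "x %:CC").

Lemma Rintegral_distribution (P : probability (measurableTypeR R) R) (h : C -> R) (M : R) :
  measurable_fun T (h : CplxB R -> R) -> (forall z, T z -> `|h z| <= M) ->
  (\int[distribution P (@expiB R)]_(z in T) h z)%R = (\int[P]_t h (expi t))%R.
Proof.
move=> mh hM; pose h' := (h : CplxB R -> R) \_ T.
have mT := @measurable_circle R.
have mh' : measurable_fun setT h' by apply/(measurable_restrictT _ mT).
have E (z : CplxB R) : z \in T -> h z = h' z by move=> Tz; rewrite /h' patchE Tz.
transitivity (\int[distribution P (@expiB R)]_(z in T) h' z)%R; first exact: eq_Rintegral.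
transitivity (\int[P]_t h' (expi t))%R; last first.
  by apply: eq_Rintegral => t _; rewrite -E// inE; exact: expi_circle.
have ib : P.-integrable setT (EFin \o (fun t : measurableTypeR R => h' (expiB t))).
  apply: measurable_bounded_integrable => //.
  - exact: le_lt_trans (probability_le1 P measurableT) (ltry 1).
  - by apply: measurableT_comp => //; exact: measurable_expi.
  exists M; split; rewrite ?num_real// => x Mx t _ /=.
  by rewrite /h' patchE mem_set; [exact: le_trans (hM _ (expi_circle t)) (ltW Mx)|exact: expi_circle].
rewrite /Rintegral; congr fine.
rewrite [LHS]integral_pushforward//.
- by rewrite expiB_preimage_circle.
- exact/measurable_realfun.measurable_EFinP.
by rewrite expiB_preimage_circle.
Qed.

(** The distribution functions, unlike the densities, converge uniformly. Their
    limit defines a Lebesgue-Stieltjes measure on the line, which is pushed to the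
    circle. *)
Lemma circle_weak_limit (V : nat -> {poly C}) (L : nat -> R) :
  (forall n, in_range (V n) (L n)) -> (forall n, complex.Re (V n).[0] = 1) ->
  (forall n t, `|prim (V n.+1) t - prim (V n) t| <= 2^-1 ^+ n) ->
  exists nu : {finite_measure set (CplxB R) -> \bar R}, [/\ nu (~` T) = 0%E, nu T = 1%E &
    forall k, cint m (fun z => z ^+ k * (rv (V n) z)%:CC) @[n --> \oo] --> cint nu (fun z => z ^+ k)].
Proof.
move=> hV V0 hd; have p0 := @pi2_gt0 R.
have p1 : 1 <= 2 * pi :> R by have := @pi_ge2 R; lra.
have hc n t : `|circle_cdf (V n.+1) t - circle_cdf (V n) t| <= 2^-1 ^+ n.
  rewrite /circle_cdf -mulrBl normrM; apply: le_trans (hd n (clamp t)).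
  by rewrite ler_piMr// normfV gtr0_norm// invf_le1.
have [G hG] := uniform_limit hc.
have cG : is_cdf G := is_cdf_limit (fun n => circle_cdf_is_cdf (hV n) (V0 n)) hG.
have [P hP] := cdf_measure cG.
exists (distribution P (@expiB R)); split.
- rewrite -[LHS]/(P (@expiB R @^-1` (~` T))).
  rewrite (_ : _ @^-1` _ = set0) ?measure0//; apply/seteqP; split => // t /=.
  by move=> /(_ (expi_circle t)).
- rewrite -[LHS]/(P (@expiB R @^-1` T)).
  by rewrite expiB_preimage_circle probability_setT.
move=> k.
have bk := bmeasX k (@bmeas_id R).
have Ek (n : nat) : bmeas (fun z => z ^+ k * (rv (V n) z)%:CC).
  exact: bmeasM bk (laurent_bmeas (rl_rv (V n))).
have ck : continuous (fun z : C => z ^+ k).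
  move=> z; have z1 : normc z < normc z + 1 by rewrite ltrDl.
  exact: (hol_cont (holX _ k) z1).
have k1 (z : C) : T z -> normc (z ^+ k) <= 1.
  by move=> /circle_normc z1; rewrite normcX z1 expr1n.
have dk (t : R) : is_derive t 1 (fun t : R => complex.Re (expi t ^+ k)) (- k%:R * sin (k%:R * t)) /\
            is_derive t 1 (fun t : R => complex.Im (expi t ^+ k)) (k%:R * cos (k%:R * t)).
  have d1 : is_derive t 1 (fun t : R => k%:R * t) k%:R.
    by apply: is_derive_eq; rewrite /GRing.scale /= mulr1.
  split.
    have -> : (fun t : R => complex.Re (expi t ^+ k)) = (fun t => cos (k%:R * t)).
      by apply/funext => s; rewrite expiX.
    rewrite mulNr mulrC -mulNr.
    exact: (@is_derive1_comp _ cos (fun t => k%:R * t) t _ _ (is_derive_cos _) d1).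
  have -> : (fun t : R => complex.Im (expi t ^+ k)) = (fun t => sin (k%:R * t)).
    by apply/funext => s; rewrite expiX.
  rewrite mulrC; exact: (@is_derive1_comp _ sin (fun t => k%:R * t) t _ _ (is_derive_sin _) d1).
have lim (q : C -> R) (q' : R -> R) : (forall z w, q (z - w) = q z - q w) -> (forall z : C, `|q z| <= normc z) ->
    measurable_fun T ((fun z : C => q (z ^+ k)) : CplxB R -> R) ->
    (forall t : R, is_derive t 1 (fun t : R => q (expi t ^+ k)) (q' t)) -> (forall t, `|q' t| <= k%:R) ->
    (\int[m]_(z in T) (q (z ^+ k) * rv (V n) z))%R @[n --> \oo] -->
      (\int[distribution P (@expiB R)]_(z in T) q (z ^+ k))%R.
  move=> qB qn qm dq q'k.
  have q1 z : T z -> `|q (z ^+ k)| <= 1 by move=> Tz; apply: le_trans (qn _) (k1 _ Tz).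
  rewrite (Rintegral_distribution _ qm q1).
  apply: (Rintegral_weak_limit (hc := fun z => q (z ^+ k)) (om := k%:R) hV V0 cG hP hG) => //.
    move=> z; have /cvgCP H := ck z.
    have {}H : normc (w ^+ k - z ^+ k) @[w --> z] --> (0 : R) := H.
    have H0 : `|q (w ^+ k) - q (z ^+ k)| @[w --> z] --> (0 : R).
      apply: (squeeze_cvgr _ (cvg_cst (0:R)) H).
      by near=> x; rewrite normr_ge0/= -qB.
    exact: (cvg_dist0 H0).
  exact: (@lipschitz_of_derive _ (fun t => q (expi t ^+ k)) q').
have [m1 m2 _] := bk.
have scale (n : nat) (z : C) : complex.Re (z ^+ k * (rv (V n) z)%:CC) = complex.Re (z ^+ k) * rv (V n) z /\
    complex.Im (z ^+ k * (rv (V n) z)%:CC) = complex.Im (z ^+ k) * rv (V n) z.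
  by rewrite ReM ImM /= !mulr0 subr0 add0r.
apply: cvg_ReIm.
- have l := lim (@complex.Re R) _ (@ReB R) (@Re_le R) m1 (fun t => (dk t).1).
  rewrite (_ : (fun n => _) = (fun n => (\int[m]_(z in T) (complex.Re (z ^+ k) * rv (V n) z))%R)).
    apply: l => t /=; rewrite normrM normrN normr_nat -[leRHS]mulr1; apply: ler_pM => //; exact: sin_max.
  by apply/funext => n; apply: eq_Rintegral => z _; rewrite (scale n z).1.
- have l := lim (@complex.Im R) _ (@ImB R) (@Im_le R) m2 (fun t => (dk t).2).
  rewrite (_ : (fun n => _) = (fun n => (\int[m]_(z in T) (complex.Im (z ^+ k) * rv (V n) z))%R)).
    apply: l => t /=; rewrite normrM normr_nat -[leRHS]mulr1; apply: ler_pM => //; exact: cos_max.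
  by apply/funext => n; apply: eq_Rintegral => z _; rewrite (scale n z).2.
Unshelve. all: by end_near. Qed.

End WeakLimitC.

(** * Tools for the constructions *)

Section Helpers.
Variable R : realType.
Local Notation C := (Cplx R).
Local Notation T := (@circle R).
Local Notation m := (@circle_measure R).
Local Notation "x %:CC" := (x%:C%C : C) (at level 2, format "x %:CC").

Lemma nneseries_bound (u : nat -> R) : (forall n, 0 <= u n) ->
  (\sum_(0 <= n <oo) (u n)%:E < +oo)%E -> exists S, forall N, \sum_(0 <= n < N) u n <= S.
Proof.
move=> u0 h; exists (fine (\sum_(0 <= n <oo) (u n)%:E)%E) => N.
have f : (\sum_(0 <= n <oo) (u n)%:E)%E \is a fin_num.
  by rewrite ge0_fin_numE// nneseries_ge0// => n _ _; rewrite lee_fin.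
rewrite -lee_fin fineK// -sumEFin; apply: nneseries_lim_ge => n _ _.
by rewrite lee_fin.
Qed.

Lemma nneseries_lty (u : nat -> R) S : (forall n, 0 <= u n) ->
  (forall N, \sum_(0 <= n < N) u n <= S) -> (\sum_(0 <= n <oo) (u n)%:E < +oo)%E.
Proof.
move=> u0 h; apply: (@le_lt_trans _ _ S%:E); last exact: ltry.
apply: lime_le; first by apply: is_cvg_nneseries => n _ _; rewrite lee_fin.
by apply: nearW => N; rewrite sumEFin lee_fin.
Qed.

Lemma half_pow_sum N : \sum_(0 <= n < N) 2^-1 ^+ n <= 2 :> R.
Proof.
have h1 : 2^-1 < 1 :> R by lra.
apply: le_trans (geometric_sum_le N _ h1) _; first by rewrite invr_ge0.
have E : 1 - 2^-1 = 2^-1 :> R by lra.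
by rewrite E invrK.
Qed.

(** Dependent choice where each step may look at the whole past *)
Lemma history_choice (A : Type) (a0 : A) (P : nat -> (nat -> A) -> A -> Prop) :
  (forall n W W' a, (forall i, (i <= n)%N -> W i = W' i) -> P n W a -> P n W' a) ->
  (forall n W, W 0%N = a0 -> (forall i, (i < n)%N -> P i W (W i.+1)) -> exists a, P n W a) ->
  exists W, W 0%N = a0 /\ forall n, P n W (W n.+1).
Proof.
move=> loc ex.
pose good n (W : nat -> A) := W 0%N = a0 /\ forall i, (i < n)%N -> P i W (W i.+1).
have step (nW : {n : nat & {W | good n W}}) : exists a, P (projT1 nW) (sval (projT2 nW)) a.
  by case: nW => n [W [W0 hW]] /=; exact: ex.
have [next hnext] := choice step.
pose upd n (W : nat -> A) a i := if i == n.+1 then a else W i.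
have updP n W a : good n W -> P n W a -> good n.+1 (upd n W a).
  move=> [W0 hW] Pa; split; first by [].
  move=> i; rewrite ltnS leq_eqVlt => /orP[/eqP ->|lt_in].
    rewrite {2}/upd eqxx; apply: loc Pa => j jn.
    by rewrite /upd; case: eqP => // e; move: jn; rewrite e ltnn.
  rewrite {2}/upd eqSS (ltn_eqF lt_in); apply: loc (hW i lt_in) => j ji.
  rewrite /upd; case: eqP => // e; move: (leq_ltn_trans ji lt_in).
  by rewrite e ltnNge leqnSn.
pose st : {n : nat & {W | good n W}} -> {n : nat & {W | good n W}} := fun s =>
  existT _ (projT1 s).+1 (exist _ (upd (projT1 s) (sval (projT2 s)) (next s))
    (updP _ _ _ (svalP (projT2 s)) (hnext s))).
have g0 : good 0%N (fun=> a0) by split.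
pose S := fix S n := if n is k.+1 then st (S k) else existT _ 0%N (exist _ (fun=> a0) g0).
have SE n : projT1 (S n) = n by elim: n => //= n ->.
pose Q n := sval (projT2 (S n)).
have QS n i : (i <= n)%N -> Q n.+1 i = Q n i.
  move=> le_in; rewrite /Q /= /upd; case: eqP => // e.
  by exfalso; move: le_in; rewrite e SE ltnn.
have QD d i : Q (i + d)%N i = Q i i.
  by elim: d => [|d IH]; rewrite ?addn0// addnS QS ?leq_addr.
have Qle i n : (i <= n)%N -> Q n i = Q i i by move=> h; rewrite -(subnKC h) QD.
exists (fun n => Q n n); split; first by [].
move=> n; have [_ h] := svalP (projT2 (S n.+1)).
have nS : (n < projT1 (S n.+1))%N by rewrite SE.
have := h n nS; apply: loc => i le_in.
exact: (Qle i n.+1 (leqW le_in)).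
Qed.

Lemma psum_tail (a : nat -> C) (z f : C) (M : R) N : normc z < 1 -> 0 <= M ->
  (forall n, normc (a n) <= M) -> series (fun n => a n * z ^+ n) @ \oo --> f ->
  normc (f - \sum_(0 <= n < N) a n * z ^+ n) <= M * (normc z ^+ N / (1 - normc z)).
Proof.
move=> z1 M0 aM hf; have z0 := normc_ge0 z.
pose g K := normc (series (fun n => a n * z ^+ n) K - \sum_(0 <= n < N) a n * z ^+ n).
have cg : g K @[K --> \oo] --> normc (f - \sum_(0 <= n < N) a n * z ^+ n).
  exact: (cvg_normc (cvgB hf (cvg_cst _))).
rewrite -(cvg_lim _ cg)//; apply: limr_le; first exact: cvgP cg.
exists N => // K /= NK; rewrite /g /series /= (big_cat_nat (n := N))//= addrAC subrr add0r.
apply: le_trans (normc_sum_le _ _ _) _.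
apply: (@le_trans _ _ (\sum_(N <= n < K) M * normc z ^+ n)).
  apply: ler_sum => n _; rewrite normcM normcX ler_wpM2r// exprn_ge0//.
rewrite -mulr_sumr ler_wpM2l// -{1}[N]add0n big_addn.
rewrite (eq_bigr (fun i => normc z ^+ N * normc z ^+ i)); last first.
  by move=> i _; rewrite addnC exprD.
by rewrite -mulr_sumr ler_wpM2l ?exprn_ge0// geometric_sum_le.
Qed.

Lemma psum_cvg (a_ : nat -> nat -> C) (a : nat -> C) (z : C) N :
  (forall n, a_ j n @[j --> \oo] --> a n) ->
  \sum_(0 <= n < N) a_ j n * z ^+ n @[j --> \oo] --> (\sum_(0 <= n < N) a n * z ^+ n : C).
Proof.
pose s N (b : nat -> C) : C := \sum_(0 <= n < N) b n * z ^+ n.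
have s0 b : s 0%N b = 0 by rewrite /s big_geq.
have sS N' b : s N'.+1 b = s N' b + b N' * z ^+ N' by rewrite /s big_nat_recr.
move=> ha; suff : (fun j => s N (a_ j)) @ \oo --> s N a by [].
clearbody s; elim: N => [|N IH].
  have -> : (fun j => s 0%N (a_ j)) = (fun=> 0) by apply/funext => j; exact: s0.
  by rewrite s0; exact: cvg_cst.
have -> : (fun j => s N.+1 (a_ j)) = (fun j => s N (a_ j) + a_ j N * z ^+ N).
  by apply/funext => j; exact: sS.
rewrite sS; exact: (cvgD IH (cvgM (ha N) (cvg_cst _))).
Qed.

(** The tails are geometric, uniformly in the index of the sequence. *)
Lemma series_cvg_lim (a_ : nat -> nat -> C) (a : nat -> C) (f_ : nat -> C) (f z : C) (M : R) :
  normc z < 1 -> (forall j n, normc (a_ j n) <= M) -> (forall n, a_ j n @[j --> \oo] --> a n) ->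
  (forall j, series (fun n => a_ j n * z ^+ n) @ \oo --> f_ j) ->
  series (fun n => a n * z ^+ n) @ \oo --> f ->
  f_ j @[j --> \oo] --> f.
Proof.
move=> z1 hM ha hf_ hf; have z0 := normc_ge0 z.
have M0 : 0 <= M by apply: le_trans (hM 0%N 0%N); exact: normc_ge0.
have aM n : normc (a n) <= M.
  have c : normc (a_ j n) @[j --> \oo] --> normc (a n) by apply: cvg_normc; exact: ha.
  rewrite -(cvg_lim _ c)//.
  by apply: limr_le; [exact: cvgP c | apply: nearW => j; exact: hM].
apply/cvgCP/cvgrPdist_le => e e0.
have [N hN] : exists N, M * (normc z ^+ N / (1 - normc z)) <= e / 3.
  have c : M * (normc z ^+ N / (1 - normc z)) @[N --> \oo] --> M * (0 / (1 - normc z)).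
    apply: cvgM; first exact: cvg_cst.
    apply: cvgM; last exact: cvg_cst.
    by apply: cvg_expr; rewrite ger0_norm.
  rewrite mul0r mulr0 in c.
  have e3 : 0 < e / 3 by rewrite divr_gt0.
  move/cvgrPdist_le : c => /(_ _ e3) [N _ hN]; exists N.
  have := hN N (leqnn N); rewrite /= sub0r normrN; apply: le_trans; exact: ler_norm.
have e3 : 0 < e / 3 by rewrite divr_gt0.
have /cvgCP /cvgrPdist_le /(_ _ e3) := @psum_cvg a_ a z N ha.
apply: filterS => j; rewrite !sub0r !normrN !ger0_norm ?normc_ge0// => hj.
have t1 := psum_tail N z1 M0 (hM j) (hf_ j); have t2 := psum_tail N z1 M0 aM hf.
move: hj t1 t2; set s1 := \sum_(0 <= n < N) a_ j n * _; set s2 := \sum_(0 <= n < N) a n * _ => hj t1 t2.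
have -> : f_ j - f = (f_ j - s1) + (s1 - s2) - (f - s2) by ring.
have := normcB_le (f_ j - s1 + (s1 - s2)) (f - s2); have := normcD_le (f_ j - s1) (s1 - s2).
lra.
Qed.

(** By Schwarz's formula and the positivity of the real part of the kernel. *)
Lemma in_range_disc (V : {poly C}) (L : R) (z : C) : in_range V L -> complex.Im V.[0] = 0 ->
  normc z < 1 -> 0 <= rv V z <= L.
Proof.
have key (W : {poly C}) : (forall w, T w -> 0 <= rv W w) -> complex.Im W.[0] = 0 -> normc z < 1 -> 0 <= rv W z.
  move=> hW im0 z1; rewrite /rv -(schwarz_formula im0 z1).
  have bK := bmeas_herglotz z1.
  have bv : bmeas (fun zeta => (rv W zeta)%:CC) := laurent_bmeas (rl_rv W).
  rewrite (_ : 0 = complex.Re (cint m (fun=> (0 : C)))); last by rewrite cint_cst mul0r.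
  apply: Re_cint_le; [exact: bmeas_cst | exact: bmeasM|].
  move=> zeta Tz; rewrite ReM /= mulr0 subr0 mulr_ge0//; last exact: hW.
  by apply: le_trans (Re_herglotz_ge Tz z1); rewrite divr_ge0 ?subr_ge0 ?(ltW z1)// addr_ge0// normc_ge0.
move=> hV im0 z1; apply/andP; split.
  by apply: key => // w Tw; have /andP[] := hV w Tw.
have E w : rv ((L%:CC)%:P - V) w = L - rv V w by rewrite /rv hornerD hornerN hornerC ReB.
rewrite -subr_ge0 -E; apply: key => //.
  by move=> w Tw; rewrite E subr_ge0; have /andP[] := hV w Tw.
by rewrite hornerD hornerN hornerC ImB im0 /= subr0.
Qed.

(** This makes the integrals of a fixed polynomial against the densities stationary
    along the construction. *)
Lemma cint_low_high (V Q : {poly C}) N : (0 < N)%N -> (size V <= N)%N ->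
  cint m (fun z => V.[z] * (rv ('X^N * Q) z)%:CC) = 0.
Proof.
move=> N0 VN; have r1 : (1 : R) < 2 by rewrite ltr1n.
have hp (p : {poly C}) : bmeas (fun z : C => p.[z]) := hol_bmeas1 (hol_poly 2 p) r1.
have b1 := bmeasM (hp V) (hp ('X^N * Q)); have b2 := bmeasM (hp V) (bmeas_conj (hp ('X^N * Q))).
transitivity (cint m (fun z => 2^-1 * (V.[z] * ('X^N * Q).[z] + V.[z] * (('X^N * Q).[z])^*%C))).
  by apply: eq_cint => z _; rewrite /rv ReJ_add; ring.
rewrite cintZ ?cintD//; last exact: bmeasD.
have N0' : (N == 0)%N = false by case: (N) N0.
have -> : cint m (fun z => V.[z] * ('X^N * Q).[z]) = 0.
  transitivity (cint m (fun z => (V * ('X^N * Q)).[z])); first by apply: eq_cint => z _; rewrite [RHS]hornerM.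
  by rewrite cint_poly !hornerM hornerXn expr0n N0' mul0r mulr0.
have -> : cint m (fun z => V.[z] * (('X^N * Q).[z])^*%C) = 0; last by rewrite addr0 mulr0.
have E : cint m (fun z => \sum_(k < size V) (V`_k)^*%C * ('X^(N - k) * Q).[z]) = 0.
  rewrite cint_sum; last by move=> k; exact: bmeasM (bmeas_cst _) (hp _).
  rewrite big1// => k _; rewrite cintZ// cint_poly hornerM hornerXn expr0n.
  by rewrite subn_eq0 leqNgt (leq_trans (ltn_ord k) VN) /= mul0r mulr0.
rewrite -[LHS]conjcK -cint_conj// -[RHS]conjc0 -E; congr (_^*)%C.
apply: eq_cint => z Tz; rewrite rmorphM /= conjcK [in LHS](horner_coef V) rmorph_sum mulr_suml.
apply: eq_bigr => k _.
transitivity ((V`_k)^*%C * z^-1 ^+ k * ('X^N * Q).[z]).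
  by congr (_ * _); rewrite [LHS]rmorphM rmorphXn circle_inv.
rewrite -mulrA; congr (_ * _).
rewrite !hornerM !hornerXn mulrA -{1}(subnKC (ltnW (leq_trans (ltn_ord k) VN))) exprD mulrA.
by rewrite -exprMn mulVf ?expr1n ?mul1r// circle_neq0.
Qed.

(** Markov's inequality on the circle *)
Lemma circle_markov (mu : {finite_measure set (CplxB R) -> \bar R}) (g : C -> R) (c : R) :
  rbmeas g -> 0 < c -> (forall z, T z -> 0 <= g z) ->
  (mu (T `&` [set z : CplxB R | (c <= g z)%R]) <= (complex.Re (cint mu (fun z => (g z)%:CC)) / c)%:E)%E.
Proof.
move=> bg c0 g0; have mT := @measurable_circle R.
have [mg _ _] := bg; have [ig _] := bmeas_integrable mu bg.
have h : (c%:E * mu (T `&` [set x | (c%:E <= `|(EFin \o (fun z : CplxB R => g z)) x|)%E]) <=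
    \int[mu]_(x in T) `|(EFin \o (fun z : CplxB R => g z)) x|)%E.
  by apply: le_integral_abse => //; exact/measurable_realfun.measurable_EFinP.
rewrite EFinM lee_pdivlMr// muleC.
have -> : T `&` [set z : CplxB R | (c <= g z)%R] =
    T `&` [set x | (c%:E <= `|(EFin \o (fun z : CplxB R => g z)) x|)%E].
  apply/seteqP; split => z [Tz] /=; rewrite lee_fin ger0_norm//; exact: g0.
apply: le_trans h _; rewrite le_eqVlt; apply/orP; left; apply/eqP.
transitivity (\int[mu]_(x in T) (EFin \o (fun z : CplxB R => g z)) x)%E.
  by apply: eq_integral => z; rewrite inE => Tz /=; rewrite ger0_norm//; exact: g0.
by rewrite /cint /cintegral /= fineK// integrable_fin_num.
Qed.

(** The functional f |-> <f, z^k G> is the k-th coefficient up to a perturbation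
    with small coefficients, to which [orlicz_duality] applies. *)
Lemma coef_small (Phi : R -> R) (eps M kap S : R) (fh gh : nat -> C) (k N : nat) :
  (forall (x y : nat -> R) N,
    (forall n, 0 <= x n) -> (forall n, 0 <= y n <= kap) ->
    \sum_(0 <= n < N) y n ^+ 2 <= M ->
    \sum_(0 <= n < N) x n * y n <= eps * (1 + \sum_(0 <= n < N) Phi (x n))) ->
  0 <= eps -> 0 <= kap -> (forall N, \sum_(0 <= n < N) Phi (normc (fh n)) <= S) ->
  gh 0%N = 1 -> (forall n, (0 < n)%N -> normc (gh n) <= kap) ->
  (forall N, \sum_(0 <= n < N) normc (gh n) ^+ 2 <= M) -> (k < N)%N ->
  normc (fh k) <= eps * (1 + S) +
    normc (\sum_(0 <= n < N) fh n * (if (k <= n)%N then gh (n - k)%N else 0)^*%C).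
Proof.
move=> dual e0 k0 hS g0 gk gM kN; apply: shifted_test => //.
apply: le_trans (dual (fun n => normc (fh n)) _ N _ _ _) _ => //.
- by move=> n; exact: normc_ge0.
- move=> n; case: ifP => kn; last by rewrite lexx.
  by rewrite normc_ge0 gk// subn_gt0.
- apply: le_trans (gM (N - k)%N).
  rewrite (big_cat_nat (n := k))//=; last exact: ltnW.
  rewrite big_nat big1 ?add0r; last by move=> n /andP[_ nk]; rewrite ltnNge ltnW// expr0n.
  rewrite -{1}[k]add0n big_addn; apply: ler_sum => i _; rewrite addnK.
  by case: ifP => // _; rewrite expr0n sqr_ge0.
by rewrite ler_wpM2l// lerD2l.
Qed.

End Helpers.

(** * The sequence of densities *)

Section SingularInner.
Variable R : realType.
Local Notation C := (Cplx R).
Local Notation T := (@circle R).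
Local Notation m := (@circle_measure R).
Local Notation "x %:CC" := (x%:C%C : C) (at level 2, format "x %:CC").

Lemma nsmall_refl (V : {poly C}) kap : 0 < kap -> nsmall V V kap.
Proof.
move=> k0; exists 0 => // n n0.
have -> : (fun z : C => cexp (- (V.[z] - V.[z]))) = (fun=> 1).
  by apply/funext => z; rewrite subrr oppr0 cexp0.
rewrite (fcoef_taylor (hol_cst 2 1)) ?ltr1n//.
have -> : fcoef m (fun=> 1) n = cint m (fun z => z^-1 ^+ n).
  by apply: eq_cint => z _; rewrite mul1r.
by rewrite circle_moment_inv eqn0Ngt n0 mulr0n normc0C.
Qed.

Definition singular_step (kap : nat -> R) (n : nat) (W : nat -> {poly C}) (V : {poly C}) :=
  [/\ in_range V (2 ^+ n.+1) /\ V.[0] = 1,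
      exists N Q, [/\ (n < N)%N, forall i, (i <= n)%N -> (size (W i) <= N)%N & V = W n + 'X^N * Q],
      forall t, `|prim V t - prim (W n) t| <= 2^-1 ^+ n,
      energy (2 ^+ n.+1) V <= 1 &
      forall i, (i <= n)%N -> nsmall V (W i) (kap i)].

Lemma singular_sequence (kap : nat -> R) : (forall n, 0 < kap n) ->
  exists W : nat -> {poly C}, W 0%N = 1 /\ forall n, singular_step kap n W (W n.+1).
Proof.
move=> k0; apply: history_choice.
  move=> n W W' V WW' [h1 [N [Q [nN sN E]]] h3 h4 h5]; split => //.
  - exists N, Q; split => //; last by rewrite -WW'.
    by move=> i le_in; rewrite -WW'//; exact: sN.
  - by move=> t; rewrite -WW'.
  - by move=> i le_in; rewrite -WW'//; exact: h5.
move=> n W W0 hW.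
have L0 : 0 < 2 ^+ n.+1 :> R by rewrite exprn_gt0.
have [rW W1] : in_range (W n) (2 ^+ n) /\ (W n).[0] = 1.
  case: n hW {L0} => [_|n /(_ n (ltnSn n)) []//].
  rewrite W0 hornerC; split => // z _; rewrite /rv hornerC expr0 /=.
  by rewrite ler01 lexx.
have rW' : in_range (W n) (2 ^+ n.+1).
  move=> z Tz; have /andP[a b] := rW z Tz; rewrite a (le_trans b)//.
  by rewrite exprS ler_peMl ?exprn_ge0// ler1n.
have sW i : (i <= n)%N -> nsmall (W n) (W i) (kap i).
  rewrite leq_eqVlt => /orP[/eqP ->|lt_in]; first exact: nsmall_refl.
  case: n lt_in hW {W1 rW L0 rW'} => // n lt_in /(_ n (ltnSn n)) [_ _ _ _].
  exact.
have e0 : 0 < 2^-1 ^+ n :> R by rewrite exprn_gt0// invr_gt0.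
have [N1 hN1] := prim_close L0 e0.
pose N := (N1 + n.+1 + \sum_(i < n.+1) size (W i))%N.
pose Ws : seq ({poly C} * R) := [seq (W i, kap i) | i <- iota 0 n.+1].
have hs : forall w, w \in Ws -> nsmall (W n) w.1 w.2.
  move=> w hw; move/mapP : hw => [k]; rewrite mem_iota add0n ltnS => /andP[_ le_in] -> /=; exact: sW.
have [V [rV [Q EV] eV sV]] := @block R _ _ _ 1 N L0 rW' ltr01 hs.
have nN : (n < N)%N by rewrite /N; apply: leq_trans (leq_addr _ _); exact: leq_addl.
exists V; split => //.
- split => //; rewrite EV hornerD hornerM hornerXn W1 expr0n.
  by case: (N) nN => // k _; rewrite mul0r addr0.
- exists N, Q; split => // i le_in; rewrite /N; apply: leq_trans (leq_addl _ _).
  by rewrite (bigD1 (Ordinal (le_in : (i < n.+1)%N)))//= leq_addr.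
- move=> t; rewrite EV; apply: hN1 => //.
  + by rewrite /N -addnA leq_addr.
  + by rewrite -EV.
  + by rewrite W1.
- move=> i le_in; apply: (sV (W i, kap i)); apply/mapP; exists i => //.
  by rewrite mem_iota.
Qed.

End SingularInner.

(** * Singularity of the limit measure *)

Section SingularLimit.
Variable R : realType.
Local Notation C := (Cplx R).
Local Notation T := (@circle R).
Local Notation m := (@circle_measure R).
Local Notation "x %:CC" := (x%:C%C : C) (at level 2, format "x %:CC").
Variables (kap : nat -> R) (W : nat -> {poly C}).
Hypotheses (W0 : W 0%N = 1) (hW : forall n, singular_step kap n W (W n.+1)).

Lemma seq_range n : in_range (W n) (2 ^+ n) /\ (W n).[0] = 1.
Proof.
case: n => [|n]; last by have [] := hW n.
rewrite W0 hornerC; split => // z _; rewrite /rv hornerC expr0 /=.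
by rewrite ler01 lexx.
Qed.

Lemma seq_Im0 n : complex.Im (W n).[0] = 0.
Proof. by have [_ ->] := seq_range n. Qed.

Lemma seq_Re0 n : complex.Re (W n).[0] = 1.
Proof. by have [_ ->] := seq_range n. Qed.

Lemma seq_mean1 n : mean (rv (W n)) = 1.
Proof.
have -> : mean (rv (W n)) = complex.Re (cint m (fun z => (W n).[z])) by [].
by rewrite cint_poly seq_Re0.
Qed.

Lemma energyE (V : {poly C}) L : energy L V = L * mean (rv V) - mean (fun z => rv V z ^+ 2).
Proof.
have b := rl_rbmeas (rl_rv V); have b2 := rl_rbmeas (rlM (rl_rv V) (rl_rv V)).
transitivity (mean (fun z => L * rv V z + (-1) * rv V z ^+ 2)).
  by apply: eq_mean => z _; ring.
rewrite meanD ?meanZ ?mulN1r//.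
  exact: rl_rbmeas (rlM (rl_cst L) (rl_rv V)).
exact: rl_rbmeas (rlM (rl_cst (-1)) (rlM (rl_rv V) (rl_rv V))).
Qed.

Lemma seq_energy n : energy (2 ^+ n) (W n) <= 1.
Proof.
case: n => [|n]; last by have [] := hW n.
rewrite energyE seq_mean1 (_ : mean (fun z => rv (W 0%N) z ^+ 2) = 1).
  by rewrite expr0 mulr1 subrr.
rewrite -[RHS](mean_cst (R := R)); apply: eq_mean => z _.
by rewrite W0 /rv hornerC /= expr1n.
Qed.

Lemma hpoly_bmeas (p : {poly C}) : bmeas (fun z : C => p.[z]).
Proof. by apply: (hol_bmeas1 (hol_poly 2 p)); rewrite ltr1n. Qed.

Lemma rv_bmeas (p : {poly C}) : bmeas (fun z : C => (rv p z)%:CC).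
Proof. exact: laurent_bmeas (rl_rv p). Qed.

Lemma seq_stable (V : {poly C}) n :
  (forall j N, (n <= j)%N -> (j < N)%N -> (forall i, (i <= j)%N -> (size (W i) <= N)%N) -> (size V <= N)%N) ->
  forall d, cint m (fun z => V.[z] * (rv (W (n + d)%N) z)%:CC) = cint m (fun z => V.[z] * (rv (W n) z)%:CC).
Proof.
move=> hV; elim => [|d IH]; first by rewrite addn0.
rewrite addnS -IH; have [_ [N [Q [jN sN E]]] _ _ _] := hW (n + d)%N.
have VN := hV _ _ (leq_addr d n) jN sN.
have b1 := bmeasM (hpoly_bmeas V) (rv_bmeas (W (n + d)%N)).
have b2 := bmeasM (hpoly_bmeas V) (rv_bmeas ('X^N * Q)).
transitivity (cint m (fun z => V.[z] * (rv (W (n + d)%N) z)%:CC + V.[z] * (rv ('X^N * Q) z)%:CC)).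
  by apply: eq_cint => z _; rewrite E /rv hornerD ReD rmorphD mulrDr.
by rewrite cintD// cint_low_high ?addr0//; exact: leq_ltn_trans jN.
Qed.

Lemma seq_stable_lim (V : {poly C}) n :
  (forall j N, (n <= j)%N -> (j < N)%N -> (forall i, (i <= j)%N -> (size (W i) <= N)%N) -> (size V <= N)%N) ->
  cint m (fun z => V.[z] * (rv (W j) z)%:CC) @[j --> \oo] --> cint m (fun z => V.[z] * (rv (W n) z)%:CC).
Proof.
move=> hV; set l := cint m _; apply: (@cvg_trans _ ((fun=> (l : C)) @ \oo)); last exact: cvg_cst.
apply: near_eq_cvg; exists n => // j /= nj.
by rewrite /l -(seq_stable hV (j - n)%N) subnKC.
Qed.

Variable nu : {finite_measure set (CplxB R) -> \bar R}.
Hypotheses (nuC : nu (~` T) = 0%E) (nuT : nu T = 1%E).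
Hypothesis nu_lim : forall k, cint m (fun z => z ^+ k * (rv (W n) z)%:CC) @[n --> \oo] -->
  cint nu (fun z => z ^+ k).

Lemma nu_poly_lim (V : {poly C}) :
  cint m (fun z => V.[z] * (rv (W j) z)%:CC) @[j --> \oo] --> cint nu (fun z => V.[z]).
Proof.
have E (j : nat) : cint m (fun z => V.[z] * (rv (W j) z)%:CC) =
    \sum_(k < size V) V`_k * cint m (fun z => z ^+ k * (rv (W j) z)%:CC).
  have bk k := bmeasM (bmeasX k (@bmeas_id R)) (rv_bmeas (W j)).
  transitivity (cint m (fun z => \sum_(k < size V) V`_k * (z ^+ k * (rv (W j) z)%:CC))).
    apply: eq_cint => z _; rewrite horner_coef mulr_suml.
    by apply: eq_bigr => k _; rewrite mulrA.
  rewrite cint_sum; last by move=> k; exact: bmeasM (bmeas_cst _) (bk k).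
  by apply: eq_bigr => k _; rewrite cintZ.
have -> : cint nu (fun z => V.[z]) = \sum_(k < size V) V`_k * cint nu (fun z => z ^+ k).
  have bk k := bmeasX k (@bmeas_id R).
  transitivity (cint nu (fun z => \sum_(k < size V) V`_k * z ^+ k)).
    by apply: eq_cint => z _; rewrite horner_coef.
  rewrite cint_sum; last by move=> k; exact: bmeasM (bmeas_cst _) (bk k).
  by apply: eq_bigr => k _; rewrite cintZ.
have one (b : nat -> C) : \sum_(k < size V) b k = \sum_(0 <= k < size V) b k * 1 ^+ k.
  by rewrite big_mkord; apply: eq_bigr => k _; rewrite expr1n mulr1.
have -> : (fun j => cint m (fun z => V.[z] * (rv (W j) z)%:CC)) = (fun j =>
    \sum_(0 <= k < size V) (V`_k * cint m (fun z => z ^+ k * (rv (W j) z)%:CC)) * 1 ^+ k).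
  by apply/funext => j; rewrite E; exact: (one (fun k => V`_k * cint m (fun z => z ^+ k * (rv (W j) z)%:CC))).
rewrite (one (fun k => V`_k * cint nu (fun z => z ^+ k))).
apply: (@psum_cvg R (fun j k => V`_k * cint m (fun z => z ^+ k * (rv (W j) z)%:CC))
  (fun k => V`_k * cint nu (fun z => z ^+ k)) 1 (size V)) => k.
have c : (fun=> V`_k : C) @ \oo --> (V`_k : C) by exact: cvg_cst.
exact: (cvgM c (@nu_lim k)).
Qed.

(** Integrals against nu of the density of index n are the integrals against the
    same density, so that the left side is the energy of that density. *)
Lemma nu_defect n :
  complex.Re (cint nu (fun z => (2 ^+ n - rv (W n) z)%:CC)) <= 1.
Proof.
have bn := hpoly_bmeas (W n); have bv := rv_bmeas (W n).
have E : cint nu (fun z => (W n).[z]) = cint m (fun z => (W n).[z] * (rv (W n) z)%:CC).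
  have h : forall j N, (n <= j)%N -> (j < N)%N -> (forall i, (i <= j)%N -> (size (W i) <= N)%N) ->
    (size (W n) <= N)%N by move=> j N nj _; exact.
  exact: (cvg_unique _ (nu_poly_lim (V := W n)) (seq_stable_lim h)).
rewrite (_ : cint nu _ = (2 ^+ n)%:CC - cint nu (fun z => (rv (W n) z)%:CC)); last first.
  transitivity (cint nu (fun z => (2 ^+ n)%:CC - (rv (W n) z)%:CC)).
    by apply: eq_cint => z _; rewrite rmorphB.
  rewrite cintB//; last exact: bmeas_cst.
  by rewrite cint_cst /cmass nuT mulr1.
rewrite ReB; have -> : complex.Re ((2 ^+ n)%:CC) = 2 ^+ n by [].
have -> : complex.Re (cint nu (fun z => (rv (W n) z)%:CC)) = mean (fun z => rv (W n) z ^+ 2).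
  transitivity (complex.Re (cint nu (fun z => (W n).[z]))); first by [].
  rewrite E /mean; apply: (congr1 fine); apply: eq_integral => z _.
  by rewrite ReM /= mulr0 subr0.
by have := seq_energy n; rewrite energyE seq_mean1 mulr1.
Qed.

Definition big_set (n : nat) : set (CplxB R) := T `&` [set z : CplxB R | (2 ^+ n / 2 <= rv (W n) z)%R].
Definition small_set (n : nat) : set (CplxB R) := T `&` [set z : CplxB R | (2 ^+ n / 2 <= 2 ^+ n - rv (W n) z)%R].

Lemma measurable_level (g : C -> R) c : rbmeas g -> measurable (T `&` [set z : CplxB R | (c <= g z)%R]).
Proof.
move=> [mg _ _]; have mT := @measurable_circle R.
have := mg mT `[c, +oo[%classic (measurable_itv _).
by congr measurable; apply/seteqP; split => z /= [Tz]; rewrite in_itv /= andbT.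
Qed.

Lemma defect_rbmeas n : rbmeas (fun z => 2 ^+ n - rv (W n) z).
Proof.
apply: bmeas_ext (bmeasB (bmeas_cst (2 ^+ n)%:CC) (rv_bmeas (W n))) => z _.
by rewrite rmorphB.
Qed.

Lemma two_half_pow n : (1 / (2 ^+ n / 2) = 2 * 2^-1 ^+ n :> R).
Proof. by rewrite exprVn; field; rewrite expf_neq0. Qed.

Lemma big_set_le n : (m (big_set n) <= (2 * 2^-1 ^+ n)%:E)%E.
Proof.
rewrite -two_half_pow -{1}(seq_mean1 n).
apply: (@circle_markov R m (rv (W n)) (2 ^+ n / 2)).
- exact: rv_bmeas.
- by rewrite divr_gt0// exprn_gt0.
- by move=> z Tz; have [h _] := seq_range n; have /andP[] := h z Tz.
Qed.

Lemma small_set_le n : (nu (small_set n) <= (2 * 2^-1 ^+ n)%:E)%E.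
Proof.
have c0 : 0 < 2 ^+ n / 2 :> R by rewrite divr_gt0// exprn_gt0.
apply: le_trans (@circle_markov R nu (fun z => 2 ^+ n - rv (W n) z) (2 ^+ n / 2) (defect_rbmeas n) c0 _) _.
  by move=> z Tz; have [h _] := seq_range n; have /andP[_ ?] := h z Tz; rewrite subr_ge0.
by rewrite -two_half_pow lee_fin ler_pM2r ?invr_gt0//; exact: nu_defect.
Qed.

Lemma sum_measure_lty (mu : {measure set (CplxB R) -> \bar R}) (F : nat -> set (CplxB R)) :
  (forall n, (mu (F n) <= (2 * 2^-1 ^+ n)%:E)%E) -> (\sum_(n <oo) mu (F n) < +oo)%E.
Proof.
move=> h; apply: (@le_lt_trans _ _ (\sum_(0 <= n <oo) (2 * 2^-1 ^+ n)%:E)%E).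
  by apply: lee_nneseries => *; [exact: measure_ge0 | exact: h].
apply: (@nneseries_lty R _ 4) => [n|N]; first by rewrite mulr_ge0// exprn_ge0// invr_ge0.
by rewrite -mulr_sumr; have := @half_pow_sum R N; lra.
Qed.

(** The set where the density exceeds half of its maximum has small Lebesgue measure
    because the density has mean 1, and its complement has small nu measure by
    [nu_defect]. Borel-Cantelli applies to both. *)
Lemma nu_singular : mutually_singular (circle_measure R) nu.
Proof.
have mb n : measurable (big_set n) by exact: measurable_level (rv_bmeas _).
have ms n : measurable (small_set n) by exact: measurable_level (defect_rbmeas n).
have mls : measurable (lim_sup_set big_set).
  by apply: bigcap_measurable => [|k _]; [exists 0%N | apply: bigcup_measurable].
have mlss : measurable (lim_sup_set small_set).
  by apply: bigcap_measurable => [|k _]; [exists 0%N | apply: bigcup_measurable].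
exists (lim_sup_set big_set); split => //.
  apply: lim_sup_set_cvg0 => //; apply: sum_measure_lty; exact: big_set_le.
have z1 : nu (lim_sup_set small_set) = 0%E.
  apply: lim_sup_set_cvg0 => //; apply: sum_measure_lty; exact: small_set_le.
have mT := @measurable_circle R.
apply: (@subset_measure0 _ _ _ nu _ ((~` T) `|` lim_sup_set small_set)).
- exact: measurableC.
- by apply: measurableU => //; exact: measurableC.
- move=> z nz; have [Tz|] := pselect (T z); last by left.
  right => k _; have : exists n, forall j, (n <= j)%N -> ~ big_set j z.
    apply: contrapT => h; apply: nz => n _; apply: contrapT => h2; apply: h.
    by exists n => j nj hj; apply: h2; exists j.
  move=> [n hn]; exists (maxn n k) => /=; first exact: leq_maxr.
  split => //=; have := hn (maxn n k) (leq_maxl _ _).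
  move=> /not_andP[//|/negP]; rewrite -ltNge; set a := 2 ^+ _; lra.
- apply/eqP; rewrite eq_le measure_ge0 andbT.
  have e0 : (nu (~` T) + nu (lim_sup_set small_set) = 0)%E by rewrite nuC z1 adde0.
  have mTC : measurable (~` T : set (CplxB R)) by exact: measurableC.
  have := @measureU2 _ _ _ nu _ _ mTC mlss; by rewrite [X in (_ <= X)%E -> _]e0.
Qed.

End SingularLimit.

(** * The inner function *)

Section PartOne.
Variable R : realType.
Local Notation C := (Cplx R).
Local Notation T := (@circle R).
Local Notation m := (@circle_measure R).
Local Notation "x %:CC" := (x%:C%C : C) (at level 2, format "x %:CC").

Lemma Re_scale (a : R) (z : C) : complex.Re (a%:CC * z) = a * complex.Re z.
Proof. by rewrite ReM /= mul0r subr0. Qed.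

Lemma Re_scaler (a : R) (z : C) : complex.Re (z * a%:CC) = complex.Re z * a.
Proof. by rewrite ReM /= mulr0 subr0. Qed.

(** The phase of the integral is removed by multiplying it by its conjugate. *)
Lemma cint_weight_le (mu : {finite_measure set (CplxB R) -> \bar R}) (g : C -> C) (h : C -> R) :
  bmeas g -> rbmeas h -> (forall z, T z -> normc (g z) <= 1) -> (forall z, T z -> 0 <= h z) ->
  normc (cint mu (fun z => g z * (h z)%:CC)) <= complex.Re (cint mu (fun z => (h z)%:CC)).
Proof.
move=> bg bh g1 h0; set I := cint mu _; set J := complex.Re _.
have bgh := bmeasM bg bh.
have key : normc I ^+ 2 <= normc I * J.
  have -> : normc I ^+ 2 = complex.Re (cint mu (fun z => (I^*)%C * (g z * (h z)%:CC))).
    by rewrite cintZ// -/I conj_normc.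
  have -> : normc I * J = complex.Re (cint mu (fun z => (normc I)%:CC * (h z)%:CC)).
    by rewrite (@cintZ R mu (normc I)%:CC _ bh); exact: esym (Re_scale _ _).
  apply: Re_cint_le; [exact: bmeasM (bmeas_cst _) bgh | exact: bmeasM (bmeas_cst _) bh|].
  move=> z Tz; rewrite mulrA (_ : complex.Re ((normc I)%:CC * (h z)%:CC) = normc I * h z); last exact: Re_scale.
  rewrite (_ : complex.Re ((I^*)%C * g z * (h z)%:CC) = complex.Re ((I^*)%C * g z) * h z); last exact: Re_scaler.
  apply: ler_wpM2r; first exact: h0.
  apply: le_trans (ler_norm _) _; apply: le_trans (Re_le _) _.
  rewrite normcM normc_conj ler_piMr ?normc_ge0//; exact: g1.
have [I0|I0] := eqVneq (normc I) 0.
  rewrite I0 /J (_ : 0 = complex.Re (cint mu (fun=> (0 : C)))); last by rewrite cint_cst mul0r.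
  by apply: Re_cint_le; [exact: bmeas_cst | exact: bh |].
have Ip : 0 < normc I by rewrite lt_neqAle eq_sym I0 normc_ge0.
by move: key; rewrite expr2 ler_pM2l.
Qed.

Section Limit.
Variables (kap : nat -> R) (W : nat -> {poly C}).
Hypotheses (W0 : W 0%N = 1) (hW : forall n, singular_step kap n W (W n.+1)).
Variable nu : {finite_measure set (CplxB R) -> \bar R}.
Hypotheses (nuT : nu T = 1%E).
Hypothesis nu_lim : forall k, cint m (fun z => z ^+ k * (rv (W n) z)%:CC) @[n --> \oo] -->
  cint nu (fun z => z ^+ k).

Let H (z : C) : C := cint nu (herglotz_kernel z).

Lemma hol_H : hol 1 H.
Proof.
apply: hol_ext (hol_herglotz nu (bmeas_cst 1)) => z _.
by apply: eq_cint => zeta _; rewrite mulr1.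
Qed.

(** The weak convergence of the measures gives the convergence of the Taylor
    coefficients of their Herglotz integrals, which are bounded by 1. *)
Lemma H_limit (z : C) : normc z < 1 -> (W j).[z] @[j --> \oo] --> H z.
Proof.
move=> z1; have bK := bmeas_kernel z1.
pose K := cint nu (fun zeta => 1 * (1 - z * zeta^-1)^-1).
pose K_ j := cint m (fun zeta => (rv (W j) zeta)%:CC * (1 - z * zeta^-1)^-1).
have EK : H z = 2 * K - 1.
  transitivity (cint nu (fun zeta => 2 * (1 * (1 - z * zeta^-1)^-1) - 1)).
    by apply: eq_cint => zeta Tz; rewrite herglotz_kernelE// mul1r.
  have b1 := bmeasM (bmeas_cst 1) bK.
  rewrite (cintB nu (bmeasM (bmeas_cst 2) b1) (bmeas_cst 1)) (cintZ nu 2 b1).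
  by congr (_ - _); rewrite [LHS]cint_cst /cmass nuT mulr1.
have EK_ j : (W j).[z] = 2 * K_ j - 1.
  rewrite -(schwarz_formula (seq_Im0 W0 hW j) z1).
  have b1 := bmeasM (rv_bmeas (W j)) bK.
  transitivity (cint m (fun zeta => 2 * ((rv (W j) zeta)%:CC * (1 - z * zeta^-1)^-1) - (rv (W j) zeta)%:CC)).
    by apply: eq_cint => zeta Tz; rewrite herglotz_kernelE//; ring.
  rewrite (cintB m (bmeasM (bmeas_cst 2) b1) (rv_bmeas (W j))) (cintZ m 2 b1).
  congr (_ - _); apply: complex_ext; first exact: seq_mean1 W0 hW j.
  have c : (cint m (fun zeta => (rv (W j) zeta)%:CC))^*%C = cint m (fun zeta => (rv (W j) zeta)%:CC).
    rewrite -cint_conj; last exact: rv_bmeas.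
    by apply: eq_cint => zeta _; rewrite conjc_real.
  have := congr1 (@complex.Im R) c; case: (cint m _) => a b /= hb; lra.
have cK : K_ j @[j --> \oo] --> K.
  apply: (@series_cvg_lim R (fun j n => fcoef m (fun zeta => (rv (W j) zeta)%:CC) n)
    (fun n => fcoef nu (fun=> 1) n) K_ K z 1 z1).
  - move=> j n; rewrite /fcoef.
    rewrite (_ : cint m _ = cint m (fun zeta => zeta^-1 ^+ n * (rv (W j) zeta)%:CC)); last first.
      by apply: eq_cint => zeta _; rewrite mulrC.
    rewrite -(seq_mean1 W0 hW j); apply: cint_weight_le.
    + exact: bmeasX (@bmeas_inv R).
    + exact: rv_bmeas.
    + move=> zeta Tz; rewrite normcX circle_inv// normc_conj.
      by have /circle_normc -> := Tz; rewrite expr1n.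
    + by move=> zeta Tz; have [h _] := seq_range W0 hW j; have /andP[] := h zeta Tz.
  - move=> n; have c := @nu_lim n.
    have e1 j : fcoef m (fun zeta => (rv (W j) zeta)%:CC) n = (cint m (fun zeta => zeta ^+ n * (rv (W j) zeta)%:CC))^*%C.
      rewrite -cint_conj; last exact: bmeasM (bmeasX n (@bmeas_id R)) (rv_bmeas (W j)).
      apply: eq_cint => zeta Tz; rewrite [RHS]rmorphM rmorphXn /= -(circle_inv Tz) mulrC.
      by congr (_ * _); exact: esym (conjc_real _).
    have e2 : fcoef nu (fun=> 1) n = (cint nu (fun zeta => zeta ^+ n))^*%C.
      rewrite -cint_conj; last exact: bmeasX n (@bmeas_id R).
      by apply: eq_cint => zeta Tz; rewrite mul1r [RHS]rmorphXn /= -(circle_inv Tz).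
    rewrite e2 (_ : (fun j => _) = (fun j => (cint m (fun zeta => zeta ^+ n * (rv (W j) zeta)%:CC))^*%C)).
      exact: (cvg_conj c).
    by apply/funext => j; exact: e1.
  - move=> j; exact: (@kernel_series R m _ z (rv_bmeas (W j)) z1).
  - exact: (@kernel_series R nu _ z (bmeas_cst 1) z1).
rewrite EK (_ : (fun j => _) = (fun j => 2 * K_ j - 1)); last by apply/funext => j; exact: EK_.
have c2 : (fun=> (2 : C)) @ \oo --> (2 : C) by exact: cvg_cst.
have c1 : (fun=> (1 : C)) @ \oo --> (1 : C) by exact: cvg_cst.
exact: (cvgB (cvgM c2 cK) c1).
Qed.

End Limit.
End PartOne.

(** * Test functions in the model space *)

Section PartOneEnd.
Variable R : realType.
Local Notation C := (Cplx R).
Local Notation T := (@circle R).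
Local Notation m := (@circle_measure R).
Local Notation "x %:CC" := (x%:C%C : C) (at level 2, format "x %:CC").

Lemma discE (z : C) : disc z <-> normc z < 1.
Proof. by rewrite /disc /= normc_lt. Qed.

Lemma hol_holomorphic (f : C -> C) rho : 1 <= rho -> hol rho f -> holomorphic f.
Proof. by move=> r1 hf z /discE z1; apply: (holP hf); exact: lt_le_trans r1. Qed.

Lemma holomorphic_hol (f : C -> C) : holomorphic f -> hol 1 f.
Proof. by move=> hf; split=> z z1; apply: hf; exact/discE. Qed.

Lemma taylor_at0 (f : C -> C) : taylor f 0 = f 0.
Proof. by rewrite /taylor fact0 divr1. Qed.

Lemma cvg_cexp (u : nat -> C) (l : C) : u @ \oo --> l -> cexp (u j) @[j --> \oo] --> cexp l.
Proof.
move=> hu; have cl := derivable_continuous_C (@derivable_cexp R l).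
exact: (cvg_comp _ _ hu cl).
Qed.

Section Limit.
Variables (kap : nat -> R) (W : nat -> {poly C}).
Hypotheses (W0 : W 0%N = 1) (hW : forall n, singular_step kap n W (W n.+1)).
Variables (H : C -> C) (i : nat).
Hypothesis hH : hol 1 H.
Hypothesis WH : forall z, normc z < 1 -> (W j).[z] @[j --> \oo] --> H z.

Let F (j : nat) (z : C) := cexp (- ((W j).[z] - (W i).[z])).
Let G (z : C) := cexp (- (H z - (W i).[z])).

Lemma F_bound j (z : C) : 0 <= rv (W j) z -> rv (W i) z <= 2 ^+ i -> normc (F j z) <= expR (2 ^+ i).
Proof.
move=> h1 h2; rewrite /F normc_cexp ReN ReB ler_expR.
by move: h1 h2; rewrite /rv; set a := 2 ^+ _; lra.
Qed.

Lemma hol_G : hol 1 G.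
Proof.
apply: hol_cexp.
apply: (hol_ext (f := fun z => (-1) * H z + (W i).[z])).
  by move=> z _; rewrite opprB mulN1r addrC.
by apply: holD; [apply: holM; [exact: hol_cst|exact: hH]|exact: hol_poly].
Qed.

Lemma G_coef n : taylor (F j) n @[j --> \oo] --> taylor G n.
Proof.
apply: (@taylor_cvg R F G (expR (2 ^+ i))) => [j||j z z1|z z1].
- exact: hol_expV.
- exact: hol_G.
- have [r1 _] := seq_range W0 hW j; have [r2 _] := seq_range W0 hW i.
  have /andP[a _] := in_range_disc r1 (seq_Im0 W0 hW j) z1.
  have /andP[_ b] := in_range_disc r2 (seq_Im0 W0 hW i) z1.
  exact: F_bound.
- apply: cvg_cexp.
  have c : (fun=> (W i).[z]) @ \oo --> ((W i).[z] : C) by exact: cvg_cst.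
  exact: (cvgN (cvgB (@WH z z1) c)).
Qed.

Lemma G_coef0 : taylor G 0 = 1.
Proof.
have c := @G_coef 0%N.
have E : (fun j => taylor (F j) 0) = (fun=> 1).
  apply/funext => j; rewrite taylor_at0 /F.
  have [_ ->] := seq_range W0 hW j; have [_ ->] := seq_range W0 hW i.
  by rewrite subrr oppr0 cexp0.
rewrite E in c; have c1 : (fun=> (1 : C)) @ \oo --> (1 : C) by exact: cvg_cst.
exact: (cvg_unique _ c c1).
Qed.

Lemma G_coef_small n : (0 < n)%N -> normc (taylor G n) <= kap i.
Proof.
move=> n0; have c : normc (taylor (F j) n) @[j --> \oo] --> normc (taylor G n).
  by apply: cvg_normc; exact: G_coef.
rewrite -(cvg_lim _ c)//; apply: limr_le; first exact: cvgP c.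
exists i.+1 => // -[//|j] /= ij; have [_ _ _ _ /(_ i ij) [k' /ltW kk h]] := hW j.
exact: le_trans (h n n0) kk.
Qed.

Lemma G_coef_sum N : \sum_(0 <= n < N) normc (taylor G n) ^+ 2 <= expR (2 ^+ i) ^+ 2.
Proof.
have c : \sum_(0 <= n < N) normc (taylor (F j) n) ^+ 2 @[j --> \oo] --> \sum_(0 <= n < N) normc (taylor G n) ^+ 2.
  pose s N (b : nat -> C) : R := \sum_(0 <= n < N) normc (b n) ^+ 2.
  have s0 b : s 0%N b = 0 by rewrite /s big_geq.
  have sS N' b : s N'.+1 b = s N' b + normc (b N') ^+ 2 by rewrite /s big_nat_recr.
  suff : (fun j => s N (taylor (F j))) @ \oo --> s N (taylor G) by [].
  clearbody s; elim: N => [|N IH].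
    have -> : (fun j => s 0%N (taylor (F j))) = (fun=> 0) by apply/funext => j; exact: s0.
    by rewrite s0; exact: cvg_cst.
  have -> : (fun j => s N.+1 (taylor (F j))) = (fun j => s N (taylor (F j)) + normc (taylor (F j) N) ^+ 2).
    by apply/funext => j; exact: sS.
  have cn : normc (taylor (F j) N) @[j --> \oo] --> normc (taylor G N).
    by apply: cvg_normc; exact: G_coef.
  rewrite sS; exact: (cvgD IH (cvgM cn cn)).
rewrite -(cvg_lim _ c)//; apply: limr_le; first exact: cvgP c.
apply: nearW => j; apply: (@bessel R 2); rewrite ?ltr1n//; first exact: hol_expV.
move=> z Tz; have [r1 _] := seq_range W0 hW j; have [r2 _] := seq_range W0 hW i.
by have /andP[a _] := r1 z Tz; have /andP[_ b] := r2 z Tz; exact: F_bound.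
Qed.

(** z^k exp(W i) lies in H^2, so that it may be used to test a function that is
    orthogonal to exp(-H) H^2; the product is z^k G. *)
Lemma test_function (f : C -> C) (k : nat) (Theta : C -> C) :
  (forall z, normc z < 1 -> Theta z = cexp (- H z)) ->
  model_space Theta f ->
  (fun N => \sum_(0 <= n < N) taylor f n * (if (k <= n)%N then taylor G (n - k)%N else 0)^*%C) @ \oo --> (0 : C).
Proof.
move=> hT [_ hf].
pose g (z : C) := z ^+ k * cexp ((W i).[z]).
have hg : hol 2 g by apply: holM; [exact: holX|apply: hol_cexp; exact: hol_poly].
have gH2 : H2 g.
  split; first by apply: hol_holomorphic hg; rewrite ler1n.
  apply: (@nneseries_lty R _ (expR (2 ^+ i) ^+ 2)) => [n|N]; first exact: sqr_ge0.
  apply: (@bessel R 2) => //; first by rewrite ltr1n.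
  move=> z Tz; rewrite /g normcM normcX; have /circle_normc -> := Tz.
  rewrite expr1n mul1r normc_cexp ler_expR.
  by have [r _] := seq_range W0 hW i; have /andP[] := r z Tz.
have := hf g gH2; rewrite /H2_orthogonal.
have E n : taylor (Theta \* g) n = if (k <= n)%N then taylor G (n - k)%N else 0.
  have h1 : hol 1 (fun z => z ^+ k * G z) by apply: holM; [exact: holX|exact: hol_G].
  have h2 (z : C) : normc z < 1 -> z ^+ k * G z = (Theta \* g) z.
    move=> z1; rewrite [RHS]/GRing.mul_fun /g hT// [RHS]mulrCA -cexpD; congr (_ * cexp _).
    by rewrite opprB addrC.
  rewrite -(@taylor_mulXn R 1 G k n ltr01 hol_G).
  exact: esym (taylor_ext ltr01 h2 h1 n).
move=> hh.
have -> : (fun N => \sum_(0 <= n < N) taylor f n * (if (k <= n)%N then taylor G (n - k)%N else 0)^*%C) =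
    series (fun n => taylor f n * (taylor (Theta \* g) n)^* : C).
  by apply/funext => N; apply: eq_bigr => n _; rewrite E conjE.
exact: hh.
Qed.

End Limit.
End PartOneEnd.

(** * The singular inner function *)

Section PartOneTheorem.
Variable R : realType.
Local Notation C := (Cplx R).
Local Notation T := (@circle R).
Local Notation m := (@circle_measure R).
Local Notation "x %:CC" := (x%:C%C : C) (at level 2, format "x %:CC").

Lemma orlicz_scale (Phi : R -> R) (M : nat -> R) : young_function Phi ->
  (Phi x / x ^+ 2) @[x --> 0^'+] --> +oo -> (forall i, 0 <= M i) ->
  exists kap : nat -> R, forall i, 0 < kap i /\ forall (x y : nat -> R) N,
    (forall n, 0 <= x n) -> (forall n, 0 <= y n <= kap i) ->
    \sum_(0 <= n < N) y n ^+ 2 <= M i ->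
    \sum_(0 <= n < N) x n * y n <= 2^-1 ^+ i * (1 + \sum_(0 <= n < N) Phi (x n)).
Proof.
move=> hPhi hgr M0; pose P (i : nat) (k : R) := 0 < k /\ forall (x y : nat -> R) N,
    (forall n, 0 <= x n) -> (forall n, 0 <= y n <= k) ->
    \sum_(0 <= n < N) y n ^+ 2 <= M i ->
    \sum_(0 <= n < N) x n * y n <= 2^-1 ^+ i * (1 + \sum_(0 <= n < N) Phi (x n)).
have h i : exists k, P i k.
  have e0 : 0 < 2^-1 ^+ i :> R by rewrite exprn_gt0// invr_gt0.
  by have [k k0 hk] := orlicz_duality hPhi hgr e0 (M0 i); exists k.
by have [kap hkap] := choice h; exists kap.
Qed.

Lemma taylor_vanish (f : C -> C) : holomorphic f ->
  (forall k, exists S, forall i, normc (taylor f k) <= S * 2^-1 ^+ i) ->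
  forall z, disc z -> f z = 0.
Proof.
move=> hf h z /discE z1; apply: (taylor0_eq0 (holomorphic_hol hf)) z1 => k.
have [S hS] := h k; apply/eqP; rewrite -normc_eq0; apply/eqP/le_anti; rewrite normc_ge0 andbT.
apply: (@le0_half_pow R (`|S| + 1)) => [|i]; first by have := normr_ge0 S; lra.
apply: le_trans (hS i) _; rewrite ler_pM2r ?exprn_gt0 ?invr_gt0//.
by have := ler_norm S; lra.
Qed.

Lemma singular_inner_test (Phi : R -> R) : young_function Phi ->
  (Phi x / x ^+ 2) @[x --> 0^'+] --> +oo ->
  exists2 Theta : C -> C, singular_inner Theta &
    forall f, model_space Theta f ->
      (\sum_(0 <= n <oo) (Phi (normc (taylor f n)))%:E < +oo)%E ->
      forall z, disc z -> f z = 0.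
Proof.
move=> hPhi hgr.
have [kap hk] := @orlicz_scale Phi (fun i => expR (2 ^+ i) ^+ 2) hPhi hgr (fun i => sqr_ge0 _).
have [W [W0 hW]] := singular_sequence (fun i => (hk i).1).
have hd n t : `|prim (W n.+1) t - prim (W n) t| <= 2^-1 ^+ n by have [] := hW n.
have [nu [nuC nuT nul]] := circle_weak_limit (fun n => (seq_range W0 hW n).1) (seq_Re0 W0 hW) hd.
pose H (z : C) : C := cint nu (herglotz_kernel z).
exists (fun z => cexp (- H z)).
  exists nu; split => //; first by rewrite nuT.
  exact: (nu_singular W0 hW nuC nuT nul).
move=> f mf hsum.
have [S hS] : exists S, forall N, \sum_(0 <= n < N) Phi (normc (taylor f n)) <= S.
  by apply: nneseries_bound hsum => n; exact: young_ge0 hPhi (normc_ge0 _).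
have hH : hol 1 H by exact: hol_H.
have WH (z : C) : normc z < 1 -> (W j).[z] @[j --> \oo] --> H z.
  exact: (H_limit W0 hW nuT nul).
have [[hf _] _] := mf; apply: taylor_vanish => // k; exists (1 + S) => i.
pose G (z : C) := cexp (- (H z - (W i).[z])).
pose s (N : nat) : C := \sum_(0 <= n < N) taylor f n * (if (k <= n)%N then taylor G (n - k)%N else 0)^*%C.
have lim : s @ \oo --> (0 : C).
  exact: (test_function W0 hW i hH k (Theta := fun z => cexp (- H z)) (fun z _ => erefl) mf).
have cn : normc (s N) @[N --> \oo] --> (0 : R) by rewrite -normc0C; apply: cvg_normc.
have e0 : 0 <= 2^-1 ^+ i :> R by rewrite exprn_ge0// invr_ge0.
rewrite mulrC -[leRHS]addr0.
have cst : (fun=> 2^-1 ^+ i * (1 + S)) @ \oo --> 2^-1 ^+ i * (1 + S) by exact: cvg_cst.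
have cc : 2^-1 ^+ i * (1 + S) + normc (s N) @[N --> \oo] --> 2^-1 ^+ i * (1 + S) + 0.
  exact: (cvgD cst cn).
rewrite -(cvg_lim _ cc)//; apply: limr_ge; first exact: cvgP cc.
exists k.+1 => // N /= kN.
have [kp dual] := hk i.
apply: (coef_small dual e0 (ltW kp) hS) => //.
- exact: (G_coef0 W0 hW i hH WH).
- by move=> n n0; exact: (@G_coef_small R kap W W0 hW H i hH WH n n0).
- by move=> N2; exact: (@G_coef_sum R kap W W0 hW H i hH WH N2).
Qed.

End PartOneTheorem.

(** * Approximation by Szego kernels *)

Section Kernels.
Variable R : realType.
Local Notation C := (Cplx R).
Local Notation T := (@circle R).
Local Notation m := (@circle_measure R).
Local Notation "x %:CC" := (x%:C%C : C) (at level 2, format "x %:CC").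

(** A finite combination of Szego kernels, given by the list of its coefficients
    and poles; [kc s n] is its n-th Taylor coefficient. *)
Definition kc (s : seq (C * C)) (n : nat) : C := \sum_(x <- s) x.1 * ((x.2)^*)%C ^+ n.
Definition in_disc (s : seq (C * C)) := forall x, x \in s -> normc x.2 < 1.

Lemma kc_nil n : kc [::] n = 0.
Proof. by rewrite /kc big_nil. Qed.

Lemma kc_cons x s n : kc (x :: s) n = x.1 * ((x.2)^*)%C ^+ n + kc s n.
Proof. by rewrite /kc big_cons. Qed.

Lemma in_disc_cons x s : in_disc (x :: s) -> normc x.2 < 1 /\ in_disc s.
Proof.
move=> h; split; first by apply: h; rewrite mem_head.
by move=> y ys; apply: h; rewrite inE ys orbT.
Qed.

Lemma kc_pairing (a : nat -> C) (phi : C -> C) (s : seq (C * C)) : in_disc s ->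
  (forall z, normc z < 1 -> series (fun n => a n * z ^+ n) @ \oo --> phi z) ->
  (fun N => \sum_(0 <= n < N) kc s n * ((a n)^*)%C) @ \oo --> (\sum_(x <- s) x.1 * ((phi x.2)^*)%C : C).
Proof.
move=> hs ha; elim: s hs => [_|x s IH /in_disc_cons [x1 hs]].
  rewrite big_nil; have -> : (fun N => \sum_(0 <= n < N) kc [::] n * ((a n)^*)%C) = (fun=> 0).
    by apply/funext => N; rewrite big1// => n _; rewrite kc_nil mul0r.
  exact: cvg_cst.
rewrite big_cons.
have -> : (fun N => \sum_(0 <= n < N) kc (x :: s) n * ((a n)^*)%C) =
    (fun N => x.1 * ((series (fun n => a n * x.2 ^+ n) N)^*)%C + \sum_(0 <= n < N) kc s n * ((a n)^*)%C).
  apply/funext => N; rewrite /series /= [X in _ = x.1 * X + _](_ : _ = \sum_(0 <= n < N) ((a n)^*)%C * ((x.2)^*)%C ^+ n).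
    rewrite mulr_sumr -big_split /=; apply: eq_bigr => n _.
    by rewrite kc_cons mulrDl; congr (_ + _); rewrite -mulrA; congr (_ * _); rewrite mulrC.
  elim: N => [|N IHN]; first by rewrite !big_geq// conjc0.
  rewrite !big_nat_recr//= -IHN; move: (\sum_(0 <= i < N) _) => y.
  transitivity ((y^*)%C + ((a N * x.2 ^+ N)^*)%C); first exact: rmorphD.
  congr (_ + _); transitivity (((a N)^*)%C * ((x.2 ^+ N)^*)%C); first exact: rmorphM.
  by congr (_ * _); exact: rmorphXn.
have c1 : (fun N => (series (fun n => a n * x.2 ^+ n) N)^*%C) @ \oo --> ((phi x.2)^*%C : C).
  by apply: cvg_conj; exact: ha.
have c0 : (fun=> x.1) @ \oo --> (x.1 : C) by exact: cvg_cst.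
exact: (cvgD (cvgM c0 c1) (IH hs)).
Qed.

Lemma kc_series (s : seq (C * C)) (z : C) : in_disc s -> normc z < 1 ->
  series (fun n => kc s n * z ^+ n) @ \oo --> (\sum_(x <- s) x.1 / (1 - (x.2)^*%C * z) : C).
Proof.
move=> hs z1; elim: s hs => [_|x s IH /in_disc_cons [x1 hs]].
  rewrite big_nil; have -> : series (fun n => kc [::] n * z ^+ n) = (fun=> 0).
    by apply/funext => N; rewrite /series /= big1// => n _; rewrite kc_nil mul0r.
  exact: cvg_cst.
rewrite big_cons; set t : C := (x.2)^*%C * z.
have t1 : normc t < 1.
  rewrite /t normcM normc_conj; have := normc_ge0 z; have := normc_ge0 x.2.
  by move: (normc x.2) (normc z) x1 z1 => u v *; nra.
have t0 : 1 - t != 0.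
  by apply/eqP => h; move: t1; rewrite (_ : t = 1) ?normc1C ?ltxx//; apply/eqP; rewrite eq_sym -subr_eq0 h.
have -> : series (fun n => kc (x :: s) n * z ^+ n) =
    (fun N => x.1 * ((1 - t ^+ N) / (1 - t)) + series (fun n => kc s n * z ^+ n) N).
  apply/funext => N; rewrite /series /=; elim: N => [|N IHN].
    by rewrite !big_geq// expr0 subrr mul0r mulr0 addr0.
  rewrite !big_nat_recr//= IHN kc_cons exprSr.
  have -> : ((x.1 * ((x.2)^*)%C ^+ N + kc s N) * z ^+ N) = x.1 * t ^+ N + kc s N * z ^+ N.
    by rewrite mulrDl /t exprMn mulrA.
  move: (\sum_(0 <= i < N) _) (kc s N * z ^+ N) (t ^+ N) => y w u.
  by move: t t0 {t1 IHN} => t t0; field.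
have ct : t ^+ N @[N --> \oo] --> (0 : C).
  apply/cvgCP; have := @cvg_expr R (normc t); rewrite ger0_norm ?normc_ge0// => /(_ t1).
  by apply: cvg_trans; apply: near_eq_cvg; apply: nearW => N; rewrite subr0 normcX.
have c1 : (fun=> (1 : C)) @ \oo --> (1 : C) by exact: cvg_cst.
pose w : C := (1 - t)^-1.
have ci : (fun=> w) @ \oo --> w by exact: cvg_cst.
have cx : (fun=> x.1) @ \oo --> (x.1 : C) by exact: cvg_cst.
have E : x.1 / (1 - t) = x.1 * ((1 - 0) / (1 - t)) by rewrite subr0 mul1r.
rewrite E; exact: (cvgD (cvgM cx (cvgM (cvgB c1 ct) ci)) (IH hs)).
Qed.

(** The l2 closure of the combinations of kernels *)
Definition approx (p : nat -> C) := forall eta, 0 < eta -> exists2 s, in_disc s &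
  forall N, \sum_(0 <= n < N) normc (kc s n - p n) ^+ 2 <= eta.

Lemma kc_cat s s' n : kc (s ++ s') n = kc s n + kc s' n.
Proof. by rewrite /kc big_cat. Qed.

Lemma kc_scale (c : C) s n : kc [seq (c * x.1, x.2) | x <- s] n = c * kc s n.
Proof. by rewrite /kc big_map mulr_sumr; apply: eq_bigr => x _; rewrite mulrA. Qed.

Lemma sum_sqr_add (u v : nat -> C) N :
  \sum_(0 <= n < N) normc (u n + v n) ^+ 2 <=
    2 * \sum_(0 <= n < N) normc (u n) ^+ 2 + 2 * \sum_(0 <= n < N) normc (v n) ^+ 2.
Proof.
rewrite !mulr_sumr -big_split /=; apply: ler_sum => n _.
exact: sqr_le_two (normc_ge0 _) (normcD_le _ _).
Qed.

Lemma approxD p q : approx p -> approx q -> approx (fun n => p n + q n).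
Proof.
move=> hp hq eta e0; have e4 : 0 < eta / 4 by rewrite divr_gt0.
have [s ds hs] := hp _ e4; have [s' ds' hs'] := hq _ e4.
exists (s ++ s') => [x|N].
  by rewrite mem_cat => /orP[]; [exact: ds|exact: ds'].
apply: (@le_trans _ _ (\sum_(0 <= n < N) normc ((kc s n - p n) + (kc s' n - q n)) ^+ 2)).
  by apply: ler_sum => n _; rewrite kc_cat opprD addrACA.
apply: le_trans (sum_sqr_add _ _ _) _; have := hs N; have := hs' N; lra.
Qed.

Lemma approxZ (c : C) p : approx p -> approx (fun n => c * p n).
Proof.
move=> hp eta e0; have M0 : 0 < normc c ^+ 2 + 1 by rewrite ltr_wpDl// sqr_ge0.
have [s ds hs] := hp _ (divr_gt0 e0 M0).
exists [seq (c * x.1, x.2) | x <- s] => [x /mapP[y ys ->]|N]; first exact: (ds y ys).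
apply: (@le_trans _ _ (normc c ^+ 2 * \sum_(0 <= n < N) normc (kc s n - p n) ^+ 2)).
  by rewrite mulr_sumr; apply: ler_sum => n _; rewrite kc_scale -mulrBr normcM exprMn.
have h := hs N; rewrite ler_pdivlMr// in h.
apply: le_trans h; rewrite mulrC ler_wpM2l ?lerDl// sumr_ge0// => n _; exact: sqr_ge0.
Qed.

(** At the points 0, ep, .., l ep the combination has to be divided by ep ^ l; its
    moments of order n > l are then of size ep ^ (n - l), so that it tends to the
    functional that extracts the l-th coefficient. *)
Lemma vandermonde_moments l : exists a : 'I_l.+1 -> C,
  forall n, (n <= l)%N -> \sum_i a i * (i%:R) ^+ n = (n == l)%:R.
Proof.
pose pts : 'rV[C]_l.+1 := \row_i (i%:R).
pose A := Vandermonde l.+1 pts.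
have uA : A \in unitmx.
  rewrite unitmxE unitfE det_Vandermonde; apply/prodf_neq0 => i _; apply/prodf_neq0 => j ij.
  by rewrite !mxE subr_eq0 eqr_nat; apply/eqP => e; move: ij; rewrite e ltnn.
pose x := invmx A *m delta_mx ord_max (0 : 'I_1).
exists (fun i => x i 0) => n nl.
have E : A *m x = delta_mx ord_max (0 : 'I_1) by rewrite mulmxA mulmxV// mul1mx.
have := congr1 (fun M : 'cV[C]_l.+1 => M (Ordinal (nl : (n < l.+1)%N)) 0) E.
rewrite !mxE eqxx andbT -val_eqE /= => <-.
by apply: eq_bigr => i _; rewrite !mxE mulrC.
Qed.

Lemma approx_monomial l : approx (fun n => (n == l)%:R).
Proof.
move=> eta e0; have [a ha] := vandermonde_moments l.
pose A := \sum_i normc (a i); pose L : R := l.+1%:R.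
have A0 : 0 <= A by apply: sumr_ge0 => i _; exact: normc_ge0.
have L1 : 1 <= L by rewrite /L ler1n.
pose B := A * L ^+ l; have B0 : 0 <= B by rewrite mulr_ge0// exprn_ge0//; lra.
pose d : R := Num.min (1 / 2) (eta / (2 * (B ^+ 2 + 1))).
have d0 : 0 < d by rewrite lt_min divr_gt0//= divr_gt0// mulr_gt0// ltr_wpDl// sqr_ge0.
have d1 : d <= 1 / 2 by rewrite ge_min lexx.
have d2 : d * (2 * (B ^+ 2 + 1)) <= eta.
  by rewrite -ler_pdivlMr ?ge_min ?lexx ?orbT// mulr_gt0// ltr_wpDl// sqr_ge0.
pose ep : R := d / L.
have ep0 : 0 < ep by rewrite divr_gt0//; lra.
have epL : ep * L = d by rewrite /ep divfK// gt_eqF//; lra.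
clearbody ep; clearbody d.
pose s := [seq (a i * ((ep ^+ l)^-1)%:CC, (ep * (i : nat)%:R)%:CC) | i <- enum 'I_l.+1].
have alg (u v w y : C) n : u * v * (w * y) ^+ n = v * w ^+ n * (u * y ^+ n).
  by rewrite exprMn; move: (w ^+ n) (y ^+ n) => p q; ring.
have kcE n : kc s n = ((ep ^+ l)^-1 * ep ^+ n)%:CC * \sum_i a i * (i%:R) ^+ n.
  rewrite /kc big_map big_enum /= mulr_sumr; apply: eq_bigr => i _.
  have E0 : (((ep * (i : nat)%:R)%:CC)^*)%C = (ep%:CC * i%:R : C).
    by transitivity ((ep * (i : nat)%:R)%:CC); [exact: conjc_real|rewrite rmorphM rmorph_nat].
  transitivity (a i * ((ep ^+ l)^-1)%:CC * (ep%:CC * i%:R) ^+ n).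
    by congr (_ * _ ^+ _); exact: E0.
  have e : ((ep ^+ l)^-1 * ep ^+ n)%:CC = ((ep ^+ l)^-1)%:CC * ep%:CC ^+ n by rewrite rmorphM rmorphXn.
  rewrite e; exact: alg.
exists s => [x /mapP[i _ ->]|N].
  rewrite -[X in normc X < _]/((ep * (i : nat)%:R)%:CC) normc_real ger0_norm; last by rewrite mulr_ge0// ltW.
  have : (i : nat)%:R <= L by rewrite /L ler_nat ltnW.
  by move=> h; apply: (@le_lt_trans _ _ (ep * L)); [rewrite ler_pM2l|rewrite epL; lra].
have bnd n : normc (kc s n - (n == l)%:R) ^+ 2 <= if (l < n)%N then B ^+ 2 * d * 2^-1 ^+ (n - l.+1) else 0.
  have [nl|ln] := leqP n l.
    rewrite kcE ha//; case: eqP => [->|_]; last by rewrite mulr0 subrr normc0C expr0n.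
    rewrite mulVf ?expf_neq0 ?gt_eqF// mulr1; have -> : (1 : R)%:CC = 1 by [].
    by rewrite subrr normc0C expr0n.
  rewrite (gtn_eqF ln) subr0 kcE normcM normc_real ger0_norm; last first.
    by rewrite mulr_ge0 ?invr_ge0 ?exprn_ge0// ltW.
  have h1 : normc (\sum_i a i * (i%:R) ^+ n) <= A * L ^+ n.
    apply: le_trans (normc_sum_le _ _ _) _; rewrite /A mulr_suml; apply: ler_sum => i _.
    have iL : (i : nat)%:R <= L by rewrite /L ler_nat ltnW.
    have L0 : 0 <= L by lra.
    by rewrite normcM ler_wpM2l ?normc_ge0// normcX normc_nat lerXn2r ?nnegrE ?ler0n.
  have en : ep ^+ n = ep ^+ l * ep ^+ (n - l) by rewrite -exprD subnKC// ltnW.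
  have Ln : L ^+ n = L ^+ l * L ^+ (n - l) by rewrite -exprD subnKC// ltnW.
  have h2 : (ep ^+ l)^-1 * ep ^+ n * normc (\sum_i a i * (i%:R) ^+ n) <= B * d ^+ (n - l).
    rewrite en mulrA mulVf ?expf_neq0 ?gt_eqF// mul1r -epL exprMn.
    apply: le_trans (ler_wpM2l _ h1) _; first by rewrite exprn_ge0// ltW.
    rewrite Ln /B; move: (ep ^+ _) (L ^+ l) (L ^+ _) => u v w.
    by rewrite le_eqVlt; apply/orP; left; apply/eqP; ring.
  have h3 : d ^+ (n - l) <= d by rewrite -{2}[d]expr1; apply: ler_wiXn2l; rewrite ?subn_gt0//; lra.
  have h4 : d ^+ (n - l) <= 2^-1 ^+ (n - l.+1).
    apply: (@le_trans _ _ (d ^+ (n - l.+1))); first by apply: ler_wiXn2l; [lra|lra|rewrite leq_sub2l].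
    by rewrite lerXn2r ?nnegrE ?invr_ge0//; lra.
  have p0 : 0 <= d ^+ (n - l) by rewrite exprn_ge0// ltW.
  have n0 : 0 <= (ep ^+ l)^-1 * ep ^+ n * normc (\sum_i a i * (i%:R) ^+ n).
    by rewrite mulr_ge0 ?normc_ge0// mulr_ge0 ?invr_ge0 ?exprn_ge0// ltW.
  apply: (@le_trans _ _ ((B * d ^+ (n - l)) ^+ 2)); first by rewrite lerXn2r ?nnegrE// mulr_ge0.
  rewrite exprMn -mulrA ler_wpM2l ?sqr_ge0// expr2.
  exact: ler_pM.
apply: (@le_trans _ _ (\sum_(0 <= n < N) if (l < n)%N then B ^+ 2 * d * 2^-1 ^+ (n - l.+1) else 0)).
  by apply: ler_sum => n _; exact: bnd.
have BD : 0 <= B ^+ 2 * d := mulr_ge0 (sqr_ge0 B) (ltW d0).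
apply: (@le_trans _ _ (B ^+ 2 * d * 2)).
  have [Nl|lN] := leqP N l.+1.
    rewrite big_nat big1; first exact: mulr_ge0 BD (ler0n R 2).
    by move=> n /andP[_ nN]; rewrite ltnNge -ltnS (leq_trans nN Nl).
  rewrite (big_cat_nat (n := l.+1))//=; last exact: ltnW.
  rewrite big_nat big1 ?add0r; last by move=> n /andP[_ nl]; rewrite ltnNge -ltnS nl.
  rewrite -{1}[l.+1]add0n big_addn (eq_bigr (fun i => B ^+ 2 * d * 2^-1 ^+ i)); last first.
    by move=> i _; rewrite addnK ltn_addl.
  by rewrite -mulr_sumr ler_wpM2l ?half_pow_sum.
by move: d2; have := sqr_ge0 B; move: (B ^+ 2) => b b0; lra.
Qed.

Lemma approx_l2 (p : nat -> C) (M : R) : (forall N, \sum_(0 <= n < N) normc (p n) ^+ 2 <= M) -> approx p.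
Proof.
move=> hM.
have fin d : approx (fun n => if (n < d)%N then p n else 0).
  elim: d => [|d IH] eta e0.
    exists [::] => [x|N]; first by rewrite in_nil.
    by rewrite big1 ?ltW// => n _; rewrite kc_nil subr0 normc0C expr0n.
  have [s ds hs] := approxD IH (approxZ (p d) (approx_monomial d)) e0.
  exists s => // N; apply: le_trans (hs N); apply: ler_sum => n _.
  rewrite ltnS leq_eqVlt; case: (eqVneq n d) => [->|nd] /=; first by rewrite ltnn mulr1 add0r.
  by rewrite mulr0 addr0.
have nd : nondecreasing_seq (fun N => \sum_(0 <= n < N) normc (p n) ^+ 2).
  by apply: nondecreasing_series => n _ _; exact: sqr_ge0.
have cv : cvgn (fun N => \sum_(0 <= n < N) normc (p n) ^+ 2).
  by apply: nondecreasing_is_cvgn => //; exists M => _ [N _ <-]; exact: hM.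
move=> eta e0; have e4 : 0 < eta / 4 by rewrite divr_gt0.
have [d hd] : exists d, forall N, \sum_(d <= n < N) normc (p n) ^+ 2 <= eta / 4.
  have /cvgrPdist_le /(_ _ e4) [d _ hd] := cv; exists d => N.
  have [Nd|dN] := leqP N d; first by rewrite big_geq// ltW.
  have := nondecreasing_cvgn_le nd cv N; have := hd d (leqnn d).
  rewrite (big_cat_nat (n := d) (p := N))//=; last exact: ltnW.
  rewrite ler_norml => /andP[_]; lra.
have [s ds hs] := fin d _ e4; exists s => // N.
apply: (@le_trans _ _ (\sum_(0 <= n < N) normc ((kc s n - (if (n < d)%N then p n else 0)) +
    (if (n < d)%N then 0 else - p n)) ^+ 2)).
  by apply: ler_sum => n _; case: ifP => _; rewrite ?addr0// subr0.
apply: le_trans (sum_sqr_add _ _ _) _.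
have h2 : \sum_(0 <= n < N) normc (if (n < d)%N then 0 else - p n) ^+ 2 <= eta / 4.
  apply: le_trans (hd N); have [Nd|dN] := leqP N d.
    by rewrite big_nat big1 ?big_geq// => n /andP[_ nN]; rewrite (leq_trans nN Nd) normc0C expr0n.
  rewrite (big_cat_nat (n := d))//=; last exact: ltnW.
  rewrite big_nat big1 ?add0r; last by move=> n /andP[_ ->]; rewrite normc0C expr0n.
  rewrite !big_nat; apply: ler_sum => n /andP[dn _]; rewrite ltnNge dn /=.
  by rewrite -[X in normc X]sub0r normcB subr0.
have := hs N; lra.
Qed.

End Kernels.

(** * Functionals on H(b) *)

Section RKHS.
Variable R : realType.
Local Notation C := (Cplx R).
Local Notation T := (@circle R).
Local Notation m := (@circle_measure R).
Local Notation "x %:CC" := (x%:C%C : C) (at level 2, format "x %:CC").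

Lemma Re_conj (z : C) : complex.Re (z^*%C) = complex.Re z.
Proof. by case: z. Qed.

Lemma Im_conj (z : C) : complex.Im (z^*%C) = - complex.Im z.
Proof. by case: z. Qed.

Section Fixed.
Variables (b : C -> C) (H : set (C -> C)) (ip : (C -> C) -> (C -> C) -> C).
Hypothesis hr : is_rkhs (fun lambda z : C => (1 - (b lambda)^* * b z) / (1 - lambda^* * z)) H ip.

Let K (lam z : C) : C := (1 - (b lam)^* * b z) / (1 - lam^* * z).
Definition kernel_sum (s : seq (C * C)) (z : C) : C := \sum_(x <- s) x.1 * K x.2 z.

Lemma kernel_sum_mem (f : C -> C) s : H f -> in_disc s -> H (kernel_sum s) /\
  forall h, H h -> ip (kernel_sum s) h = \sum_(x <- s) x.1 * (h x.2)^*%C.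
Proof.
move=> Hf; elim: s => [_|x s IH /in_disc_cons [x1 hs]].
  have E : kernel_sum [::] = (fun z => (-1) * f z + f z).
    by apply/funext => z; rewrite /kernel_sum big_nil mulN1r addNr.
  rewrite E; split; first exact: (rkhs_linear hr).
  by move=> h Hh; rewrite (rkhs_ip_linear hr)// big_nil mulN1r addNr.
have [Hs ips] := IH hs.
have dx : disc x.2 by exact/discE.
have HK : H (K x.2) by exact: (rkhs_kernel hr).
have E : kernel_sum (x :: s) = (fun z => x.1 * K x.2 z + kernel_sum s z).
  by apply/funext => z; rewrite /kernel_sum big_cons.
rewrite E; split; first exact: (rkhs_linear hr).
move=> h Hh; rewrite (rkhs_ip_linear hr)// big_cons ips//; congr (_ * _ + _).
by rewrite (rkhs_ip_conj hr Hh HK) (rkhs_reproducing hr Hh dx) conjE.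
Qed.

(** The square of f + t u is nonnegative for every t of modulus tau; the phase of
    t is chosen opposite to that of <u, f>. Fixing tau avoids square roots. *)
Lemma rkhs_quadratic (f u : C -> C) (tau : R) : H f -> H u -> 0 < tau ->
  2 * tau * normc (ip u f) <= complex.Re (ip f f) + tau ^+ 2 * complex.Re (ip u u).
Proof.
move=> Hf Hu t0.
have key (t : C) : 0 <= normc t ^+ 2 * complex.Re (ip u u) + 2 * complex.Re (t * ip u f) + complex.Re (ip f f).
  pose v z := t * u z + f z.
  have Hv : H v by exact: (rkhs_linear hr).
  have := rkhs_ip_ge0 hr Hv.
  have e1 : ip v v = t * (t * ip u u + ip f u)^*%C + (t * ip u f + ip f f)^*%C.
    rewrite {1}/v (rkhs_ip_linear hr)// (rkhs_ip_conj hr Hv Hu) (rkhs_ip_conj hr Hv Hf) !conjE.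
    by rewrite /v !(rkhs_ip_linear hr).
  rewrite e1 (rkhs_ip_conj hr Hu Hf) conjE lecE => /andP[_].
  rewrite normc_sqr !(ReD, ReM, ImM, ImD, Re_conj, Im_conj) -[complex.Re (0 : C)]/(0 : R).
  set w := (X in 0 <= X -> _); set w' := (X in _ -> 0 <= X).
  have -> : w' = w; last by [].
  rewrite /w /w'; move: (complex.Re t) (complex.Im t) (complex.Re (ip u u)) (complex.Im (ip u u)).
  move: (complex.Re (ip u f)) (complex.Im (ip u f)) (complex.Re (ip f f)) => *; ring.
have [p0|p0] := eqVneq (normc (ip u f)) 0.
  have /eqP := p0; rewrite normc_eq0 => /eqP pz.
  have h := key tau%:CC; rewrite pz mulr0 normc_real (ger0_norm (ltW t0)) in h.
  rewrite pz normc0C; move: h; rewrite -[complex.Re (0 : C)]/(0 : R); lra.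
have pp : 0 < normc (ip u f) by rewrite lt_def p0; exact: normc_ge0.
have := key ((- (tau / normc (ip u f)))%:CC * (ip u f)^*%C).
rewrite -mulrA conj_normc -rmorphM normcM normc_conj normc_real normrN ger0_norm; last first.
  by rewrite divr_ge0// ltW.
rewrite divfK ?gt_eqF//.
have -> : complex.Re ((- (tau / normc (ip u f)) * normc (ip u f) ^+ 2)%:CC) = - (tau * normc (ip u f)).
  by rewrite -[LHS]/(- (tau / normc (ip u f)) * normc (ip u f) ^+ 2); field; rewrite gt_eqF.
lra.
Qed.

Lemma kernel_sum_norm (F g : C -> C) (s : seq (C * C)) (f : C -> C) (eta E E0 D : R) : H f -> in_disc s ->
  hol 1 F -> hol 1 g -> (forall z, normc z < 1 -> F z = b z * g z) ->
  (forall N, \sum_(0 <= n < N) normc (taylor g n) ^+ 2 <= E) ->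
  (fun N => \sum_(0 <= n < N) normc (taylor F n) ^+ 2) @ \oo --> E0 -> E <= E0 + D ->
  (forall N, \sum_(0 <= n < N) normc (kc s n - taylor F n) ^+ 2 <= eta) ->
  complex.Re (ip (kernel_sum s) (kernel_sum s)) <= eta + D.
Proof.
move=> Hf ds hF hg Fbg gE FE0 ED hs.
have [Hs ips] := kernel_sum_mem Hf ds; rewrite ips//.
pose s' := [seq (x.1 * (b x.2)^*%C, x.2) | x <- s].
have ds' : in_disc s' by move=> x /mapP[y ys ->]; exact: (ds y ys).
pose h (z : C) : C := \sum_(x <- s) x.1 / (1 - (x.2)^*%C * z).
pose y (z : C) : C := \sum_(x <- s') x.1 / (1 - (x.2)^*%C * z).
have usE z : kernel_sum s z = h z - b z * y z.
  rewrite /kernel_sum /h /y big_map mulr_sumr -sumrB; apply: eq_bigr => x _ /=.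
  by rewrite /K !conjE; move: ((1 - (x.2)^*%C * z)^-1) ((b x.2)^*%C) (b z) => u v w; ring.
have cQ1 := kc_pairing ds (fun z z1 => kc_series ds z1).
have cQ2 := kc_pairing ds' (fun z z1 => kc_series ds' z1).
have cPF := kc_pairing ds (fun z z1 => taylor_sum hF z1).
have cPG := kc_pairing ds' (fun z z1 => taylor_sum hg z1).
have EPG : \sum_(x <- s') x.1 * (g x.2)^*%C = \sum_(x <- s) x.1 * (F x.2)^*%C :> C.
  rewrite big_map big_seq [RHS]big_seq; apply: eq_bigr => x xs; rewrite -mulrA; congr (_ * _).
  rewrite Fbg; last exact: (ds x xs).
  exact: esym (rmorphM _ _ _).
have EQ : \sum_(x <- s) x.1 * (kernel_sum s x.2)^*%C =
    \sum_(x <- s) x.1 * (h x.2)^*%C - \sum_(x <- s') x.1 * (y x.2)^*%C :> C.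
  rewrite big_map -sumrB; apply: eq_bigr => x _; rewrite usE.
  transitivity (x.1 * ((h x.2)^*%C - (b x.2)^*%C * (y x.2)^*%C)).
    congr (_ * _); transitivity ((h x.2)^*%C - (b x.2 * y x.2)^*%C); first exact: rmorphB.
    by congr (_ - _); exact: rmorphM.
  by rewrite mulrBr mulrA.
rewrite EQ ReB; rewrite EPG in cPG.
set Q1 := \sum_(x <- s) x.1 * (h x.2)^*%C in cQ1 *.
set Q2 := \sum_(x <- s') x.1 * (y x.2)^*%C in cQ2 *.
set P := \sum_(x <- s) x.1 * (F x.2)^*%C in cPF cPG.
pose A N := \sum_(0 <= n < N) kc s n * (kc s n)^*%C.
pose Y N := \sum_(0 <= n < N) kc s' n * (kc s' n)^*%C.
pose PF N := \sum_(0 <= n < N) kc s n * (taylor F n)^*%C.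
pose PG N := \sum_(0 <= n < N) kc s' n * (taylor g n)^*%C.
pose FF N := \sum_(0 <= n < N) normc (taylor F n) ^+ 2.
have cA : complex.Re (A N) @[N --> \oo] --> complex.Re Q1 by exact: (cvg_Re cQ1).
have cY : complex.Re (Y N) @[N --> \oo] --> complex.Re Q2 by exact: (cvg_Re cQ2).
have cF : complex.Re (PF N) @[N --> \oo] --> complex.Re P by exact: (cvg_Re cPF).
have cG : complex.Re (PG N) @[N --> \oo] --> complex.Re P by exact: (cvg_Re cPG).
have cst (c : R) : (fun=> c) @ \oo --> c by exact: cvg_cst.
pose X N := ((eta + E) - FF N) + (2 * complex.Re (PF N) - 2 * complex.Re (PG N)) - (complex.Re (A N) - complex.Re (Y N)).
have cX : X N @[N --> \oo] --> ((eta + E) - E0) + (2 * complex.Re P - 2 * complex.Re P) - (complex.Re Q1 - complex.Re Q2).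
  exact: (cvgB (cvgD (cvgB (cst (eta + E)) FE0) (cvgB (cvgM (cst 2) cF) (cvgM (cst 2) cG))) (cvgB cA cY)).
have X0 N : 0 <= X N.
  have pt (p q r t : C) : complex.Re (p * p^*%C) - complex.Re (q * q^*%C) <= normc (p - r) ^+ 2 - normc r ^+ 2 +
      normc t ^+ 2 + (2 * complex.Re (p * r^*%C) - 2 * complex.Re (q * t^*%C)).
    rewrite !normc_sqr; case: p => p1 p2; case: q => q1 q2; case: r => r1 r2; case: t => t1 t2.
    rewrite !(ReM, ReB, ImB) /=; have := sqr_ge0 (q1 - t1); have := sqr_ge0 (q2 - t2); nra.
  have : complex.Re (A N) - complex.Re (Y N) <= \sum_(0 <= n < N) normc (kc s n - taylor F n) ^+ 2 - FF N +
      \sum_(0 <= n < N) normc (taylor g n) ^+ 2 + (2 * complex.Re (PF N) - 2 * complex.Re (PG N)).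
    rewrite /A /Y /PF /PG /FF !Re_sum !mulr_sumr -!sumrB -!big_split /=.
    by apply: ler_sum => n _; exact: pt.
  have := hs N; have := gE N; rewrite /X; lra.
have : 0 <= ((eta + E) - E0) + (2 * complex.Re P - 2 * complex.Re P) - (complex.Re Q1 - complex.Re Q2).
  rewrite -(cvg_lim _ cX)//; apply: limr_ge; first exact: cvgP cX.
  by apply: nearW.
lra.
Qed.

Lemma normc_pairing_sym (u v : nat -> C) N :
  normc (\sum_(0 <= n < N) u n * (v n)^*%C) = normc (\sum_(0 <= n < N) v n * (u n)^*%C).
Proof.
rewrite -normc_conj; congr normc; elim: N => [|N IH]; first by rewrite !big_geq// conjc0.
rewrite !big_nat_recr//= -IH; move: (\sum_(0 <= i < N) _) => w.
transitivity (w^*%C + (u N * (v N)^*%C)^*%C); first exact: rmorphD.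
congr (_ + _); transitivity ((u N)^*%C * ((v N)^*%C)^*%C); first exact: rmorphM.
by rewrite conjcK mulrC.
Qed.

(** The functional <., F> is small on H(b) when F = b g and the l2 norms of g and
    F are close: if h is a combination of Szego kernels, the squared H(b)-norm of
    the functional <., h> is |h|^2 - |T h|^2 with T the adjoint of multiplication
    by b, and |T h|^2 >= 2 Re <T h, g> - |g|^2 = 2 Re <h, F> - |g|^2. *)
Lemma rkhs_test (f F g : C -> C) (S2 E E0 D tau e : R) k : H f ->
  (forall N, \sum_(0 <= n < N) normc (taylor f n) ^+ 2 <= S2) ->
  hol 1 F -> hol 1 g -> (forall z, normc z < 1 -> F z = b z * g z) ->
  (forall N, \sum_(0 <= n < N) normc (taylor g n) ^+ 2 <= E) ->
  (fun N => \sum_(0 <= n < N) normc (taylor F n) ^+ 2) @ \oo --> E0 -> E <= E0 + D ->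
  0 < tau -> 0 < e -> exists2 N, (k < N)%N &
  normc (\sum_(0 <= n < N) taylor f n * (taylor F n)^*%C) <=
    (complex.Re (ip f f) + tau ^+ 2 * D) / (2 * tau) + e.
Proof.
move=> Hf fS hF hg Fbg gE FE0 ED t0 e0.
have hf : hol 1 f by apply: holomorphic_hol; exact: (rkhs_holomorphic hr).
have S0 : 0 <= S2 by have := fS 0%N; rewrite big_geq.
have den : 0 < tau + S2 + 3 by lra.
pose eta := Num.min 1 (e / (tau + S2 + 3)).
have eta0 : 0 < eta by rewrite lt_min ltr01 divr_gt0.
have eta1 : eta <= 1 by rewrite ge_min lexx.
have etae : eta * (tau + S2 + 3) <= e by rewrite -ler_pdivlMr// ge_min lexx orbT.
clearbody eta.
have Fb N : \sum_(0 <= n < N) normc (taylor F n) ^+ 2 <= E0.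
  rewrite -(cvg_lim _ FE0)//; apply: nondecreasing_cvgn_le; last exact: cvgP FE0.
  by apply: nondecreasing_series => n _ _; exact: sqr_ge0.
have [s ds hs] := approx_l2 Fb (exprn_gt0 2 eta0).
have [Hs ips] := kernel_sum_mem Hf ds.
have Q := kernel_sum_norm Hf ds hF hg Fbg gE FE0 ED hs.
have quad := rkhs_quadratic Hf Hs t0.
set I := ip (kernel_sum s) f in quad.
have cI : (fun N => \sum_(0 <= n < N) kc s n * (taylor f n)^*%C) @ \oo --> I.
  rewrite /I ips//; apply: kc_pairing => // z z1; exact: (taylor_sum hf z1).
have /cvgCP /cvgrPdist_le /(_ _ eta0) [N0 _ hN0] := cI.
exists (maxn N0 k.+1); first exact: leq_maxr.
have := hN0 _ (leq_maxl N0 k.+1); set N := maxn _ _; rewrite /= sub0r normrN ger0_norm ?normc_ge0// => hN.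
rewrite normc_pairing_sym.
set SF := \sum_(0 <= n < N) taylor F n * _; set Sh := \sum_(0 <= n < N) kc s n * _ in hN.
have d1 : normc (SF - Sh) <= eta * (S2 + 1) / 2.
  rewrite /SF /Sh -sumrB; apply: le_trans (normc_sum_le _ _ _) _.
  apply: (@le_trans _ _ (\sum_(0 <= n < N) (eta / 2 * normc (taylor f n) ^+ 2 +
      (2 * eta)^-1 * normc (kc s n - taylor F n) ^+ 2))).
    apply: ler_sum => n _; rewrite -mulrBl normcM normc_conj normcB.
    move: (normc (taylor F n - _)) (normc (taylor f n)) => x y.
    rewrite -(ler_pM2l (mulr_gt0 (ltr0n R 2%N) eta0)).
    have -> : 2 * eta * (eta / 2 * y ^+ 2 + (2 * eta)^-1 * x ^+ 2) = (eta * y) ^+ 2 + x ^+ 2.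
      by field; rewrite gt_eqF.
    by have := sqr_ge0 (eta * y - x); nra.
  rewrite big_split /= -!mulr_sumr.
  have h1 : eta / 2 * \sum_(0 <= n < N) normc (taylor f n) ^+ 2 <= eta / 2 * S2.
    by rewrite ler_wpM2l// divr_ge0// ltW.
  have h2 : (2 * eta)^-1 * \sum_(0 <= n < N) normc (kc s n - taylor F n) ^+ 2 <= (2 * eta)^-1 * eta ^+ 2.
    by rewrite ler_wpM2l// invr_ge0 mulr_ge0// ltW.
  have h3 : (2 * eta)^-1 * eta ^+ 2 = eta / 2 by field; rewrite gt_eqF.
  move: h1 h2; rewrite h3; set z1 := eta / 2 * _; set z2 := (2 * eta)^-1 * _; lra.
have d2 : normc SF <= normc I + eta + eta * (S2 + 1) / 2.
  have -> : SF = (SF - Sh) + ((Sh - I) + I) by ring.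
  have := normcD_le (SF - Sh) ((Sh - I) + I); have := normcD_le (Sh - I) I; lra.
apply: le_trans d2 _.
have d3 : normc I <= (complex.Re (ip f f) + tau ^+ 2 * D) / (2 * tau) + tau * eta ^+ 2 / 2.
  have -> : (complex.Re (ip f f) + tau ^+ 2 * D) / (2 * tau) + tau * eta ^+ 2 / 2 =
      (complex.Re (ip f f) + tau ^+ 2 * (eta ^+ 2 + D)) / (2 * tau) by field; rewrite gt_eqF.
  rewrite ler_pdivlMr ?mulr_gt0// mulrC; apply: le_trans quad _.
  by rewrite lerD2l ler_wpM2l// sqr_ge0.
have d4 : tau * eta ^+ 2 <= tau * eta by rewrite ler_pM2l// expr2 ler_piMl// ltW.
have p1 := mulr_ge0 (ltW eta0) S0; have p2 := mulr_ge0 (ltW eta0) (ltW t0).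
move: d3 d4 etae p1 p2; set z1 := _ / (2 * tau); lra.
Qed.

End Fixed.
End RKHS.

(** * The outer function *)

Section OuterFunction.
Variable R : realType.
Local Notation C := (Cplx R).
Local Notation T := (@circle R).
Local Notation m := (@circle_measure R).
Local Notation "x %:CC" := (x%:C%C : C) (at level 2, format "x %:CC").

(** The negative frequencies of a real function are the conjugates of the positive
    ones, and conjugating a monomial does not change its real part. *)
Lemma rl_completion (w : C -> R) : rl w ->
  exists U : {poly C}, complex.Im U.[0] = 0 /\ forall z, T z -> rv U z = w z.
Proof.
move=> [d [p hp]].
pose tm (k : nat) : {poly C} := if (d <= k)%N then p`_k *: 'X^(k - d) else (p`_k)^*%C *: 'X^(d - k).
pose P := \sum_(k < size p) tm k.
pose U := P - (Complex 0 (complex.Im P.[0]))%:P.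
have re z : T z -> rv P z = w z.
  move=> Tz; have z0 := circle_neq0 Tz.
  have ei e : z^-1 ^+ e * z ^+ e = 1 by rewrite -exprMn mulVf// expr1n.
  have -> : w z = complex.Re (z^-1 ^+ d * p.[z]).
    by rewrite hp// mulrA ei mul1r.
  rewrite /rv /P horner_sum (horner_coef p) mulr_sumr !Re_sum; apply: eq_bigr => k _.
  rewrite /tm; case: leqP => dk.
    rewrite hornerZ hornerXn; congr complex.Re.
    have ek : z ^+ k = z ^+ d * z ^+ (k - d) by rewrite -exprD subnKC.
    by rewrite ek mulrCA; congr (_ * _); rewrite mulrA ei mul1r.
  have -> : z^-1 ^+ d * (p`_k * z ^+ k) = p`_k * z^-1 ^+ (d - k).
    have ed : z^-1 ^+ d = z^-1 ^+ k * z^-1 ^+ (d - k) by rewrite -exprD subnKC// ltnW.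
    by rewrite ed mulrCA; congr (_ * _); rewrite mulrAC ei mul1r.
  rewrite hornerZ hornerXn; transitivity (complex.Re ((p`_k * z^-1 ^+ (d - k))^*%C)); last first.
    by case: (p`_k * _).
  congr complex.Re; transitivity ((p`_k)^*%C * (z^-1 ^+ (d - k))^*%C); last exact: esym (rmorphM _ _ _).
  congr (_ * _); transitivity (((z^-1)^*%C) ^+ (d - k)); last exact: esym (rmorphXn _ _ _).
  by rewrite circle_inv// conjcK.
exists U; split.
  by rewrite /U hornerD hornerN hornerC ImB /= subrr.
by move=> z Tz; rewrite /rv /U hornerD hornerN hornerC ReB /= subr0; exact: re.
Qed.

Definition gap (n : nat) : R := 2^-1 ^+ n.+2.
Definition height (n : nat) : R := (2 * n + 1)%:R / gap n.

Lemma gap_gt0 n : 0 < gap n.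
Proof. by rewrite exprn_gt0// invr_gt0. Qed.

Lemma gap_lt1 n : gap n <= 2^-1.
Proof. by rewrite /gap exprS ler_piMr ?invr_ge0// exprn_ile1 ?invr_ge0// invf_le1//; lra. Qed.

Lemma height_gt0 n : 0 < height n.
Proof. by rewrite divr_gt0 ?gap_gt0// ltr0n addn1. Qed.

Lemma height_gap n : height n * gap n = (2 * n + 1)%:R.
Proof. by rewrite divfK// gt_eqF// gap_gt0. Qed.

Definition base (n : nat) : R := height n * (1 - gap n).
Definition tol (n : nat) : R :=
  height n ^+ 2 * (gap n / 2) * expR (- (2 * height n)) * (2^-1 ^+ n) ^+ 2.

Lemma outer_blocks (kap : nat -> R) : (forall n, 0 < kap n) ->
  exists V : nat -> {poly C}, forall n, [/\ in_range (V n) (height n), (V n).[0] = (base n)%:CC,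
    energy (height n) (V n) <= tol n & nsmall (V n) ((base n)%:CC)%:P (kap n)].
Proof.
move=> k0.
have h n : exists V : {poly C}, [/\ in_range V (height n), V.[0] = (base n)%:CC,
    energy (height n) V <= tol n & nsmall V ((base n)%:CC)%:P (kap n)].
  have h0 := height_gt0 n; have g0 := gap_gt0 n; have g1 := gap_lt1 n.
  have r0 : in_range ((base n)%:CC)%:P (height n).
    move=> z _; rewrite /rv hornerC -[complex.Re _]/(base n) /base; apply/andP; split.
      by rewrite mulr_ge0 ?ltW//; lra.
    by rewrite ler_piMr ?ltW//; lra.
  have t0 : 0 < tol n.
    have p1 : 0 < 2^-1 ^+ n :> R by rewrite exprn_gt0// invr_gt0.
    exact: mulr_gt0 (mulr_gt0 (mulr_gt0 (exprn_gt0 2 h0) (divr_gt0 g0 (ltr0n _ 2%N))) (expR_gt0 _)) (exprn_gt0 2 p1).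
  pose Ws : seq ({poly C} * R) := [:: (((base n)%:CC)%:P, kap n)].
  have hs : forall x, x \in Ws -> nsmall ((base n)%:CC)%:P x.1 x.2.
    by move=> x; rewrite mem_seq1 => /eqP -> /=; exact: nsmall_refl.
  have [V [rV [P EV] eV sV]] := @block R _ _ _ (tol n) 1 h0 r0 t0 hs.
  exists V; split=> //.
    by rewrite EV hornerD hornerM hornerXn hornerC expr1 mul0r addr0.
  by apply: (sV (((base n)%:CC)%:P, kap n)); rewrite mem_seq1.
by have [V hV] := choice h; exists V.
Qed.

Section Fixed.
Variables (kap : nat -> R) (V : nat -> {poly C}).
Hypothesis hV : forall n, [/\ in_range (V n) (height n), (V n).[0] = (base n)%:CC,
    energy (height n) (V n) <= tol n & nsmall (V n) ((base n)%:CC)%:P (kap n)].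

Definition ratio n (z : C) : R := (height n)^-1 * rv (V n) z.

Lemma ratio_in n z : T z -> 0 <= ratio n z <= 1.
Proof.
move=> Tz; have [h _ _ _] := hV n; have /andP[a b] := h z Tz; have h0 := height_gt0 n.
rewrite /ratio; apply/andP; split; first by rewrite mulr_ge0 ?invr_ge0 ?(ltW h0).
by rewrite mulrC ler_pdivrMr// mul1r.
Qed.

Lemma rl_ratio n : rl (ratio n).
Proof. exact: rlM (rl_cst _) (rl_rv _). Qed.

Lemma mean_ratio n : mean (ratio n) = 1 - gap n.
Proof.
have -> : mean (ratio n) = (height n)^-1 * mean (rv (V n)) := meanZ _ (rl_rbmeas (rl_rv _)).
have -> : mean (rv (V n)) = base n.
  have -> : mean (rv (V n)) = complex.Re (cint m (fun z => (V n).[z])) by [].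
  by rewrite cint_poly; have [_ -> _ _] := hV n.
by rewrite /base mulrA mulVf ?mul1r// gt_eqF// height_gt0.
Qed.

Fixpoint wpart j (z : C) : R := if j is k.+1 then wpart k z * ratio k.+1 z else ratio 0 z.

Lemma rl_wpart j : rl (wpart j).
Proof. by elim: j => [|j IH]; [exact: rl_ratio|exact: rlM IH (rl_ratio _)]. Qed.

Lemma wpart_in j z : T z -> 0 <= wpart j z <= 1.
Proof.
move=> Tz; elim: j => [|j /andP[a b]]; first exact: ratio_in.
have /andP[c d] := ratio_in j.+1 Tz; rewrite /= mulr_ge0//=.
by rewrite -[leRHS]mulr1 ler_pM.
Qed.

Lemma wpart_le n j z : T z -> (n <= j)%N -> wpart j z <= ratio n z.
Proof.
move=> Tz; elim: j => [|j IH].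
  by rewrite leqn0 => /eqP ->.
rewrite leq_eqVlt => /orP[/eqP ->|nj] /=.
  by have /andP[a b] := wpart_in j Tz; have /andP[c d] := ratio_in j.+1 Tz; rewrite ler_piMl.
apply: le_trans (IH nj); have /andP[a b] := wpart_in j Tz; have /andP[c d] := ratio_in j.+1 Tz.
by rewrite ler_piMr.
Qed.

(** A product of numbers of [0, 1] is at least 1 minus the sum of their defects. *)
Lemma mean_wpart j : 2^-1 <= mean (wpart j).
Proof.
have key : 1 - \sum_(0 <= i < j.+1) gap i <= mean (wpart j).
  elim: j => [|j IH]; first by rewrite big_nat1 mean_ratio.
  have b1 := rl_rbmeas (rl_wpart j); have b2 := rl_rbmeas (rl_ratio j.+1).
  have E : mean (fun z => wpart j z + (ratio j.+1 z + (-1))) = mean (wpart j) + (mean (ratio j.+1) + (-1)).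
    rewrite meanD//; last exact: rl_rbmeas (rlD (rl_ratio _) (rl_cst _)).
    by rewrite meanD ?mean_cst//; exact: rl_rbmeas (rl_cst _).
  apply: (@le_trans _ _ (mean (wpart j) + (mean (ratio j.+1) + (-1)))).
    by rewrite mean_ratio (big_nat_recr j.+1)//=; move: IH; set s := \sum_(0 <= i < j.+1) _; lra.
  rewrite -E; apply: le_mean.
  - exact: rl_rbmeas (rlD (rl_wpart _) (rlD (rl_ratio _) (rl_cst _))).
  - exact: rl_rbmeas (rl_wpart j.+1).
  move=> z Tz /=; have /andP[a b] := wpart_in j Tz; have /andP[c d] := ratio_in j.+1 Tz.
  by move: (wpart j z) (ratio j.+1 z) a b c d => x y *; nra.
apply: le_trans key; have -> : \sum_(0 <= i < j.+1) gap i = 2^-1 * 2^-1 * \sum_(0 <= i < j.+1) 2^-1 ^+ i.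
  by rewrite mulr_sumr; apply: eq_bigr => i _; rewrite /gap !exprS mulrA.
by have := @half_pow_sum R j.+1; set s := \sum_(0 <= i < j.+1) _; lra.
Qed.

Definition wlim (z : C) : R := limn (fun j => wpart j z).

Lemma wlim_cvg z : T z -> wpart j z @[j --> \oo] --> wlim z.
Proof.
move=> Tz; have ni : nonincreasing_seq (fun j => wpart j z).
  apply/nonincreasing_seqP => j /=; have /andP[a b] := wpart_in j Tz.
  by have /andP[c d] := ratio_in j.+1 Tz; rewrite ler_piMr.
apply: nonincreasing_is_cvgn => //; exists 0 => _ [j _ <-].
by have /andP[] := wpart_in j Tz.
Qed.

Lemma wlim_in z : T z -> 0 <= wlim z <= 1.
Proof.
move=> Tz; have c := wlim_cvg Tz; apply/andP; split.
  by apply: limr_ge; [exact: cvgP c|apply: nearW => j; have /andP[] := wpart_in j Tz].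
by apply: limr_le; [exact: cvgP c|apply: nearW => j; have /andP[] := wpart_in j Tz].
Qed.

Lemma cint_wlim (k : C -> C) : bmeas k -> bmeas (fun z => k z * (wlim z)%:CC) /\
  cint m (fun z => k z * (wpart j z)%:CC) @[j --> \oo] --> cint m (fun z => k z * (wlim z)%:CC).
Proof.
move=> bk; have [_ _ [M hM]] := bk.
apply: (@cint_cvg R m (fun j z => k z * (wpart j z)%:CC) _ M).
- by move=> j; exact: bmeasM bk (rl_rbmeas (rl_wpart j)).
- move=> j z Tz; rewrite normcM normc_real; have /andP[a b] := wpart_in j Tz.
  rewrite ger0_norm//; apply: le_trans (hM z Tz); rewrite ler_piMr ?normc_ge0//.
- move=> z Tz; have c0 : (fun=> k z) @ \oo --> (k z : C) by exact: cvg_cst.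
  have c1 : (fun j => (wpart j z)%:CC) @ \oo --> (wlim z)%:CC by apply: cvg_RC; exact: wlim_cvg.
  exact: (cvgM c0 c1).
Qed.

Lemma wlim_bmeas : rbmeas wlim.
Proof.
have [b _] := cint_wlim (bmeas_cst 1).
by apply: bmeas_ext b => z _; rewrite mul1r.
Qed.

Lemma mean_wlim : 2^-1 <= mean wlim.
Proof.
have [_ c] := cint_wlim (bmeas_cst 1).
have e (u : C -> R) : cint m (fun z => 1 * (u z)%:CC) = cint m (fun z => (u z)%:CC).
  by apply: eq_cint => z _; rewrite mul1r.
have c2 : complex.Re (cint m (fun z => 1 * (wpart j z)%:CC)) @[j --> \oo] --> complex.Re (cint m (fun z => 1 * (wlim z)%:CC)).
  exact: (cvg_Re c).
rewrite /mean -e -(cvg_lim _ c2)//; apply: limr_ge; first exact: cvgP c2.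
by apply: nearW => j; rewrite e; exact: mean_wpart.
Qed.

Definition Ufun (z : C) : C := cint m (fun zeta => herglotz_kernel z zeta * (wlim zeta)%:CC).
Definition bfun (z : C) : C := cexp (- Ufun z).

Lemma hol_U : hol 1 Ufun.
Proof. exact: hol_herglotz wlim_bmeas. Qed.

Lemma hol_b : hol 1 bfun.
Proof.
apply: hol_cexp; apply: (hol_ext (f := fun z => (-1) * Ufun z)); first by move=> z _; rewrite mulN1r.
by apply: holM; [exact: hol_cst|exact: hol_U].
Qed.

Lemma Re_U_gt0 z : normc z < 1 -> 0 < complex.Re (Ufun z).
Proof.
move=> z1; have n0 := normc_ge0 z; set c := (1 - normc z) / (1 + normc z).
have c0 : 0 < c by rewrite divr_gt0//; lra.
apply: (@lt_le_trans _ _ (c * mean wlim)).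
  by rewrite mulr_gt0//; have := mean_wlim; lra.
have -> : c * mean wlim = complex.Re (cint m (fun zeta => c%:CC * (wlim zeta)%:CC)).
  by rewrite (@cintZ R m c%:CC _ wlim_bmeas); exact: esym (Re_scale _ _).
apply: Re_cint_le.
- exact: bmeasM (bmeas_cst _) wlim_bmeas.
- exact: bmeasM (bmeas_herglotz z1) wlim_bmeas.
move=> zeta Tz; rewrite (_ : complex.Re (c%:CC * (wlim zeta)%:CC) = c * wlim zeta); last exact: Re_scale.
rewrite (_ : complex.Re (herglotz_kernel z zeta * (wlim zeta)%:CC) = complex.Re (herglotz_kernel z zeta) * wlim zeta); last exact: Re_scaler.
by apply: ler_wpM2r; [have /andP[] := wlim_in Tz|exact: Re_herglotz_ge].
Qed.

Lemma bfun_self_map : holomorphic_self_map bfun.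
Proof.
split; first exact: (hol_holomorphic (lexx 1) hol_b).
move=> z /discE z1; apply/discE; rewrite /bfun normc_cexp ReN expR_lt1.
by rewrite oppr_lt0; exact: Re_U_gt0.
Qed.

Lemma bfun_outer : outer bfun.
Proof.
have [mw _ _] := wlim_bmeas; have [iw _] := bmeas_integrable m wlim_bmeas.
exists 1, (fun zeta => expR (- wlim zeta)); split.
- by rewrite normr1.
- split; last by move=> zeta _; exact: expR_gt0.
  apply: measurableT_comp; first exact: (measurable_realfun.continuous_measurable_fun (@continuous_expR R)).
  exact: measurable_realfun.measurable_funN.
- have i2 := integrableN iw.
  rewrite (_ : (fun zeta : CplxB R => (ln (expR (- wlim zeta)))%:E) =
    (-%E \o (EFin \o (fun z : CplxB R => complex.Re (wlim z)%:C%C)))%E); first exact: i2.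
  by apply/funext => z /=; rewrite expRK.
- move=> z /discE z1; rewrite mul1r /bfun; congr cexp.
  rewrite -mulN1r /Ufun -cintZ; last exact: bmeasM (bmeas_herglotz z1) wlim_bmeas.
  apply: eq_cint => zeta _; rewrite expRK mulN1r -mulrN; congr (_ * _).
  by apply: complex_ext => //=; rewrite oppr0.
Qed.

Lemma completion_sequence : exists U : nat -> {poly C}, forall j, complex.Im (U j).[0] = 0 /\
  forall z, T z -> rv (U j) z = wpart j z.
Proof. by have [U hU] := choice (fun j => rl_completion (rl_wpart j)); exists U. Qed.

Lemma completion_limit (U : nat -> {poly C}) z : (forall j, complex.Im (U j).[0] = 0 /\
  forall z, T z -> rv (U j) z = wpart j z) -> normc z < 1 -> (U j).[z] @[j --> \oo] --> Ufun z.
Proof.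
move=> hU z1; have [_ c] := cint_wlim (bmeas_herglotz z1).
rewrite (_ : (fun j => (U j).[z]) = (fun j => cint m (fun zeta => herglotz_kernel z zeta * (wpart j zeta)%:CC))).
  exact: c.
apply/funext => j; have [i0 re] := hU j; rewrite -(schwarz_formula i0 z1).
by apply: eq_cint => zeta Tz; rewrite re.
Qed.

Definition Ftest n (z : C) : C := cexp (- ((V n).[z] - (((base n)%:CC)%:P).[z])).

Lemma normc_Ftest n z : normc (Ftest n z) = expR (base n - rv (V n) z).
Proof.
rewrite /Ftest normc_cexp ReN ReB hornerC -[complex.Re (base n)%:CC]/(base n) /rv.
by rewrite opprB.
Qed.

Lemma half_expR n : expR (- (2 * n + 1)%:R) <= (2^-1 ^+ n) ^+ 2 :> R.
Proof.
have e1 : expR (-1) <= 2^-1 :> R.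
  by rewrite expRN lef_pV2 ?posrE ?expR_gt0//; have := @expR_ge1Dx R 1; lra.
have -> : - (2 * n + 1)%:R = (2 * n + 1)%:R * (-1) :> R by rewrite mulrN1.
rewrite expRM_natl -exprM mulnC addn1 exprS.
have e0 : 0 <= expR (-1) :> R by exact: expR_ge0.
apply: (@le_trans _ _ (expR (-1) ^+ (n * 2))).
  by rewrite ler_piMl ?exprn_ge0//; lra.
by rewrite lerXn2r ?nnegrE// invr_ge0.
Qed.

(** If the ratio q is close to 1, then the test function is small; otherwise q is
    at most a multiple of q (1 - q), whose mean is tiny for the blocks. *)
Lemma Ftest_weight n z x : T z -> 0 <= x -> x <= ratio n z -> x <= 1 ->
  normc (Ftest n z) ^+ 2 * expR (2 * x) <= normc (Ftest n z) ^+ 2 + 2 * expR 2 *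
    ((2^-1 ^+ n) ^+ 2 + expR (2 * height n) * (2 / gap n) * (height n ^+ 2)^-1 *
      (rv (V n) z * (height n - rv (V n) z))).
Proof.
move=> Tz x0 xq x1; have h0 := height_gt0 n; have g0 := gap_gt0 n; have g1 := gap_lt1 n.
have /andP[q0 q1] := ratio_in n Tz; set q := ratio n z in xq q0 q1 *.
have vE : rv (V n) z = height n * q by rewrite /q /ratio mulrA mulfV ?mul1r// gt_eqF.
have FE : normc (Ftest n z) ^+ 2 = expR (- (2 * (height n * (q - 1 + gap n)))).
  by rewrite normc_Ftest expr2 -expRD vE /base; congr expR; ring.
rewrite FE vE; set f := expR (- _).
have f0 : 0 <= f by exact: expR_ge0.
have hf : f * q <= (2^-1 ^+ n) ^+ 2 + expR (2 * height n) * (2 / gap n) * (q * (1 - q)).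
  have q2 : 0 <= q * (1 - q) by rewrite mulr_ge0// subr_ge0.
  have c0 : 0 <= expR (2 * height n) * (2 / gap n) by rewrite mulr_ge0 ?expR_ge0// divr_ge0// ltW.
  have [qs|ql] := ltP q (1 - gap n / 2).
    have f1 : f <= expR (2 * height n).
      rewrite /f ler_expR -mulrN ler_pM2l// -mulrN -[leRHS]mulr1 ler_pM2l//.
      by move: q g0 g1 {f f0 FE vE xq q2 c0} q0 q1 qs => q; lra.
    have q3 : q <= (2 / gap n) * (q * (1 - q)).
      rewrite mulrAC ler_pdivlMr//.
      have : q * (gap n / 2) <= q * (1 - q) by rewrite ler_wpM2l//; lra.
      by set a := q * (1 - q); set g := gap n; move: a => a; lra.
    have : f * q <= expR (2 * height n) * ((2 / gap n) * (q * (1 - q))) by apply: ler_pM.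
    have eqq : expR (2 * height n) * (2 / gap n * (q * (1 - q))) =
      expR (2 * height n) * (2 / gap n) * (q * (1 - q)) by exact: mulrA.
    by rewrite eqq => h; apply: le_trans h _; rewrite lerDr sqr_ge0.
  have f1 : f <= expR (- (2 * n + 1)%:R).
    rewrite /f ler_expR lerN2 -height_gap.
    have -> : 2 * (height n * (q - 1 + gap n)) = height n * (2 * (q - 1 + gap n)) by ring.
    by rewrite ler_pM2l//; lra.
  have f2 := le_trans f1 (half_expR n).
  have : f * q <= f by rewrite ler_piMr.
  have := mulr_ge0 c0 q2; lra.
have ex : expR (2 * x) <= 1 + 2 * q * expR 2.
  have e1 : 1 - 2 * x <= expR (- (2 * x)) by have := @expR_ge1Dx R (- (2 * x)); lra.
  have e2 : expR (2 * x) * expR (- (2 * x)) = 1 by rewrite -expRD subrr expR0.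
  have e3 : expR (2 * x) <= expR 2 by rewrite ler_expR; lra.
  have e4 : 0 < expR (2 * x) by exact: expR_gt0.
  have e5 : expR (2 * x) * (1 - 2 * x) <= 1.
    by apply: le_trans (ler_wpM2l (ltW e4) e1) _; rewrite e2.
  have e6 : x * expR (2 * x) <= q * expR 2 by apply: ler_pM => //; exact: ltW.
  by move: (expR (2 * x)) (expR 2) e5 e6 {e1 e2 e3 e4} => u v; nra.
have hE : (height n ^+ 2)^-1 * (height n * q * (height n - height n * q)) = q * (1 - q).
  by field; rewrite gt_eqF.
rewrite -[X in 2 * expR 2 * (_ + X)]mulrA hE.
have : f * expR (2 * x) <= f * (1 + 2 * q * expR 2) by rewrite ler_wpM2l.
have : 2 * expR 2 * (f * q) <= 2 * expR 2 * ((2^-1 ^+ n) ^+ 2 + expR (2 * height n) * (2 / gap n) * (q * (1 - q))).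
  by rewrite ler_wpM2l// mulr_ge0// expR_ge0.
set A := _ + _ * (q * (1 - q)); move: A (expR (2 * x)) (expR 2) => A u v; lra.
Qed.

Definition defect_cst : R := 4 * expR 2.

Lemma hol_Ftest n rho : hol rho (Ftest n).
Proof. exact: hol_expV. Qed.

Lemma rbmeas_normc_sqr (f : C -> C) : bmeas f -> rbmeas (fun z => normc (f z) ^+ 2).
Proof. by move=> bf; apply: bmeas_ext (bmeasM (bmeas_conj bf) bf) => z _; rewrite conj_normc. Qed.

Lemma Ftest_energy n j (U : {poly C}) : (n <= j)%N -> (forall z, T z -> rv U z = wpart j z) ->
  mean (fun z => normc (Ftest n z * cexp U.[z]) ^+ 2) <=
  mean (fun z => normc (Ftest n z) ^+ 2) + defect_cst * (2^-1 ^+ n) ^+ 2.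
Proof.
move=> nj hU; have h0 := height_gt0 n; have g0 := gap_gt0 n.
have r1 : (1 : R) < 2 by rewrite ltr1n.
have bF := hol_bmeas1 (hol_Ftest n 2) r1.
have bU := hol_bmeas1 (hol_cexp (hol_poly 2 U)) r1.
pose c : R := 2 * expR 2; pose a : R := (2^-1 ^+ n) ^+ 2.
pose d : R := expR (2 * height n) * (2 / gap n) * (height n ^+ 2)^-1.
pose P z := rv (V n) z * (height n - rv (V n) z).
have rP : rl P.
  have := rlM (rl_rv (V n)) (rlD (rl_cst (height n)) (rlM (rl_cst (-1)) (rl_rv (V n)))).
  by apply: laurent_ext => z _; rewrite mulN1r.
have b1 := rbmeas_normc_sqr bF; have b2 := rl_rbmeas (rlD (rl_cst (c * a)) (rlM (rl_cst (c * d)) rP)).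
apply: (@le_trans _ _ (mean (fun z => normc (Ftest n z) ^+ 2 + (c * a + c * d * P z)))).
  apply: le_mean; [exact: rbmeas_normc_sqr (bmeasM bF bU) | |move=> z Tz].
    by apply: bmeas_ext (bmeasD b1 b2) => z _; rewrite -rmorphD.
  rewrite normcM exprMn normc_cexp -[complex.Re _]/(rv U z) hU//.
  have -> : expR (wpart j z) ^+ 2 = expR (2 * wpart j z) by rewrite expr2 -expRD; congr expR; ring.
  have /andP[w0 w1] := wpart_in j Tz.
  apply: le_trans (Ftest_weight Tz w0 (wpart_le Tz nj) w1) _.
  by rewrite lerD2l -/c -/a -/d -/(P z) mulrDr mulrA.
rewrite meanD// lerD2l meanD; [|exact: rl_rbmeas (rl_cst _)|exact: rl_rbmeas (rlM (rl_cst _) rP)].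
rewrite mean_cst meanZ; last exact: rl_rbmeas rP.
have d0 : 0 <= d.
  by rewrite mulr_ge0 ?invr_ge0 ?exprn_ge0 ?(ltW h0)// mulr_ge0 ?expR_ge0// divr_ge0// ltW.
have c0 : 0 <= c by rewrite mulr_ge0// expR_ge0.
have he : d * mean P <= a.
  have [_ _ he _] := hV n; apply: le_trans (ler_wpM2l d0 he) _.
  rewrite le_eqVlt; apply/orP; left; apply/eqP; rewrite /d /tol -/a.
  have ee : expR (2 * height n) * expR (- (2 * height n)) = 1 by rewrite -expRD subrr expR0.
  transitivity ((expR (2 * height n) * expR (- (2 * height n))) * a); last by rewrite ee mul1r.
  have alg (u v x g y : R) : 0 < x -> 0 < g ->
      u * (2 / g) / x ^+ 2 * (x ^+ 2 * (g / 2) * v * y) = u * v * y.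
    by move=> x0 g0'; field; rewrite (gt_eqF x0) (gt_eqF g0').
  exact: alg.
have := ler_wpM2l c0 he; rewrite mulrA /defect_cst -/a => h.
have -> : 4 * expR 2 * a = c * a + c * a by rewrite /c; ring.
by rewrite lerD2l.
Qed.

End Fixed.
End OuterFunction.

(** * Test functions in H(b) *)

Section PartTwo.
Variable R : realType.
Local Notation C := (Cplx R).
Local Notation T := (@circle R).
Local Notation m := (@circle_measure R).
Local Notation "x %:CC" := (x%:C%C : C) (at level 2, format "x %:CC").

(** Phi dominates the square near 0, and a linear function away from 0. *)
Lemma young_l2 (Phi : R -> R) (x : nat -> R) (S : R) : young_function Phi ->
  (Phi x / x ^+ 2) @[x --> 0^'+] --> +oo -> (forall n, 0 <= x n) ->
  (forall N, \sum_(0 <= n < N) Phi (x n) <= S) ->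
  exists S2, forall N, \sum_(0 <= n < N) x n ^+ 2 <= S2.
Proof.
move=> hPhi hgr x0 hS.
have [del del0 hdel] : exists2 del, 0 < del & forall x, 0 < x -> x < del -> x ^+ 2 <= Phi x.
  move/cvgryPge : hgr => /(_ 1); rewrite near_withinE => /nbhs_ballP [del /= del0 h].
  exists del => // y y0 yd.
  have := h y; rewrite -ball_normE /ball_ /= sub0r normrN gtr0_norm// => /(_ yd y0).
  by rewrite ler_pdivlMr ?mul1r// exprn_gt0.
pose e := del / 2; have e0 : 0 < e by rewrite divr_gt0.
have ed : e < del by rewrite /e; lra.
have Pe : 0 < Phi e by have [_ _ h _] := hPhi; exact: h.
pose A := e / Phi e; have A0 : 0 < A by rewrite divr_gt0.
have P0 n : 0 <= Phi (x n) by exact: young_ge0.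
have PS n : Phi (x n) <= S.
  apply: le_trans (hS n.+1); rewrite big_nat_recr//= lerDr sumr_ge0// => i _; exact: P0.
have S0 : 0 <= S by apply: le_trans (PS 0%N); exact: P0.
exists ((1 + A ^+ 2 * S) * S) => N.
apply: (@le_trans _ _ (\sum_(0 <= n < N) (1 + A ^+ 2 * S) * Phi (x n))); last first.
  by rewrite -mulr_sumr ler_wpM2l// addr_ge0// mulr_ge0// sqr_ge0.
apply: ler_sum => n _; have AS : 0 <= A ^+ 2 * S by rewrite mulr_ge0// sqr_ge0.
have [xs|xl] := ltP (x n) e.
  have h : x n ^+ 2 <= Phi (x n).
    have := x0 n; rewrite le_eqVlt => /orP[/eqP <-|xp]; first by rewrite expr0n; exact: young_ge0.
    by apply: hdel => //; exact: lt_trans ed.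
  by rewrite mulrDl mul1r; have := mulr_ge0 AS (P0 n); lra.
have h1 : x n <= A * Phi (x n).
  by rewrite /A mulrAC ler_pdivlMr//; exact: young_slope.
have h2 : A * Phi (x n) <= A * S by rewrite ler_pM2l.
have h3 : x n ^+ 2 <= (A * Phi (x n)) * (A * S).
  by rewrite expr2; apply: ler_pM => //; exact: le_trans h2.
apply: le_trans h3 _; rewrite mulrDl mul1r.
have -> : A * Phi (x n) * (A * S) = A ^+ 2 * S * Phi (x n) by ring.
by rewrite lerDr.
Qed.

Lemma sum_sqr_cvg (u_ : nat -> nat -> C) (u : nat -> C) N : (forall n, u_ j n @[j --> \oo] --> u n) ->
  \sum_(0 <= n < N) normc (u_ j n) ^+ 2 @[j --> \oo] --> \sum_(0 <= n < N) normc (u n) ^+ 2.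
Proof.
move=> hu; pose s N (b : nat -> C) : R := \sum_(0 <= n < N) normc (b n) ^+ 2.
have s0 b : s 0%N b = 0 by rewrite /s big_geq.
have sS N' b : s N'.+1 b = s N' b + normc (b N') ^+ 2 by rewrite /s big_nat_recr.
suff : (fun j => s N (u_ j)) @ \oo --> s N u by [].
clearbody s; elim: N => [|N IH].
  have -> : (fun j => s 0%N (u_ j)) = (fun=> 0) by apply/funext => j; exact: s0.
  by rewrite s0; exact: cvg_cst.
have -> : (fun j => s N.+1 (u_ j)) = (fun j => s N (u_ j) + normc (u_ j N) ^+ 2).
  by apply/funext => j; exact: sS.
have cn : normc (u_ j N) @[j --> \oo] --> normc (u N) by apply: cvg_normc; exact: hu.
rewrite sS; exact: (cvgD IH (cvgM cn cn)).
Qed.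

Section Fixed.
Variables (kap : nat -> R) (V : nat -> {poly C}).
Hypothesis hV : forall n, [/\ in_range (V n) (height R n), (V n).[0] = (base R n)%:CC,
    energy (height R n) (V n) <= tol R n & nsmall (V n) ((base R n)%:CC)%:P (kap n)].

Let F := Ftest V.
Let b := bfun V.

Lemma F_at0 i : taylor (F i) 0 = 1.
Proof.
rewrite taylor_at0 /F /Ftest hornerC; have [_ -> _ _] := hV i.
by rewrite subrr oppr0 cexp0.
Qed.

Lemma F_le i z : 0 <= rv (V i) z -> normc (F i z) <= expR (base R i).
Proof. by move=> h; rewrite /F normc_Ftest ler_expR; lra. Qed.

Lemma F_small i n : (0 < n)%N -> normc (taylor (F i) n) <= kap i.
Proof.
move=> n0; have [_ _ _ [k' /ltW kk h]] := hV i; exact: le_trans (h n n0) kk.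
Qed.

Lemma F_sum i N : \sum_(0 <= n < N) normc (taylor (F i) n) ^+ 2 <= expR (base R i) ^+ 2.
Proof.
apply: (@bessel R 2); [exact: hol_Ftest|by rewrite ltr1n|].
by move=> z Tz; apply: F_le; have [r _ _ _] := hV i; have /andP[] := r z Tz.
Qed.

Let FF k i (z : C) : C := z ^+ k * F i z.
Let gg k i (z : C) : C := z ^+ k * (F i z * cexp (Ufun V z)).

Lemma hol_FF k i rho : hol rho (FF k i).
Proof. by apply: holM; [exact: holX|exact: hol_Ftest]. Qed.

Lemma hol_gg k i : hol 1 (gg k i).
Proof.
apply: holM; first exact: holX.
apply: holM; first exact: hol_Ftest.
by apply: hol_cexp; exact: (hol_U hV).
Qed.

Lemma FF_factor k i (z : C) : FF k i z = b z * gg k i z.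
Proof.
rewrite /FF /gg /b /bfun.
have e : cexp (- Ufun V z) * cexp (Ufun V z) = 1 by rewrite -cexpD addNr cexp0.
transitivity (z ^+ k * (F i z * (cexp (- Ufun V z) * cexp (Ufun V z)))); first by rewrite e mulr1.
by move: (cexp _) (cexp _) (z ^+ k) (F i z) => p q r s; ring.
Qed.

Lemma mean_FF k i : (fun N => \sum_(0 <= n < N) normc (taylor (FF k i) n) ^+ 2) @ \oo -->
  mean (fun z => normc (F i z) ^+ 2).
Proof.
have -> : mean (fun z => normc (F i z) ^+ 2) = mean (fun z => normc (FF k i z) ^+ 2).
  by apply: eq_mean => z /circle_normc z1; rewrite /FF normcM normcX z1 expr1n mul1r.
by apply: (@parseval R 2); [exact: hol_FF|rewrite ltr1n].
Qed.

(** The modulus of F / b on the circle is not available for the limit b, only for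
    the products of finitely many factors, where it is a trigonometric polynomial.
    The Taylor coefficients pass to the limit. *)
Lemma gg_sum k i N : \sum_(0 <= n < N) normc (taylor (gg k i) n) ^+ 2 <=
  mean (fun z => normc (F i z) ^+ 2) + defect_cst R * (2^-1 ^+ i) ^+ 2.
Proof.
have [U hU] := completion_sequence V.
pose gj j (z : C) : C := z ^+ k * (F i z * cexp (U j).[z]).
have hgj j rho : hol rho (gj j).
  apply: holM; first exact: holX.
  apply: holM; first exact: hol_Ftest.
  by apply: hol_cexp; exact: hol_poly.
have rU j : in_range (U j) 1.
  by move=> z Tz; have [_ ->] := hU j => //; exact: (wpart_in hV j Tz).
have im0 : complex.Im (V i).[0] = 0 by have [_ -> _ _] := hV i.
have cg n : taylor (gj j) n @[j --> \oo] --> taylor (gg k i) n.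
  apply: (@taylor_cvg R gj (gg k i) (expR (base R i) * expR 1)) => [j||j z z1|z z1].
  - exact: hgj.
  - exact: hol_gg.
  - rewrite /gj !normcM normcX -[leRHS]mul1r; apply: ler_pM; rewrite ?mulr_ge0 ?normc_ge0 ?exprn_ge0 ?normc_ge0//.
      by rewrite exprn_ile1 ?normc_ge0// ltW.
    apply: ler_pM; rewrite ?normc_ge0//.
      by apply: F_le; have [r _ _ _] := hV i; have /andP[] := in_range_disc r im0 z1.
    rewrite normc_cexp ler_expR.
    by have /andP[] := in_range_disc (rU j) (hU j).1 z1.
  - have cU := cvg_cexp (completion_limit hV hU z1).
    have c1 : (fun=> z ^+ k) @ \oo --> (z ^+ k : C) by exact: cvg_cst.
    have c2 : (fun=> F i z) @ \oo --> (F i z : C) by exact: cvg_cst.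
    exact: (cvgM c1 (cvgM c2 cU)).
have c := @sum_sqr_cvg (fun j n => taylor (gj j) n) (fun n => taylor (gg k i) n) N cg.
rewrite -(cvg_lim _ c)//; apply: limr_le; first exact: cvgP c.
exists i => // j /= ij.
have r1 : (1 : R) < 2 by rewrite ltr1n.
have p := parseval (hgj j 2) r1.
apply: le_trans (Ftest_energy hV ij (hU j).2).
have -> : mean (fun z => normc (Ftest V i z * cexp (U j).[z]) ^+ 2) = mean (fun z => normc (gj j z) ^+ 2).
  by apply: eq_mean => z /circle_normc z1; rewrite /gj [in RHS]normcM normcX z1 expr1n mul1r.
have nd : nondecreasing_seq (fun N => \sum_(0 <= n < N) normc (taylor (gj j) n) ^+ 2).
  by apply: nondecreasing_series => n _ _; exact: sqr_ge0.
have := nondecreasing_cvgn_le nd (cvgP _ p) N.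
by rewrite (cvg_lim _ p).
Qed.

Lemma b_test (f : C -> C) (S2 : R) k : deBranges_Rovnyak b f ->
  (forall N, \sum_(0 <= n < N) normc (taylor f n) ^+ 2 <= S2) ->
  exists A, forall i, exists2 N, (k < N)%N &
  normc (\sum_(0 <= n < N) taylor f n * (if (k <= n)%N then taylor (F i) (n - k)%N else 0)^*%C) <= A * 2^-1 ^+ i.
Proof.
move=> [H [ip [hr Hf]]] fS.
exists ((complex.Re (ip f f) + defect_cst R) / 2 + 1) => i'.
have p0 : 0 < 2 ^+ i' :> R by rewrite exprn_gt0.
have e0 : 0 < 2^-1 ^+ i' :> R by rewrite exprn_gt0// invr_gt0.
have [N kN hN] := rkhs_test hr k Hf fS (hol_FF k i' 1) (hol_gg k i')
  (fun z _ => FF_factor k i' z) (gg_sum k i') (@mean_FF k i') (lexx _) p0 e0.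
exists N => //.
have -> : \sum_(0 <= n < N) taylor f n * (if (k <= n)%N then taylor (F i') (n - k)%N else 0)^*%C =
    \sum_(0 <= n < N) taylor f n * (taylor (FF k i') n)^*%C :> C.
  by apply: eq_bigr => n _; rewrite /FF (taylor_mulXn k n ltr01 (hol_Ftest V i' 1)).
apply: le_trans hN _; rewrite le_eqVlt; apply/orP; left; apply/eqP.
rewrite exprVn; move: (2 ^+ i') p0 (complex.Re _) (defect_cst R) => p p0 x y.
by field; rewrite gt_eqF.
Qed.

End Fixed.

Lemma outer_test (Phi : R -> R) : young_function Phi ->
  (Phi x / x ^+ 2) @[x --> 0^'+] --> +oo ->
  exists2 b : C -> C, outer b /\ holomorphic_self_map b &
    forall f, deBranges_Rovnyak b f ->
      (\sum_(0 <= n <oo) (Phi (normc (taylor f n)))%:E < +oo)%E ->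
      forall z, disc z -> f z = 0.
Proof.
move=> hPhi hgr.
have [kap hk] := @orlicz_scale R Phi (fun i => expR (base R i) ^+ 2) hPhi hgr (fun i => sqr_ge0 _).
have [V hV] := outer_blocks (fun i => (hk i).1).
exists (bfun V); first by split; [exact: (bfun_outer hV)|exact: (bfun_self_map hV)].
move=> f mf hsum.
have [S hS] : exists S, forall N, \sum_(0 <= n < N) Phi (normc (taylor f n)) <= S.
  by apply: nneseries_bound hsum => n; exact: young_ge0 hPhi (normc_ge0 _).
have [S2 hS2] := young_l2 hPhi hgr (fun n => normc_ge0 (taylor f n)) hS.
have hf : holomorphic f by have [H [ip [hr Hf]]] := mf; exact: (rkhs_holomorphic hr).
apply: taylor_vanish => // k; have [A hA] := b_test hV k mf hS2.
exists (1 + S + A) => i; have [N kN hN] := hA i; have [kp dual] := hk i.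
have e0 : 0 <= 2^-1 ^+ i :> R by rewrite exprn_ge0// invr_ge0.
rewrite mulrDl [(1 + S) * _]mulrC.
have h := coef_small dual e0 (ltW kp) hS (F_at0 hV i) (fun n n0 => F_small hV i n0) (F_sum hV i) kN.
by apply: le_trans h _; rewrite lerD2l.
Qed.

End PartTwo.

(** * The two uniqueness theorems *)

Theorem corollary2p2 (R : realType) (Phi : R -> R)
  (hPhi : young_function Phi)
  (hPhi2 : (Phi x / x ^+ 2) @[x --> 0^'+] --> +oo) :
  (exists2 Theta : Cplx R -> Cplx R, singular_inner Theta &
     forall f, model_space Theta f ->
       (\sum_(0 <= n <oo) (Phi (normc (taylor f n)))%:E < +oo)%E ->
       forall z, disc z -> f z = 0)
  /\
  (exists2 b : Cplx R -> Cplx R, outer b /\ holomorphic_self_map b &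
     forall f, deBranges_Rovnyak b f ->
       (\sum_(0 <= n <oo) (Phi (normc (taylor f n)))%:E < +oo)%E ->
       forall z, disc z -> f z = 0).
Proof.
split; first exact: singular_inner_test hPhi hPhi2.
exact: outer_test hPhi hPhi2.
Qed.
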